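(* Let $\Sigma=(f,g)$, $\dot\xi=f(\xi)+g(\xi)u$, $u\in\mathbb{R}$, be a control-affine system on a $3$-dimensional manifold $\mathcal{M}$ satisfying, at every point, $f\wedge g\wedge[g,f]\neq0$ and $g\wedge[g,f]\wedge[g,[g,f]]\neq0$. Let $(f_c,g_c)$ be its canonical pair, and let $\kappa$ and $\nu$ be its curvature and its centro-affine curvature. Then $\Sigma$ is locally trivialisable if and only if $$\kappa=0,\qquad L_{f_c}(\nu)=0,\qquad\text{and}\qquad L_{[f_c,g_c]}(\nu)=0 .$$
   Context: All objects are $C^\infty$-smooth; $L_v(\lambda)$ is the Lie derivative of the function $\lambda$ along the vector field $v$. The brackets are such that $L_{[f,g]}=L_fL_g-L_gL_f$. Structure functions: under the two regularity assumptions in the claim, there are unique smooth functions $k_1,k_2,k_3,\lambda_1,\lambda_2,\lambda_3$ with $$[f,[f,g]]=k_1g+k_2[g,f]+k_3[g,[g,f]],\qquad [g,[g,f]]=\lambda_1f+\lambda_2g+\lambda_3[g,f],$$ and $\lambda_1\neq0$ everywhere. A pair $(f,g)$ is called canonical if $k_3\equiv0$ and $\lambda_1\equiv\pm1$. Every $\Sigma=(f,g)$ as in the claim is feedback equivalent to the system given by the canonical pair $f_c=f+k_3g$, $g_c=|\lambda_1|^{-1/2}g$, which is unique up to $g_c\mapsto-g_c$. For the canonical pair one has $$[f_c,[f_c,g_c]]=\kappa g_c,\qquad [g_c,[g_c,f_c]]=\varepsilon f_c+\mu g_c+\nu[g_c,f_c],\qquad \varepsilon=\pm1,$$ and this defines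 the curvature $\kappa$ and the centro-affine curvature $\nu$ ($\nu$ is defined up to the sign change induced by $g_c\mapsto-g_c$). Feedback equivalence: $(f,g)$ and $(\tilde f,\tilde g)$ are (locally) feedback equivalent if there are a (local) diffeomorphism $\phi$ and smooth functions $\alpha$, $\beta\neq0$ with $\tilde f=\phi_*(f+g\alpha)$ and $\tilde g=\phi_*(g\beta)$. $\Sigma$ is locally trivialisable if, around each point, it is locally feedback equivalent to a trivial system $\dot x=F_1(w)$, $\dot y=F_2(w)$, $\dot w=u$, with $F_1,F_2$ smooth functions of $w$ only. *)

(* Defs.v *)
From HB Require Import structures.
From mathcomp Require Import all_boot all_order all_algebra.
From mathcomp Require Import all_classical all_reals all_analysis.

Set Implicit Arguments.
Unset Strict Implicit.
Unset Printing Implicit Defensive.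

Import Order.TTheory GRing.Theory Num.Theory.
Import numFieldNormedType.Exports.

Local Open Scope classical_set_scope.
Local Open Scope ring_scope.

Section SmoothOn.
Context (R : realType) (V : normedModType R).

(* C^k on U, for U open: the values of f outside U play no role. *)
Fixpoint Ck_on (W : normedModType R) (k : nat) (U : set V) (f : V -> W) : Prop :=
  if k is k'.+1 then
    (forall x, U x -> differentiable f x) /\
    (forall v, Ck_on k' U (fun x => 'D_v f x))
  else forall x, U x -> {for x, continuous f}.

Definition smooth_on (W : normedModType R) (U : set V) (f : V -> W) : Prop :=
  forall k, Ck_on k U f.

Lemma smooth_on_cst (W : normedModType R) (U : set V) (a : W) :
  smooth_on U (fun=> a).
Proof.
move=> k; elim: k a => [|k IH] a /=; first by move=> x _; exact: cst_continuous.
split=> [x _|v]; first exact: differentiable_cst.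
by under eq_fun do rewrite derive_cst; exact: IH.
Qed.

Lemma smooth_on_id (U : set V) : smooth_on U (fun x => x).
Proof.
case=> [|k] /=; first by move=> x _.
split=> [x _|v]; first by apply: ex_diff; exact: is_diff_id.
by under eq_fun do rewrite derive_id; exact: smooth_on_cst.
Qed.

End SmoothOn.

Section Manifolds.
Context (R : realType) (n : nat).

(* [cinv] is only meaningful on [cmap @` dom]. *)
Record chart (M : topologicalType) := Chart {
  dom : set M;
  cmap :> M -> 'rV[R]_n;
  cinv : 'rV[R]_n -> M;
  dom_open : open dom;
  cod_open : open (cmap @` dom);
  cmapK : forall p, dom p -> cinv (cmap p) = p;
  cmap_continuous : forall p, dom p -> {for p, continuous cmap};
  cinv_continuous : forall x, (cmap @` dom) x -> {for x, continuous cinv}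
}.

(* The atlas need not be maximal. [chart_at] selects, at each point p, a chart
   around p; the coordinates it provides identify T_pM with R^n. *)
Record manifold := Manifold {
  carrier :> topologicalType;
  carrier_hausdorff : hausdorff_space carrier;
  carrier_second_countable : @second_countable carrier;
  atlas : set (chart carrier);
  chart_at : carrier -> chart carrier;
  chart_at_atlas : forall p, atlas (chart_at p);
  chart_at_dom : forall p, dom (chart_at p) p;
  atlas_compatible : forall c d, atlas c -> atlas d ->
    smooth_on (c @` (dom c `&` dom d)) (d \o cinv c)
}.

End Manifolds.

Section Euclidean.
Context (R : realType) (n : nat).

Local Notation E := 'rV[R]_n.

Lemma euclidean_hausdorff : hausdorff_space E.
Proof. exact: (@norm_hausdorff R 'rV[R]_n). Qed.

Lemma euclidean_second_countable : @second_countable E.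
Proof.
pose box (q : 'rV[rat]_n * rat) : set E :=
  [set x | forall i, `|ratr (q.1 0 i) - x 0 i| < ratr q.2].
exists (range box); first exact: sub_countable (card_image_le _ _) (countableP _).
split.
  move=> _ [q _ <-]; rewrite openE => x /= xq.
  apply: (@filter_forall E _ _ (nbhs x) _) => i.
  have : nbhs (x 0 i) (ball (ratr (q.1 0 i) : R) (ratr q.2)).
    exact: (open_nbhs_nbhs (conj (@ball_open R R^o _ _) (xq i))).
  exact: (@coord_continuous R 1 n 0 i x).
move=> x V /nbhs_ballP[e /= e0 eV].
have [r] : exists2 r : rat, True & (0 < (ratr r : R)) && (ratr r < e / 2).
  have /rat_in_itvoo[r] : (0 : R) < e / 2 by rewrite divr_gt0.
  by rewrite in_itv /=; exists r.
move=> _ /andP[r0 re].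
have /choice[q qP] i : exists q : rat, `|ratr q - x 0 i| < ratr r.
  have /rat_in_itvoo[q] : x 0 i - ratr r < x 0 i + ratr r.
    by rewrite ltrD2l gtrN.
  by rewrite in_itv /= => qr; exists q; rewrite ltr_distl.
exists (box (\row_i q i, r)); first split; first by exists (\row_i q i, r).
  by move=> i; rewrite /= mxE.
move=> y yq; apply: eV; split=> // j i; rewrite ord1.
have := yq i; rewrite /= mxE => yqi.
apply: (@ball_splitr R R^o (ratr (q i))).
  exact: lt_trans (qP i) re.
exact: lt_trans yqi re.
Qed.

Lemma id_codomain_open : open (id @` [set: E]).
Proof. by rewrite image_id; exact: openT. Qed.

Definition id_chart : chart R n E :=
  @Chart R n E setT id id openT id_codomain_open
    (fun _ _ => erefl) (fun _ _ => @cvg_id _ _) (fun _ _ => @cvg_id _ _).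

Lemma id_chart_compatible (c d : chart R n E) :
  [set id_chart] c -> [set id_chart] d ->
  smooth_on (c @` (dom c `&` dom d)) (d \o cinv c).
Proof. by move=> -> ->; exact: smooth_on_id. Qed.

Definition euclidean : manifold R n :=
  @Manifold R n E euclidean_hausdorff euclidean_second_countable
    [set id_chart] (fun=> id_chart) (fun=> erefl) (fun=> I) id_chart_compatible.

End Euclidean.

Section Calculus.
Context (R : realType) (n : nat) (M : manifold R n).
Implicit Types (v w : M -> 'rV[R]_n) (lam : M -> R) (p : M).

(* A vector field is given by its components v p in the chart [chart_at p];
   [in_chart c v] is its component function in the chart c. *)
Definition in_chart (c : chart R n M) v (x : 'rV[R]_n) : 'rV[R]_n :=
  let p := cinv c x in
  'D_(v p) (c \o cinv (chart_at p)) (chart_at p p).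

Definition smooth_field v : Prop :=
  forall c : chart R n M, atlas c -> smooth_on (c @` dom c) (in_chart c v).

Definition smooth_function (U : set M) lam : Prop :=
  forall c : chart R n M, atlas c ->
    smooth_on (c @` (dom c `&` U)) (lam \o cinv c : 'rV[R]_n -> R^o).

Definition lie_derivative v lam p : R :=
  'D_(v p) (lam \o cinv (chart_at p) : 'rV[R]_n -> R^o) (chart_at p p).

(* The sign is such that L_[v,w] = L_v L_w - L_w L_v. *)
Definition lie_bracket v w p : 'rV[R]_n :=
  let c := chart_at p in
  'D_(v p) (in_chart c w) (c p) - 'D_(w p) (in_chart c v) (c p).

End Calculus.

Section LocalDiffeomorphisms.
Context (R : realType) (n : nat).

Definition smooth_map (M N : manifold R n) (U : set M) (phi : M -> N) : Prop :=
  (forall p, U p -> {for p, continuous phi}) /\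
  (forall (c : chart R n M) (d : chart R n N), atlas c -> atlas d ->
     smooth_on (c @` (dom c `&` U `&` phi @^-1` dom d)) (d \o phi \o cinv c)).

(* The differential of phi at p, in the coordinates given by [chart_at p] and
   [chart_at (phi p)]. *)
Definition differential_at (M N : manifold R n) (phi : M -> N) (p : M)
    (a : 'rV[R]_n) : 'rV[R]_n :=
  'D_a (chart_at (phi p) \o phi \o cinv (chart_at p)) (chart_at p p).

Definition diffeomorphism_between (M N : manifold R n) (U : set M) (V : set N)
    (phi : M -> N) (psi : N -> M) : Prop :=
  [/\ phi @` U `<=` V, psi @` V `<=` U,
      forall p, U p -> psi (phi p) = p, forall q, V q -> phi (psi q) = q
    & smooth_map U phi /\ smooth_map V psi].

(* Local feedback equivalence near p; the base point phi p in N is free. *)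
Definition feedback_equivalent_near (M N : manifold R n) (p : M)
    (f g : M -> 'rV[R]_n) (f' g' : N -> 'rV[R]_n) : Prop :=
  exists (U : set M) (V : set N) (phi : M -> N) (psi : N -> M)
         (alpha beta : M -> R),
    [/\ open U /\ U p, open V, diffeomorphism_between U V phi psi,
        [/\ smooth_function U alpha, smooth_function U beta
          & forall q, U q -> beta q != 0]
      & forall q, U q ->
          f' (phi q) = differential_at phi q (f q + alpha q *: g q) /\
          g' (phi q) = differential_at phi q (beta q *: g q)].

End LocalDiffeomorphisms.

Section TrivialSystems.
Context (R : realType).

(* Coordinates on R^3 are (x, y, w), numbered 0, 1, 2. *)
Definition trivial_drift (F1 F2 : R -> R) (z : euclidean R 3) : 'rV[R]_3 :=
  let w := (z : 'rV[R]_3) 0 ord_max in \row_i [:: F1 w; F2 w; 0]`_i.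

Definition trivial_control (z : euclidean R 3) : 'rV[R]_3 :=
  \row_i [:: 0; 0; 1]`_i.

Definition locally_trivialisable (M : manifold R 3) (f g : M -> 'rV[R]_3) :=
  forall p : M, exists F1 F2 : R -> R,
    [/\ smooth_on [set: R^o] (F1 : R^o -> R^o),
        smooth_on [set: R^o] (F2 : R^o -> R^o)
      & feedback_equivalent_near p f g (trivial_drift F1 F2) trivial_control].

End TrivialSystems.

Section StructureFunctions.
Context (R : realType) (M : manifold R 3).
Implicit Types (f g : M -> 'rV[R]_3) (p : M).

Local Notation "{[ v , w ]}" := (lie_bracket v w).

(* The coefficient of a /\ b /\ c in the basis of Lambda^3 R^3. *)
Definition wedge3 (a b c : 'rV[R]_3) : R :=
  \det (\matrix_(i < 3) [:: a; b; c]`_i).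

Definition regular f g : Prop := forall p,
  wedge3 (f p) (g p) ({[g, f]} p) != 0 /\
  wedge3 (g p) ({[g, f]} p) ({[g, {[g, f]}]} p) != 0.

Definition structure_functions f g (k1 k2 k3 l1 l2 l3 : M -> R) : Prop :=
  [/\ [/\ smooth_function setT k1, smooth_function setT k2
         & smooth_function setT k3],
      [/\ smooth_function setT l1, smooth_function setT l2
         & smooth_function setT l3],
      forall p, {[f, {[f, g]}]} p =
        k1 p *: g p + k2 p *: {[g, f]} p + k3 p *: {[g, {[g, f]}]} p
    & forall p, {[g, {[g, f]}]} p =
        l1 p *: f p + l2 p *: g p + l3 p *: {[g, f]} p].

(* The sign s accounts for gc being unique only up to gc |-> - gc. *)
Definition canonical_pair_of f g fc gc : Prop :=
  exists (k1 k2 k3 l1 l2 l3 : M -> R) (s : bool),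
    [/\ structure_functions f g k1 k2 k3 l1 l2 l3,
        forall p, fc p = f p + k3 p *: g p
      & forall p, gc p = ((-1) ^+ s / Num.sqrt `|l1 p|) *: g p].

(* [eps] is a locally constant sign; M is not assumed to be connected. *)
Definition curvatures fc gc (kappa nu : M -> R) : Prop :=
  [/\ smooth_function setT kappa, smooth_function setT nu
    & exists eps mu : M -> R,
      [/\ smooth_function setT mu,
          forall p, eps p = 1 \/ eps p = -1,
          forall p, {[fc, {[fc, gc]}]} p = kappa p *: gc p
        & forall p, {[gc, {[gc, fc]}]} p =
            eps p *: fc p + mu p *: gc p + nu p *: {[gc, fc]} p]].

End StructureFunctions.

(* Main.v *)
(* In a chart write X = fc, Y = gc, H = [Y, X], so that [X, [X, Y]] = kappa Y and
   [Y, H] = eps X + mu Y + nu H.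

   Trivialisable => flat.  Let f1 = f + alpha g, g1 = beta g be the fields which
   a trivialising diffeomorphism sends to F(w) and d/dw, and h1 = [g1, f1],
   m = [g1, h1].  Then h1, m are sent to F'(w), F''(w), so f1, h1, m commute
   and m has no d/dw component.  Writing X = f1 + a g1, Y = b g1, the
   f1-component of [X, [X, Y]] = kappa Y gives a = 0.  Hence
   m = (eps / b^2) f1 + sigma h1 with sigma b = nu - g1(b).  As f1 and h1 commute
   with f1, h1 and m, they kill the coefficients of m, hence b, and then nu; and
   kappa = 0 since f1(b) = 0.

   Flat => trivialisable.  Jacobi gives mu = 0, so X, H commute,
   [Y, H] = eps X + nu H, and eps, nu are killed by X and H.  The 1-form theta
   dual to Y is then closed, theta = dw.  For a, b with da = b theta and
   db = (eps a + nu b) theta, the 1-form which is a on X, b on H and 0 on Y is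
   closed too.  The two independent solutions (a_i, b_i) give potentials x_1, x_2,
   and (x_1, x_2, w) are coordinates in which X = (a_1(w), a_2(w), 0) and Y = d/dw.
   A final change of the variable w makes a_1, a_2 globally defined. *)

Require Import Defs.
From HB Require Import structures.
From mathcomp Require Import all_boot all_order all_algebra.
From mathcomp Require Import all_classical all_reals all_analysis.
From mathcomp Require Import ring lra.

Set Implicit Arguments.
Unset Strict Implicit.
Unset Printing Implicit Defensive.

Import Order.TTheory GRing.Theory Num.Theory.
Import numFieldNormedType.Exports.

Local Open Scope classical_set_scope.
Local Open Scope ring_scope.

(** * Directional derivatives *)

(** The linear system is the equation of the drift in disguise: if X = F(w) and Y = d/dw, then H =
    F' and [Y, H] = F'', so [Y, H] = eps X + nu H reads F'' = eps F + nu F', and (a, b) stands for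
    one entry of (F, F'). The obstacle is that w does not yet belong to a coordinate system when
    this equation has to be solved. It is therefore solved on a ball of the chart, as an equation
    between 1-forms: eps, nu and all Picard iterates are killed by X and H, so every right-hand side
    is a closed multiple of theta, and the Poincare lemma performs each integration in place of a
    flow. The initial values (1, 0) and (0, 1) make d x_1, d x_2, dw the dual basis at the centre,
    where the inverse function theorem then applies. In the converse direction, independence of f,
    g, [g, f] survives every feedback, so (f1, h1, g1) is a frame and bracket relations can be
    compared coefficient by coefficient. The bracket on the manifold uses a chart that varies with
    the point; transition maps relate it to the bracket in one fixed chart, where all computations
    take place. *)

Section Differentials.
Context {R : realType}.

Section DirectionalDerivatives.
Context {V W : normedModType R}.
Implicit Types (f g : V -> W) (a : V -> R^o) (x u v : V).

Lemma derive_addv f x u v : differentiable f x ->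
  'D_(u + v) f x = 'D_u f x + 'D_v f x.
Proof. by move=> df; rewrite !deriveE// linearD. Qed.

Lemma derive_scalev f x k v : differentiable f x ->
  'D_(k *: v) f x = k *: 'D_v f x.
Proof. by move=> df; rewrite !deriveE// linearZ. Qed.

(** Little-o traded for an inequality: products, inverse maps, potentials and limits are all
    differentiated below by exhibiting a linear candidate [L] and checking this estimate. *)
Lemma differentiable_eps f (L : {linear V -> W}) x : continuous L ->
  (forall e, 0 < e -> \forall h \near 0,
     `|f (h + x) - f x - L h| <= e * `|h|) ->
  differentiable f x /\ 'd f x = L :> (V -> W).
Proof.
move=> Lc fL.
have E : f \o shift x = cst (f x) + L +o_ 0 id.
  apply/eqaddoP => e e0; near=> h.
  rewrite /= !fctE opprD addrA.
  by near: h; exact: fL.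
have dE : 'd f x = L :> (V -> W) by exact: diff_unique.
by split=> //; apply/diff_locallyP; rewrite dE.
Unshelve. all: by end_near. Qed.

Lemma differentiable_epsE f x e : differentiable f x -> 0 < e ->
  \forall h \near 0, `|f (h + x) - f x - 'd f x h| <= e * `|h|.
Proof.
move=> df e0; have [_ /eqaddoP/(_ e e0)] := (diff_locallyP x f).1 df.
by apply: filterS => h; rewrite /= !fctE opprD addrA.
Qed.

Lemma near0_shift (P : set V) x :
  (\forall y \near x, P y) -> \forall h \near 0, P (h + x).
Proof. by rewrite (near_shift 0) subr0. Qed.

Lemma near_eq_differentiable f g x : {near x, f =1 g} ->
  differentiable f x -> differentiable g x.
Proof.
move=> fg df.
have fgx : f x = g x by exact: nbhs_singleton fg.
apply: (proj1 (@differentiable_eps g ('d f x) x _ _)); first exact: diff_continuous.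
move=> e e0; have := differentiable_epsE df e0.
move/near0_shift: fg => fg.
by apply: filterS2 fg => h ->; rewrite fgx.
Qed.

End DirectionalDerivatives.

Section Products.
Context {V W : normedModType R}.
Implicit Types (f : V -> W) (a : V -> R^o) (x v : V).

Lemma derive_fZ a f x v : differentiable a x -> differentiable f x ->
  differentiable (fun y => a y *: f y) x /\
  'D_v (fun y => a y *: f y) x = 'D_v a x *: f x + a x *: 'D_v f x.
Proof.
move=> da df.
have [M M0 fM] := linear_lipschitz (diff_continuous df).
have [N N0 aN] := linear_lipschitz (diff_continuous da).
pose L0 h := ('d a x h : R) *: f x + a x *: 'd f x h.
have Llin : linear L0.
  move=> k h1 h2; rewrite /L0.
  have -> : 'd a x (k *: h1 + h2) = k * 'd a x h1 + 'd a x h2 by rewrite linearP.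
  rewrite (linearP ('d f x)) scalerDl !scalerDr !scalerA -!addrA; congr (_ + _).
  by rewrite addrCA [a x * k]mulrC.
pose L : {linear V -> W} := HB.pack L0 (GRing.isLinear.Build _ _ _ _ L0 Llin).
have Lc : continuous L.
  move=> y; apply: cvgD; first by apply: cvgZr_tmp; exact: diff_continuous.
  by apply: cvgZl_tmp; exact: diff_continuous.
suff : differentiable (fun y => a y *: f y) x /\
    'd (fun y => a y *: f y) x = L :> (V -> W).
  by move=> [d dE]; split=> //; rewrite !deriveE// dE.
apply: differentiable_eps => // e e0.
(* [K] bounds [a x], the operator norm of ['d a x] and the values of [f] near [x]. The remainder is
   split below into three products of a factor bounded by means of [K] and one bounded by means of
   [e / (3 * K)]. *)
pose K := `|a x| + `|f x| + N + 1.
have K0 : 0 < K by rewrite /K -addrA ltr_wpDl ?addr_ge0// addr_gt0.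
have eK : 0 < e / (3 * K) by rewrite divr_gt0// mulr_gt0.
have fc : {for x, continuous f} by exact: differentiable_continuous.
have fcx : \forall h \near 0, `|f (h + x) - f x| <= e / (3 * K).
  move/cvgrPdist_le : fc => /(_ _ eK)/near0_shift.
  by apply: filterS => h /=; rewrite distrC.
have fbd : \forall h \near 0, `|f (h + x)| <= `|f x| + 1.
  move/cvgrPdist_le : fc => /(_ _ ltr01)/near0_shift.
  apply: filterS => h /=; rewrite distrC => H.
  by rewrite -[f _](subrK (f x)) (le_trans (ler_normD _ _))// addrC lerD2l.
near=> h.
have -> : a (h + x) *: f (h + x) - a x *: f x - L h =
  (a (h + x) - a x - 'd a x h) *: f (h + x) + 'd a x h *: (f (h + x) - f x) +
  a x *: (f (h + x) - f x - 'd f x h).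
  rewrite /L /= /L0 !scalerBl !scalerBr.
  set A := a _ *: f (_ + _); set B := a x *: f x; set C := _ *: 'd f x h.
  set D := a x *: f (h + x); set E := 'd a x h *: f (h + x).
  set F := _ *: f x.
  rewrite (subrKA E) (addrAC A (- D)) -(addrA D) (subrKA D).
  by rewrite opprD !addrA (addrAC A).
have h1 : `|a (h + x) - a x - 'd a x h| <= e / (3 * K) * `|h|.
  by near: h; exact: differentiable_epsE.
have h2 : `|f (h + x) - f x - 'd f x h| <= e / (3 * K) * `|h|.
  by near: h; exact: differentiable_epsE.
have h3 : `|f (h + x) - f x| <= e / (3 * K) by near: h.
have h4 : `|f (h + x)| <= K.
  have : `|f (h + x)| <= `|f x| + 1 by near: h.
  move/le_trans; apply; rewrite /K lerD2r -addrA addrCA lerDl.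
  by rewrite addr_ge0// ltW.
have h5 : `|'d a x h| <= K * `|h|.
  rewrite (le_trans (aN _))// ler_wpM2r// /K -addrA addrCA lerDl.
  by rewrite addr_ge0// addr_ge0.
have h6 : `|a x| <= K.
  by rewrite /K -!addrA lerDl addr_ge0// addr_ge0// ltW.
have -> : e * `|h| = e / (3 * K) * `|h| * K + K * `|h| * (e / (3 * K)) +
    K * (e / (3 * K) * `|h|).
  by field; rewrite gt_eqF.
rewrite (le_trans (ler_normD _ _))// lerD//; last first.
  by rewrite normrZ ler_pM.
rewrite (le_trans (ler_normD _ _))// lerD// normrZ ler_pM//.
Unshelve. all: by end_near. Qed.

End Products.

Lemma derive_comp {U V W : normedModType R} (f : U -> V) (g : V -> W) x v :
  differentiable f x -> differentiable g (f x) ->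
  'D_v (g \o f) x = 'D_('D_v f x) g (f x).
Proof.
move=> df dg; rewrite !deriveE//; last exact: differentiable_comp.
by rewrite diff_comp.
Qed.

Lemma differentiable_entry {V : normedModType R} {n} (f : V -> 'rV[R]_n) x i :
  differentiable f x -> differentiable (fun y => f y 0 i : R^o) x.
Proof.
move=> df; apply: (@differentiable_comp _ _ _ _ f (fun N : 'rV[R]_n => N 0 i : R^o)) => //.
exact: (@differentiable_coord R 1 n).
Qed.

Lemma derive_entry {V : normedModType R} {n} (f : V -> 'rV[R]_n) x v i :
  differentiable f x ->
  'D_v (fun y => f y 0 i : R^o) x = ('D_v f x) 0 i.
Proof.
by move=> df; rewrite derive_mx ?mxE//; exact: diff_derivable.
Qed.

Lemma mx_norm_leP {n} (x : 'rV[R]_n) c : 0 <= c ->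
  (`|x| <= c) <-> (forall i, `|x 0 i| <= c).
Proof.
move=> c0; rewrite {1}/Num.norm /= mx_normrE; split=> [h i|h].
  by apply: le_trans h; exact: (le_bigmax _ (fun ij => `|x ij.1 ij.2|) (0, i)).
by apply: bigmax_le => // -[j i] _ /=; rewrite ord1.
Qed.

Lemma mx_norm_ltP {n} (x : 'rV[R]_n) c : 0 < c ->
  (`|x| < c) <-> (forall i, `|x 0 i| < c).
Proof.
move=> c0; rewrite {1}/Num.norm /= mx_normrE; split=> [h i|h].
  by apply: le_lt_trans h; exact: (le_bigmax _ (fun ij => `|x ij.1 ij.2|) (0, i)).
by apply: bigmax_lt => // -[j i] _ /=; rewrite ord1.
Qed.

Lemma row_linear_continuous {W : normedModType R} {n} (L : {linear 'rV[R]_n -> W}) :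
  continuous L.
Proof.
have E : (L : _ -> _) = (fun y => \sum_i y 0 i *: L (delta_mx 0 i)).
  apply/funext => y; rewrite {1}(row_sum_delta y) linear_sum.
  by apply: eq_bigr => i _; rewrite linearZ.
rewrite E; apply: continuous_big => [|i _ x]; first exact: add_continuous.
apply: (@cvgZr_tmp _ _ _ (nbhs (x : 'rV[R]_n)) (nbhs_filter _) (fun y : 'rV[R]_n => y 0 i)).
exact: (@coord_continuous R 1 n 0 i x).
Qed.

Lemma differentiable_rV {V : normedModType R} {n} (f : V -> 'rV[R]_n) x :
  (forall i, differentiable (fun y => f y 0 i : R^o) x) -> differentiable f x.
Proof.
move=> df.
have -> : f = \sum_(i < n) (fun y => f y 0 i *: delta_mx 0 i).
  by apply/funext => y; rewrite fct_sumE {1}(row_sum_delta (f y)).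
apply: differentiable_sum => i; apply: differentiableZl; exact: df.
Qed.

Lemma derive_rV_sum {W : normedModType R} {n} (f : 'rV[R]_n -> W) x v :
  differentiable f x -> 'D_v f x = \sum_i v 0 i *: 'D_(delta_mx 0 i) f x.
Proof.
move=> df; rewrite deriveE// {1}(row_sum_delta v) linear_sum.
by apply: eq_bigr => i _; rewrite linearZ deriveE.
Qed.

Lemma is_derive_segment {V W : normedModType R} (f : V -> W) x h (t : R) :
  differentiable f (x + t *: h) ->
  is_derive t 1 (fun s : R => f (x + s *: h)) ('D_h f (x + t *: h)).
Proof.
move=> df.
have E : (fun k : R => k^-1 *: (((fun s : R => f (x + s *: h)) \o shift t) (k *: 1) -
    f (x + t *: h))) =
  (fun k : R => k^-1 *: ((f \o shift (x + t *: h)) (k *: h) - f (x + t *: h))).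
  by apply/funext => k /=; rewrite [k *: 1]mulr1 scalerDl addrCA.
have := diff_derivable (v := h) df.
by rewrite /derivable /= -E => dd; split=> //; rewrite /derive E.
Qed.

Lemma MVT_direction {V : normedModType R} (f : V -> R^o) x h :
  (forall t : R, 0 <= t <= 1 -> differentiable f (x + t *: h)) ->
  exists2 t : R, 0 < t < 1 & f (x + h) - f x = 'D_h f (x + t *: h).
Proof.
move=> df.
have [||t] := @MVT R (fun s : R => f (x + s *: h))
    (fun t => 'D_h f (x + t *: h)) 0 1 ltr01.
- move=> t; rewrite in_itv /= => /andP[t0 t1].
  by apply: is_derive_segment; apply: df; rewrite !ltW.
- apply: continuous_in_subspaceT => t; rewrite inE /= in_itv /= => t01.
  have [+ _] := is_derive_segment (df _ t01).
  by move=> /derivable1_diffP; exact: differentiable_continuous.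
by rewrite in_itv /= scale1r scale0r addr0 subr0 mulr1 => t01 E; exists t.
Qed.

End Differentials.

(** * Smooth functions *)

Section SmoothClosure.
Context {R : realType} {V : normedModType R} (U : set V) (U_open : open U).

Lemma nbhs_open x : U x -> nbhs x U.
Proof. by move=> Ux; exact: open_nbhs_nbhs. Qed.

(** Derivatives at a point of an open set only see a neighbourhood inside it, so equality on [U] is
    inherited by all directional derivatives. This licenses replacing a derivative by a formula
    valid on [U] only in the inductions on [k]. *)
Lemma Ck_on_eq {W : normedModType R} k (f g : V -> W) :
  (forall x, U x -> f x = g x) -> Ck_on k U f -> Ck_on k U g.
Proof.
elim: k f g => [|k IH] f g fg /=.
  move=> cf x Ux; rewrite /prop_for /continuous_at -(fg x Ux).
  apply: cvg_trans (cf x Ux); apply: near_eq_cvg.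
  by apply: filterS (nbhs_open Ux) => y /fg.
have fgn x : U x -> {near x, f =1 g}.
  by move=> Ux; apply: filterS (nbhs_open Ux) => y /fg.
move=> [df Cf]; split=> [x Ux|v].
  by apply: near_eq_differentiable (df x Ux); exact: fgn.
apply: IH (Cf v) => x Ux; exact: near_eq_derive (fgn x Ux).
Qed.

Lemma Ck_onW {W : normedModType R} k (f : V -> W) : Ck_on k.+1 U f -> Ck_on k U f.
Proof.
elim: k f => [|k IH] f /= [df Cf].
  by move=> x Ux; exact: differentiable_continuous (df x Ux).
by split=> // v; apply: IH; exact: Cf.
Qed.

Lemma Ck_on_cst {W : normedModType R} k (a : W) : Ck_on k U (fun=> a).
Proof. exact: smooth_on_cst. Qed.

Lemma Ck_onD {W : normedModType R} k (f g : V -> W) :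
  Ck_on k U f -> Ck_on k U g -> Ck_on k U (fun x => f x + g x).
Proof.
elim: k f g => [|k IH] f g /=.
  by move=> cf cg x Ux; apply: cvgD; [exact: cf|exact: cg].
move=> [df Cf] [dg Cg]; split=> [x Ux|v].
  by apply: differentiableD; [exact: df|exact: dg].
apply: Ck_on_eq (IH _ _ (Cf v) (Cg v)) => x Ux.
by rewrite -deriveD//; apply: diff_derivable; [exact: df|exact: dg].
Qed.

Lemma Ck_onZ {W : normedModType R} k (a : V -> R^o) (f : V -> W) :
  Ck_on k U a -> Ck_on k U f -> Ck_on k U (fun x => a x *: f x).
Proof.
elim: k a f => [|k IH] a f.
  by move=> cf cg x Ux; apply: cvgZ; [exact: cf|exact: cg].
move=> Ca Cf; have [da Cda] : _ /\ (forall v, Ck_on k U ('D_v a)) := Ca.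
have [df Cdf] : _ /\ (forall v, Ck_on k U ('D_v f)) := Cf.
split=> [x Ux|v].
  by have [] := derive_fZ 0 (da x Ux) (df x Ux).
apply: (@Ck_on_eq _ _ (fun x => 'D_v a x *: f x + a x *: 'D_v f x)) => [x Ux|].
  by have [_ ->] := derive_fZ v (da x Ux) (df x Ux).
by apply: Ck_onD; apply: IH; [exact: Cda|exact: Ck_onW|exact: Ck_onW|exact: Cdf].
Qed.

Lemma Ck_on_sum {W : normedModType R} k (I : Type) (r : seq I) (f : I -> V -> W) :
  (forall i, Ck_on k U (f i)) -> Ck_on k U (fun x => \sum_(i <- r) f i x).
Proof.
move=> Cf; elim: r => [|i r IH].
  by apply: Ck_on_eq (Ck_on_cst k (0 : W)) => x _; rewrite big_nil.
by apply: Ck_on_eq (Ck_onD (Cf i) IH) => x _; rewrite big_cons.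
Qed.

Lemma Ck_on_prod k (I : Type) (r : seq I) (f : I -> V -> R^o) :
  (forall i, Ck_on k U (f i)) -> Ck_on k U (fun x => \prod_(i <- r) f i x : R^o).
Proof.
move=> Cf; elim: r => [|i r IH].
  by apply: Ck_on_eq (Ck_on_cst k (1 : R^o)) => x _; rewrite big_nil.
by apply: Ck_on_eq (Ck_onZ (Cf i) IH) => x _; rewrite big_cons.
Qed.

Lemma Ck_on_det k n (A : V -> 'M[R]_n) :
  (forall i j, Ck_on k U (fun x => A x i j : R^o)) ->
  Ck_on k U (fun x => \det (A x) : R^o).
Proof.
move=> CA; apply: Ck_on_sum => s; apply: Ck_onZ; first exact: Ck_on_cst.
exact: Ck_on_prod.
Qed.

Lemma Ck_on_entry k n (f : V -> 'rV[R]_n) i :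
  Ck_on k U f -> Ck_on k U (fun x => f x 0 i : R^o).
Proof.
elim: k f => [|k IH] f /=.
  move=> cf x Ux; apply: (@continuous_comp _ _ _ f (fun N : 'rV[R]_n => N 0 i)).
    exact: cf.
  exact: (@coord_continuous R 1 n 0 i).
move=> [df Cf]; split=> [x Ux|v]; first by apply: differentiable_entry; exact: df.
by apply: Ck_on_eq (IH _ (Cf v)) => x Ux; rewrite derive_entry//; exact: df.
Qed.

Lemma Ck_on_rV k n (f : V -> 'rV[R]_n) :
  (forall i, Ck_on k U (fun x => f x 0 i : R^o)) -> Ck_on k U f.
Proof.
move=> Cf; apply: (@Ck_on_eq _ _ (fun x => \sum_i f x 0 i *: delta_mx 0 i)) => [x _|].
  by rewrite -row_sum_delta.
by apply: Ck_on_sum => i; apply: Ck_onZ => //; exact: Ck_on_cst.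
Qed.

(** The chain rule has to be written with partial derivatives: in [Ck_on] the direction of
    differentiation is constant, whereas the direction ['D_v f x] in which [g] is differentiated
    moves with [x]. *)
Lemma Ck_on_comp {W : normedModType R} k n (U' : set 'rV[R]_n)
    (f : V -> 'rV[R]_n) (g : 'rV[R]_n -> W) :
  (forall x, U x -> U' (f x)) ->
  Ck_on k U f -> Ck_on k U' g -> Ck_on k U (g \o f).
Proof.
move=> fU; elim: k f g fU => [|k IH] f g fU.
  move=> cf cg x Ux; apply: continuous_comp; first exact: cf.
  by apply: cg; exact: fU.
move=> Cf Cg; have [df Cdf] : _ /\ (forall v, Ck_on k U ('D_v f)) := Cf.
have [dg Cdg] : _ /\ (forall v, Ck_on k U' ('D_v g)) := Cg.
split=> [x Ux|v].
  by apply: differentiable_comp; [exact: df|apply: dg; exact: fU].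
apply: (@Ck_on_eq _ _ (fun x => \sum_i ('D_v f x) 0 i *: 'D_(delta_mx 0 i) g (f x))).
  move=> x Ux; have dgx := dg _ (fU _ Ux).
  by rewrite (derive_comp v (df x Ux) dgx) (derive_rV_sum _ dgx).
apply: Ck_on_sum => i; apply: Ck_onZ; first by apply: Ck_on_entry; exact: Cdf.
exact: (IH f ('D_(delta_mx 0 i) g) fU (Ck_onW Cf) (Cdg _)).
Qed.

Lemma Ck_on_comp1 {W : normedModType R} k (U' : set R^o)
    (f : V -> R^o) (g : R^o -> W) :
  (forall x, U x -> U' (f x)) ->
  Ck_on k U f -> Ck_on k U' g -> Ck_on k U (g \o f).
Proof.
move=> fU; elim: k f g fU => [|k IH] f g fU.
  move=> cf cg x Ux; apply: continuous_comp; first exact: cf.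
  by apply: cg; exact: fU.
move=> Cf Cg; have [df Cdf] : _ /\ (forall v, Ck_on k U ('D_v f)) := Cf.
have [dg Cdg] : _ /\ (forall v, Ck_on k U' ('D_v g)) := Cg.
split=> [x Ux|v].
  by apply: differentiable_comp; [exact: df|apply: dg; exact: fU].
apply: (@Ck_on_eq _ _ (fun x => ('D_v f x) *: 'D_1 g (f x))).
  move=> x Ux; have dgx := dg _ (fU _ Ux).
  rewrite (derive_comp v (df x Ux) dgx) -(derive_scalev _ _ dgx).
  by rewrite [_ *: 1]mulr1.
apply: Ck_onZ; first exact: Cdf.
exact: (IH f ('D_1 g) fU (Ck_onW Cf) (Cdg _)).
Qed.

(** The derivative of 1/a is - a'/a^2, which involves 1/a again but only to the order already
    granted by the induction hypothesis. *)
Lemma Ck_onV k (a : V -> R^o) : (forall x, U x -> a x != 0) ->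
  Ck_on k U a -> Ck_on k U (fun x => (a x)^-1 : R^o).
Proof.
move=> a0; elim: k => [|k IH].
  by move=> ca x Ux; apply: cvgV; [exact: a0|exact: ca].
move=> Ca; have [da Cda] : _ /\ (forall v, Ck_on k U ('D_v a)) := Ca; split=> [x Ux|v].
  by apply: differentiableV; [exact: da|exact: a0].
have CV := IH (Ck_onW Ca).
apply: (@Ck_on_eq _ _ (fun x => ((-1 : R^o) *: ((a x)^-1 *: (a x)^-1 : R^o)) *: 'D_v a x)).
  move=> x Ux; rewrite deriveV//; last 2 first.
    exact: a0.
    by apply: diff_derivable; exact: da.
  by rewrite scaleN1r -exprVn expr2.
apply: Ck_onZ; last exact: Cda.
by apply: Ck_onZ; [exact: Ck_on_cst|exact: Ck_onZ].
Qed.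

Lemma Ck_on_sqrt k (a : V -> R^o) : (forall x, U x -> 0 < a x) ->
  Ck_on k U a -> Ck_on k U (fun x => Num.sqrt (a x) : R^o).
Proof.
move=> a0; elim: k => [|k IH].
  by move=> ca x Ux; apply: (continuous_comp (ca x Ux)); exact: sqrt_continuous.
move=> Ca; have [da Cda] : _ /\ (forall v, Ck_on k U ('D_v a)) := Ca.
have ds x : U x -> differentiable (Num.sqrt : R^o -> R^o) (a x).
  by move=> Ux; apply/derivable1_diffP; have [] := is_derive1_sqrt (a0 x Ux).
split=> [x Ux|v].
  exact: (differentiable_comp (da x Ux) (ds x Ux)).
have CV := IH (Ck_onW Ca).
apply: (@Ck_on_eq _ _ (fun x => (2 *: Num.sqrt (a x) : R^o)^-1 *: 'D_v a x)).
  move=> x Ux; rewrite (derive_comp _ (da x Ux) (ds x Ux)).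
  rewrite -['D_v a x in RHS]mulr1 -['D_v a x * 1]/('D_v a x *: (1 : R^o)).
  rewrite derive_scalev; last exact: ds.
  have [_ ->] := is_derive1_sqrt (a0 x Ux).
  exact: mulrC.
apply: Ck_onZ; last exact: Cda.
apply: Ck_onV => [x Ux|]; last by apply: Ck_onZ; first exact: Ck_on_cst.
by rewrite mulf_neq0// gt_eqF// sqrtr_gt0 a0.
Qed.

Lemma Ck_on_invmx k n (A : V -> 'M[R]_n) :
  (forall x, U x -> A x \in unitmx) ->
  (forall i j, Ck_on k U (fun x => A x i j : R^o)) ->
  forall i j, Ck_on k U (fun x => invmx (A x) i j : R^o).
Proof.
move=> uA CA i j.
apply: (@Ck_on_eq _ _ (fun x => (\det (A x) : R^o)^-1 *: cofactor (A x) j i)).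
  by move=> x Ux; rewrite /invmx uA// !mxE.
apply: Ck_onZ.
  apply: Ck_onV => [x /uA|]; last exact: Ck_on_det.
  by rewrite unitmxE unitfE.
apply: Ck_onZ; first exact: Ck_on_cst.
apply: Ck_on_det => a b.
by apply: (@Ck_on_eq _ _ (fun x => A x (lift j a) (lift i b) : R^o)) => // x _; rewrite !mxE.
Qed.

End SmoothClosure.

Section Smooth.
Context {R : realType} {V : normedModType R}.
Implicit Types (U : set V).

Lemma smooth_eq {W : normedModType R} U (f g : V -> W) : open U ->
  (forall x, U x -> f x = g x) -> smooth_on U f -> smooth_on U g.
Proof. by move=> Uo fg sf k; exact: (Ck_on_eq Uo fg (sf k)). Qed.

Lemma smooth_sub {W : normedModType R} U U' (f : V -> W) :
  U' `<=` U -> smooth_on U f -> smooth_on U' f.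
Proof.
move=> U'U sf k; have := sf k; elim: k f {sf} => [|k IH] f /=.
  by move=> cf x /U'U; exact: cf.
by move=> [df Cf]; split=> [x /U'U|v]; [exact: df|exact: IH].
Qed.

Lemma smooth_differentiable {W : normedModType R} U (f : V -> W) x :
  smooth_on U f -> U x -> differentiable f x.
Proof. by move=> /(_ 1%N)[+ _]; exact. Qed.

Lemma smooth_derive {W : normedModType R} U (f : V -> W) v :
  smooth_on U f -> smooth_on U ('D_v f).
Proof. by move=> sf k; have [_] := sf k.+1; exact. Qed.

Lemma smooth_onS {W : normedModType R} U (f : V -> W) :
  (forall x, U x -> differentiable f x) ->
  (forall v, smooth_on U ('D_v f)) -> smooth_on U f.
Proof.
move=> df sf [|k] /=; last by split=> // v; exact: sf.
by move=> x Ux; exact: differentiable_continuous (df x Ux).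
Qed.

Lemma smoothD {W : normedModType R} U (f g : V -> W) : open U ->
  smooth_on U f -> smooth_on U g -> smooth_on U (fun x => f x + g x).
Proof. by move=> Uo sf sg k; exact: Ck_onD. Qed.

Lemma smoothZ {W : normedModType R} U (a : V -> R^o) (f : V -> W) : open U ->
  smooth_on U a -> smooth_on U f -> smooth_on U (fun x => a x *: f x).
Proof. by move=> Uo sa sf k; exact: Ck_onZ. Qed.

Lemma smoothM U (a b : V -> R^o) : open U ->
  smooth_on U a -> smooth_on U b -> smooth_on U (fun x => a x * b x : R^o).
Proof. exact: smoothZ. Qed.

Lemma smoothN {W : normedModType R} U (f : V -> W) : open U ->
  smooth_on U f -> smooth_on U (fun x => - f x).
Proof.
move=> Uo sf; apply: (@smooth_eq _ _ (fun x => -1 *: f x)) => // [x _|].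
  by rewrite scaleN1r.
by apply: smoothZ => //; exact: smooth_on_cst.
Qed.

Lemma smoothB {W : normedModType R} U (f g : V -> W) : open U ->
  smooth_on U f -> smooth_on U g -> smooth_on U (fun x => f x - g x).
Proof. by move=> Uo sf sg; apply: smoothD => //; exact: smoothN. Qed.

Lemma smooth_sum {W : normedModType R} U (I : Type) (r : seq I) (f : I -> V -> W) :
  open U -> (forall i, smooth_on U (f i)) -> smooth_on U (fun x => \sum_(i <- r) f i x).
Proof. by move=> Uo sf k; apply: Ck_on_sum => // i; exact: sf. Qed.

Lemma smooth_invmx U n (A : V -> 'M[R]_n) : open U ->
  (forall x, U x -> A x \in unitmx) ->
  (forall i j, smooth_on U (fun x => A x i j : R^o)) ->
  forall i j, smooth_on U (fun x => invmx (A x) i j : R^o).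
Proof. by move=> Uo uA sA i j k; apply: Ck_on_invmx => // a b; exact: sA. Qed.

Lemma smooth_entry U n (f : V -> 'rV[R]_n) i : open U ->
  smooth_on U f -> smooth_on U (fun x => f x 0 i : R^o).
Proof. by move=> Uo sf k; exact: Ck_on_entry. Qed.

Lemma smooth_rV U n (f : V -> 'rV[R]_n) : open U ->
  (forall i, smooth_on U (fun x => f x 0 i : R^o)) -> smooth_on U f.
Proof. by move=> Uo sf k; apply: Ck_on_rV => // i; exact: sf. Qed.

Lemma smooth_comp {W : normedModType R} U n (U' : set 'rV[R]_n)
    (f : V -> 'rV[R]_n) (g : 'rV[R]_n -> W) : open U ->
  (forall x, U x -> U' (f x)) ->
  smooth_on U f -> smooth_on U' g -> smooth_on U (g \o f).
Proof. by move=> Uo fU sf sg k; exact: (Ck_on_comp Uo fU (sf k) (sg k)). Qed.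

Lemma smooth_comp1 {W : normedModType R} U (U' : set R^o)
    (f : V -> R^o) (g : R^o -> W) : open U ->
  (forall x, U x -> U' (f x)) ->
  smooth_on U f -> smooth_on U' g -> smooth_on U (g \o f).
Proof. by move=> Uo fU sf sg k; exact: (Ck_on_comp1 Uo fU (sf k) (sg k)). Qed.

Lemma smoothV U (a : V -> R^o) : open U -> (forall x, U x -> a x != 0) ->
  smooth_on U a -> smooth_on U (fun x => (a x)^-1 : R^o).
Proof. by move=> Uo a0 sa k; exact: Ck_onV. Qed.

Lemma smooth_sqrt U (a : V -> R^o) : open U -> (forall x, U x -> 0 < a x) ->
  smooth_on U a -> smooth_on U (fun x => Num.sqrt (a x) : R^o).
Proof. by move=> Uo a0 sa k; exact: Ck_on_sqrt. Qed.

Lemma smooth_normr U (a : V -> R^o) : open U -> (forall x, U x -> a x != 0) ->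
  smooth_on U a -> smooth_on U (fun x => `|a x| : R^o).
Proof.
move=> Uo a0 sa.
apply: (@smooth_eq _ _ (fun x => Num.sqrt (a x * a x) : R^o)) => // [x _|].
  by rewrite -expr2 sqrtr_sqr.
apply: smooth_sqrt => // [x Ux|]; last exact: smoothM.
by rewrite -expr2 exprn_even_gt0//= a0.
Qed.

End Smooth.

Section SmoothFields.
Context {R : realType} {n : nat}.
Implicit Types (U : set 'rV[R]_n) (X Y : 'rV[R]_n -> 'rV[R]_n).

Lemma smooth_along {W : normedModType R} U X (f : 'rV[R]_n -> W) : open U ->
  smooth_on U X -> smooth_on U f -> smooth_on U (fun x => 'D_(X x) f x).
Proof.
move=> Uo sX sf.
apply: (@smooth_eq _ _ _ _ (fun x => \sum_i (X x) 0 i *: 'D_(delta_mx 0 i) f x)) => //.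
  by move=> x Ux; rewrite -derive_rV_sum//; exact: smooth_differentiable sf Ux.
apply: smooth_sum => // i; apply: smoothZ => //; first exact: smooth_entry.
exact: smooth_derive.
Qed.

End SmoothFields.

(* Keeps failing unifications of directional derivatives cheap. *)
#[local] Opaque derive diff.

(** * Symmetry of second derivatives *)

Section Schwarz.
Context {R : realType} {V : normedModType R}.

(* Mean value theorem applied to y |-> f (y + s v) - f y between x and x + s u. *)
Lemma second_difference (f : V -> R^o) (U : set V) x u v : open U -> U x ->
  (forall y, U y -> differentiable f y) -> differentiable ('D_u f) x ->
  forall e, 0 < e -> exists2 d : R, 0 < d & forall s : R, 0 < s < d ->
  `|(f (x + s *: v + s *: u) - f (x + s *: u)) - (f (x + s *: v) - f x) -
    s ^+ 2 * 'D_v ('D_u f) x| <= e * s ^+ 2.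
Proof.
(* [M] serves twice: [s * M < d1] keeps displacements of norm at most [s * (|v| + |u|)] within the
   ball of radius [d1], and the two errors, each at most [e / M] times such a norm, add up to at
   most [e * s]. *)
move=> Uo Ux df dG e e0; pose M := 2 * (`|v| + `|u|) + 1.
have M0 : 0 < M by rewrite ltr_wpDl// mulr_ge0// addr_ge0.
have /nbhs_norm0P[d1 /= d10 Hd1] : \forall h \near 0, U (h + x) /\
    `|'D_u f (h + x) - 'D_u f x - 'd ('D_u f) x h| <= e / M * `|h|.
  apply: filterI; first by apply: near0_shift; exact: nbhs_open.
  by apply: differentiable_epsE => //; exact: divr_gt0.
exists (d1 / M) => [|s /andP[s0 sd]]; first exact: divr_gt0.
have sM : s * M < d1 by rewrite -ltr_pdivlMr.
have bnd0 (a b : R) : 0 <= a <= 1 -> 0 <= b <= 1 ->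
    `|a *: (s *: v) + b *: (s *: u)| <= s * (`|v| + `|u|).
  move=> /andP[a0 a1] /andP[b0 b1].
  rewrite (le_trans (ler_normD _ _))// !normrZ (ger0_norm a0) (ger0_norm b0) (gtr0_norm s0).
  have sp (c : V) : 0 <= s * `|c| by rewrite mulr_ge0// ltW.
  by rewrite mulrDr lerD// ler_piMl.
have bnd (a b : R) : 0 <= a <= 1 -> 0 <= b <= 1 ->
    `|a *: (s *: v) + b *: (s *: u)| < d1.
  move=> ab bb; apply: le_lt_trans (bnd0 a b ab bb) _; apply: le_lt_trans sM.
  rewrite ler_wpM2l ?ltW// /M.
  have := normr_ge0 v; have := normr_ge0 u; lra.
have UU (a b : R) : 0 <= a <= 1 -> 0 <= b <= 1 ->
    U (x + a *: (s *: v) + b *: (s *: u)).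
  by move=> ab bb; rewrite -addrA addrC; have [] := Hd1 _ (bnd a b ab bb).
pose F (t : R) := f (x + s *: v + t *: (s *: u)) - f (x + t *: (s *: u)).
have i1 : 0 <= (1 : R) <= 1 by rewrite ler01 lexx.
have i0 : 0 <= (0 : R) <= 1 by rewrite ler01 lexx.
have dF (t : R) : 0 <= t <= 1 -> is_derive t 1 F
    ('D_(s *: u) f (x + s *: v + t *: (s *: u)) - 'D_(s *: u) f (x + t *: (s *: u))).
  move=> t01; apply: is_deriveB; apply: is_derive_segment; apply: df.
    by have := UU 1 t i1 t01; rewrite scale1r.
  by have := UU 0 t i0 t01; rewrite scale0r addr0.
pose F' (t : R) := 'D_(s *: u) f (x + s *: v + t *: (s *: u)) - 'D_(s *: u) f (x + t *: (s *: u)).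
have [||t] := @MVT R F F' 0 1 ltr01.
- by move=> t; rewrite in_itv /= => /andP[t0 t1]; apply: dF; rewrite !ltW.
- apply: continuous_in_subspaceT => t; rewrite inE /= in_itv /= => t01.
  have [+ _] := dF _ t01.
  by move=> /derivable1_diffP; exact: differentiable_continuous.
rewrite in_itv /= => /andP[t0 t1].
have t01 : 0 <= t <= 1 by rewrite !ltW.
rewrite /F /F' !scale1r !scale0r !addr0 subr0 mulr1 => ->.
have U1 : U (x + s *: v + t *: (s *: u)).
  by have := UU 1 t i1 t01; rewrite scale1r.
have U2 : U (x + t *: (s *: u)).
  by have := UU 0 t i0 t01; rewrite scale0r addr0.
rewrite !derive_scalev; [|exact: df|exact: df].
rewrite (deriveE _ dG).
set G := 'D_u f; set L := 'd G x.
pose h1 := s *: v + t *: (s *: u); pose h2 := t *: (s *: u).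
have b1 : `|h1| < d1 by have := bnd 1 t i1 t01; rewrite scale1r.
have b2 : `|h2| < d1 by have := bnd 0 t i0 t01; rewrite scale0r add0r.
have E1 : `|h1| <= s * (`|v| + `|u|) by have := bnd0 1 t i1 t01; rewrite scale1r.
have E2 : `|h2| <= s * (`|v| + `|u|) by have := bnd0 0 t i0 t01; rewrite scale0r add0r.
have [_ e1] := Hd1 _ b1; have [_ e2] := Hd1 _ b2.
have x1 : x + s *: v + t *: (s *: u) = h1 + x by rewrite [RHS]addrC addrA.
have x2 : x + t *: (s *: u) = h2 + x by rewrite [RHS]addrC.
rewrite x1 x2 {}/L {}/G.
have Lv : 'd ('D_u f) x h1 - 'd ('D_u f) x h2 = s * 'd ('D_u f) x v.
  by rewrite -linearB /h1 addrK linearZ.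
move: e1 e2 Lv.
move: ('d ('D_u f) x h1) ('d ('D_u f) x h2) ('d ('D_u f) x v) => l1 l2 l.
move: ('D_u f (h1 + x)) ('D_u f (h2 + x)) ('D_u f x) => g1 g2 g e1 e2 Lv.
have -> : s *: g1 - s *: g2 - s ^+ 2 * l = s * ((g1 - g - l1) - (g2 - g - l2)).
  rewrite expr2 -mulrA -Lv -![s *: _]/(s * _); ring.
rewrite normrM (gtr0_norm s0) expr2 mulrCA ler_wpM2l ?(ltW s0)//.
rewrite (le_trans (ler_normB _ _))// (le_trans (lerD e1 e2))// -mulrDr.
have eM : 0 <= e / M by rewrite divr_ge0// ltW.
rewrite (le_trans (ler_wpM2l eM (lerD E1 E2)))//.
rewrite (_ : e / M * _ = e * s * (2 * (`|v| + `|u|) / M)); last by ring.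
by rewrite ler_piMr ?mulr_ge0 ?ltW// ltr_pdivrMr// mul1r /M ltrDl.
Qed.

(** The second difference of [f] along [s *: u] and [s *: v] is symmetric in [u] and [v].
    Approximating it in both orders for one small [s] shows that the two derivatives differ by at
    most any [e]. *)
Lemma schwarz (f : V -> R^o) (U : set V) x u v : open U -> U x ->
  (forall y, U y -> differentiable f y) ->
  differentiable ('D_u f) x -> differentiable ('D_v f) x ->
  'D_v ('D_u f) x = 'D_u ('D_v f) x.
Proof.
move=> Uo Ux df du dv; apply/eqP; rewrite -subr_eq0 -normr_le0.
apply/ler_addgt0Pl => e e0; rewrite addr0.
have e2 : 0 < e / 2 by rewrite divr_gt0.
have [d1 d10 H1] := second_difference v Uo Ux df du e2.
have [d2 d20 H2] := second_difference u Uo Ux df dv e2.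
pose s := Num.min d1 d2 / 2.
have m0 : 0 < Num.min d1 d2 by rewrite lt_min d10.
have s0 : 0 < s by rewrite divr_gt0.
have sm : s < Num.min d1 d2 by rewrite ltr_pdivrMr// ltr_pMr// ltr1n.
have s1 : 0 < s < d1 by rewrite s0 (lt_le_trans sm)// ge_min lexx.
have s2 : 0 < s < d2 by rewrite s0 (lt_le_trans sm)// ge_min lexx orbT.
have {}H1 := H1 s s1; have {}H2 := H2 s s2.
rewrite [x + s *: u + s *: v]addrAC in H2.
have ss : 0 < s ^+ 2 by rewrite exprn_gt0.
rewrite -(ler_pM2l ss) -[s ^+ 2 in leLHS]gtr0_norm// -normrM.
set D := f (x + s *: v + s *: u) in H1 H2.
move: H1 H2; rewrite {}/D.
move: ('D_v ('D_u f) x) ('D_u ('D_v f) x) => a b.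
move: (f _) (f _) (f _) (f _) => c1 c2 c3 c4 H1 H2.
rewrite (_ : s ^+ 2 * (a - b) =
  (c4 - c2 - (c3 - c1) - s ^+ 2 * b) - (c4 - c3 - (c2 - c1) - s ^+ 2 * a)); last by ring.
by rewrite (le_trans (ler_normB _ _))// (le_trans (lerD H2 H1))// -mulrDl -splitr mulrC.
Qed.

End Schwarz.

(** * Lie brackets in coordinates *)

Section Brackets.
Context {R : realType}.

Lemma derive_fsum {V W : normedModType R} n (h : 'I_n -> V -> W) x v :
  (forall i, differentiable (h i) x) ->
  differentiable (fun y => \sum_i h i y) x /\
  'D_v (fun y => \sum_i h i y) x = \sum_i 'D_v (h i) x.
Proof.
move=> dh.
have -> : (fun y => \sum_i h i y) = \sum_i h i by apply/funext => y; rewrite fct_sumE.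
split; first exact: differentiable_sum.
by rewrite derive_sum// => i; exact: diff_derivable.
Qed.

Lemma derive_fD {V W : normedModType R} (f g : V -> W) x v :
  differentiable f x -> differentiable g x ->
  'D_v (fun y => f y + g y) x = 'D_v f x + 'D_v g x.
Proof. by move=> df dg; rewrite -deriveD//; exact: diff_derivable. Qed.

Lemma derive_fB {V W : normedModType R} (f g : V -> W) x v :
  differentiable f x -> differentiable g x ->
  'D_v (fun y => f y - g y) x = 'D_v f x - 'D_v g x.
Proof. by move=> df dg; rewrite -deriveB//; exact: diff_derivable. Qed.

Context {n : nat}.
Implicit Types (U : set 'rV[R]_n) (X Y Z : 'rV[R]_n -> 'rV[R]_n).

Definition lbr X Y (x : 'rV[R]_n) : 'rV[R]_n := 'D_(X x) Y x - 'D_(Y x) X x.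

Lemma lbrE X Y x : lbr X Y x = 'D_(X x) Y x - 'D_(Y x) X x.
Proof. by []. Qed.

Lemma derive_along {W : normedModType R} U Y (f : 'rV[R]_n -> W) x w : open U -> U x ->
  smooth_on U Y -> smooth_on U f ->
  'D_w (fun y => 'D_(Y y) f y) x = 'D_('D_w Y x) f x + 'D_w ('D_(Y x) f) x.
Proof.
move=> Uo Ux sY sf.
have dfx y : U y -> differentiable f y by exact: smooth_differentiable sf.
have dDf i : differentiable ('D_(delta_mx 0 i) f) x.
  by apply: smooth_differentiable Ux; exact: smooth_derive sf.
have dYi i : differentiable (fun y => Y y 0 i : R^o) x.
  by apply: smooth_differentiable Ux; exact: smooth_entry.
have dY : differentiable Y x by exact: smooth_differentiable sY Ux.
rewrite (near_eq_derive (g := fun y => \sum_i Y y 0 i *: 'D_(delta_mx 0 i) f y)); last first.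
  by apply: filterS (nbhs_open Uo Ux) => y Uy; rewrite -derive_rV_sum//; exact: dfx.
rewrite [X in _ + X](near_eq_derive (g := fun y => \sum_i Y x 0 i *: 'D_(delta_mx 0 i) f y)); last first.
  by apply: filterS (nbhs_open Uo Ux) => y Uy; rewrite -derive_rV_sum//; exact: dfx.
have H1 i := derive_fZ w (dYi i) (dDf i).
have H2 i := @derive_fZ _ _ _ (cst (Y x 0 i)) _ x w (differentiable_cst _ _) (dDf i).
have [_ ->] := derive_fsum w (fun i => (H1 i).1).
have [_ ->] := derive_fsum w (fun i => (H2 i).1).
rewrite (derive_rV_sum _ (dfx _ Ux)) -big_split /=; apply: eq_bigr => i _.
by rewrite (H1 i).2 (H2 i).2 derive_cst scale0r add0r derive_entry.
Qed.

Lemma lbr_apply U X Y (f : 'rV[R]_n -> R^o) x : open U -> U x ->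
  smooth_on U X -> smooth_on U Y -> smooth_on U f ->
  'D_(lbr X Y x) f x =
    'D_(X x) (fun y => 'D_(Y y) f y) x - 'D_(Y x) (fun y => 'D_(X y) f y) x.
Proof.
move=> Uo Ux sX sY sf.
rewrite (derive_along (X x) Uo Ux sY sf) (derive_along (Y x) Uo Ux sX sf).
have dD v : differentiable ('D_v f) x.
  by apply: smooth_differentiable Ux; exact: smooth_derive sf.
have dfx y : U y -> differentiable f y by exact: smooth_differentiable sf.
have dx := dfx _ Ux.
have -> : 'D_(lbr X Y x) f x = 'D_('D_(X x) Y x) f x - 'D_('D_(Y x) X x) f x.
  by rewrite /lbr derive_addv// -scaleN1r derive_scalev// scaleN1r.
have aux (a b p q : R) : p = q -> a - b = a + q - (b + p) by move=> ->; ring.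
exact: aux (schwarz Uo Ux dfx (dD (X x)) (dD (Y x))).
Qed.

Lemma smooth_lbr U X Y : open U -> smooth_on U X -> smooth_on U Y ->
  smooth_on U (lbr X Y).
Proof. by move=> Uo sX sY; apply: smoothB => //; exact: smooth_along. Qed.

Lemma lbrC X Y x : lbr Y X x = - lbr X Y x.
Proof. by rewrite /lbr opprB. Qed.

Lemma lbrxx X x : lbr X X x = 0.
Proof. by rewrite /lbr subrr. Qed.

Lemma lbr_eq U X Y X' Y' x : open U -> U x -> (forall y, U y -> X y = X' y) ->
  (forall y, U y -> Y y = Y' y) -> lbr X Y x = lbr X' Y' x.
Proof.
move=> Uo Ux XX YY; rewrite /lbr -(XX _ Ux) -(YY _ Ux).
have -> : 'D_(X x) Y' x = 'D_(X x) Y x.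
  by apply: near_eq_derive; apply: filterS (nbhs_open Uo Ux) => y Uy; rewrite YY.
have -> // : 'D_(Y x) X' x = 'D_(Y x) X x.
by apply: near_eq_derive; apply: filterS (nbhs_open Uo Ux) => y Uy; rewrite XX.
Qed.

Lemma lbrDr X Y Z x : differentiable X x -> differentiable Y x ->
  differentiable Z x ->
  lbr X (fun y => Y y + Z y) x = lbr X Y x + lbr X Z x.
Proof.
move=> dX dY dZ; rewrite /lbr derive_fD// derive_addv//.
by rewrite opprD addrACA.
Qed.

Lemma lbrZr (a : 'rV[R]_n -> R^o) X Y x : differentiable a x ->
  differentiable X x -> differentiable Y x ->
  lbr X (fun y => a y *: Y y) x = 'D_(X x) a x *: Y x + a x *: lbr X Y x.
Proof.
move=> da dX dY; rewrite /lbr (derive_fZ _ da dY).2 derive_scalev//.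
by rewrite -addrA -scalerBr.
Qed.

Lemma lbrDl X Y Z x : differentiable X x -> differentiable Y x ->
  differentiable Z x ->
  lbr (fun y => Y y + Z y) X x = lbr Y X x + lbr Z X x.
Proof. move=> dX dY dZ; rewrite (lbrC X (fun y => Y y + Z y)) (lbrDr dX dY dZ) opprD.
by rewrite (lbrC X Y) (lbrC X Z). Qed.

Lemma lbrZl (a : 'rV[R]_n -> R^o) X Y x : differentiable a x ->
  differentiable X x -> differentiable Y x ->
  lbr (fun y => a y *: Y y) X x = a x *: lbr Y X x - 'D_(X x) a x *: Y x.
Proof.
move=> da dX dY; rewrite (lbrC X (fun y => a y *: Y y)) (lbrZr da dX dY) opprD addrC.
by rewrite (lbrC X Y) scalerN.
Qed.

Lemma lbr_lbrC U X Y x : open U -> U x -> smooth_on U X -> smooth_on U Y ->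
  lbr X (lbr Y X) x = - lbr X (lbr X Y) x.
Proof.
move=> Uo Ux sX sY.
have -> : lbr X (lbr Y X) x =
    lbr X (fun y => (cst (-1) : 'rV[R]_n -> R^o) y *: lbr X Y y) x.
  by apply: (lbr_eq Uo Ux) => // y _; rewrite /= scaleN1r -lbrC.
have dX := smooth_differentiable sX Ux.
have dXY := smooth_differentiable (smooth_lbr Uo sX sY) Ux.
by rewrite (lbrZr (differentiable_cst _ _) dX dXY) derive_cst scale0r add0r scaleN1r.
Qed.

Lemma lbr_entry U X Y x i : open U -> U x -> smooth_on U X -> smooth_on U Y ->
  (lbr X Y x) 0 i = 'D_(X x) (fun y => Y y 0 i : R^o) x -
                    'D_(Y x) (fun y => X y 0 i : R^o) x.
Proof.
move=> Uo Ux sX sY; rewrite /lbr mxE [X in _ + X]mxE !derive_entry//.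
  exact: smooth_differentiable sX Ux.
exact: smooth_differentiable sY Ux.
Qed.

#[local] Opaque lbr.

(** Read entrywise, with brackets as commutators of derivations: [T A B C i] is A applied to B
    applied to the i-th entry of C. Each double bracket yields four such terms, and the twelve
    cancel in pairs. *)
Lemma lbr_jacobi U X Y Z x : open U -> U x ->
  smooth_on U X -> smooth_on U Y -> smooth_on U Z ->
  lbr X (lbr Y Z) x + lbr Y (lbr Z X) x + lbr Z (lbr X Y) x = 0.
Proof.
move=> Uo Ux sX sY sZ.
pose T (A B C : 'rV[R]_n -> 'rV[R]_n) (i : 'I_n) : R :=
  'D_(A x) (fun y => 'D_(B y) (fun z => C z 0 i : R^o) y) x.
suff H A B C i : smooth_on U A -> smooth_on U B -> smooth_on U C ->
   (lbr A (lbr B C) x) 0 i = T A B C i - T A C B i - (T B C A i - T C B A i).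
  apply/rowP => i; have H1 := H X Y Z i sX sY sZ; have H2 := H Y Z X i sY sZ sX.
  have H3 := H Z X Y i sZ sX sY.
  have aux (A B C : 'rV[R]_n) : A 0 i + B 0 i + C 0 i = 0 -> (A + B + C) 0 i = (0 : 'rV[R]_n) 0 i.
    by rewrite !mxE.
  move: (lbr X (lbr Y Z) x) H1 => a ea.
  move: (lbr Y (lbr Z X) x) H2 => b eb.
  move: (lbr Z (lbr X Y) x) H3 => c ec.
  apply: aux.
  rewrite ea eb ec.
  move: (T X Y Z i) (T X Z Y i) (T Y Z X i) (T Y X Z i) (T Z X Y i) (T Z Y X i).
  by clear=> *; ring.
move=> sA sB sC; rewrite (lbr_entry _ Uo Ux sA (smooth_lbr Uo sB sC)).
rewrite (lbr_apply Uo Ux sB sC (smooth_entry i Uo sA)); congr (_ - _).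
rewrite /T.
rewrite -derive_fB; last 2 first.
- apply: smooth_differentiable Ux; apply: smooth_along => //; exact: smooth_entry.
- apply: smooth_differentiable Ux; apply: smooth_along => //; exact: smooth_entry.
apply: near_eq_derive; apply: filterS (nbhs_open Uo Ux) => y Uy.
exact: lbr_entry Uy sB sC.
Qed.

End Brackets.

(** Test on a coordinate y_i of the target: relatedness turns the derivative of y_i after [phi]
    along [Y] into the i-th entry of [Y'] after [phi], so both commutators agree. Applied to
    transition maps, it makes brackets independent of the chart; applied to a trivialising map, it
    computes brackets in the model. *)
Lemma lbr_related {R : realType} m n (U : set 'rV[R]_m) (V : set 'rV[R]_n)
    (phi : 'rV[R]_m -> 'rV[R]_n) X Y X' Y' x :
  open U -> open V -> (forall y, U y -> V (phi y)) -> smooth_on U phi ->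
  smooth_on U X -> smooth_on U Y -> smooth_on V X' -> smooth_on V Y' ->
  (forall y, U y -> 'D_(X y) phi y = X' (phi y)) ->
  (forall y, U y -> 'D_(Y y) phi y = Y' (phi y)) ->
  U x -> 'D_(lbr X Y x) phi x = lbr X' Y' (phi x).
Proof.
move=> Uo Vo UV sp sX sY sX' sY' XX YY Ux; apply/rowP => i.
have dp y : U y -> differentiable phi y by exact: smooth_differentiable sp.
rewrite -derive_entry; last exact: dp.
rewrite (lbr_apply Uo Ux sX sY (smooth_entry i Uo sp)).
rewrite (lbr_entry i Vo (UV _ Ux) sX' sY').
have H A A' B B' : smooth_on V A' -> smooth_on V B' ->
  (forall y, U y -> 'D_(A y) phi y = A' (phi y)) ->
  (forall y, U y -> 'D_(B y) phi y = B' (phi y)) ->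
  'D_(A x) (fun y => 'D_(B y) (fun y => phi y 0 i : R^o) y) x =
  'D_(A' (phi x)) (fun y => B' y 0 i : R^o) (phi x).
  move=> sA sB AA BB.
  rewrite (near_eq_derive (g := (fun y => B' y 0 i : R^o) \o phi)); last first.
    apply: filterS (nbhs_open Uo Ux) => y Uy.
    by rewrite derive_entry /=; [rewrite BB|exact: dp].
  rewrite derive_comp ?AA//; first exact: dp.
  apply: smooth_differentiable (UV _ Ux); exact: smooth_entry.
by rewrite (H _ _ _ _ sX' sY' XX YY) (H _ _ _ _ sY' sX' YY XX).
Qed.

(** * The inverse function theorem *)

Section InverseFunction.
Context {R : realType}.

Lemma continuous_eps {V W : normedModType R} (f : V -> W) x :
  (forall e, 0 < e -> exists2 d : R, 0 < d & forall y, `|y - x| < d -> `|f y - f x| <= e) ->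
  {for x, continuous f}.
Proof.
move=> H; apply/cvgrPdist_le => e /H[d d0 Hd].
by apply/nbhs_normP; exists d => // y /=; rewrite distrC [X in _ -> X <= _]distrC; exact: Hd.
Qed.

Lemma open_ball {V : normedModType R} (U : set V) x : open U -> U x ->
  exists2 d : R, 0 < d & forall y, `|y - x| < d -> U y.
Proof.
move=> Uo /(nbhs_open Uo)/nbhs_normP[d d0 Hd]; exists d => // y yx.
by apply: Hd; rewrite /= distrC.
Qed.

Lemma open_normball {V : normedModType R} (z : V) d : open [set y | `|y - z| < d].
Proof.
have [d0|d0] := ltP 0 d; last first.
  suff -> : [set y | `|y - z| < d] = set0 by exact: open0.
  by apply/seteqP; split=> // y /= /lt_le_trans/(_ d0); rewrite normr_lt0.
have -> : [set y | `|y - z| < d] = ball z d.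
  by rewrite -ball_normE; apply/seteqP; split=> y /=; rewrite distrC.
exact: ball_open.
Qed.

(* On the compact ball, a point minimising |T x - x| is fixed. *)
Lemma contraction_fixed_point n (x0 : 'rV[R]_n) (r : R) (T : 'rV[R]_n -> 'rV[R]_n) :
  0 <= r -> (forall x, `|x - x0| <= r -> {for x, continuous T}) ->
  (forall x, `|x - x0| <= r -> `|T x - x0| <= r) ->
  (forall x y, `|x - x0| <= r -> `|y - x0| <= r -> `|T x - T y| <= `|x - y| / 2) ->
  exists2 x, `|x - x0| <= r & T x = x.
Proof.
move=> r0 Tc Tr TL; pose A : set 'rV[R]_n := [set x | `|x - x0| <= r].
have Ac : compact A.
  apply: bounded_closed_compact.
    exists (`|x0| + r); split; first exact: num_real.
    move=> M rM x /= Ax; apply: le_trans (ltW rM).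
    by rewrite -[x](subrK x0) (le_trans (ler_normD _ _))// addrC lerD2l.
  have -> : A = closed_ball_ Num.norm x0 r.
    by apply/seteqP; split=> x; rewrite /A /closed_ball_ /= distrC.
  exact: closed_closed_ball_.
have Tc' : {within A, continuous (fun x => `|T x - x|)}.
  apply: continuous_in_subspaceT => x; rewrite inE => Ax.
  apply: (@continuous_comp _ _ _ (fun x => T x - x) Num.norm).
    by apply: (continuousB (Tc _ Ax)); exact: cvg_id.
  exact: norm_continuous.
have A0 : A !=set0 by exists x0; rewrite /A /= subrr normr0.
have [c] := EVT_min_rV A0 Ac Tc'.
rewrite inE => Acc cmin; exists c => //.
apply/eqP; rewrite -subr_eq0 -normr_le0.
have ATc : A (T c) by exact: Tr.
have : `|T c - c| <= `|T (T c) - T c| by apply: (cmin (T c)); rewrite inE.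
have := TL _ _ ATc Acc; lra.
Qed.

Lemma entry_le_norm n (v : 'rV[R]_n) i : `|v 0 i| <= `|v|.
Proof. exact: (mx_norm_leP v (normr_ge0 v)).1. Qed.

Lemma norm_derive_le n (h : 'rV[R]_n -> 'rV[R]_n) x v c : differentiable h x ->
  (forall i, `|'D_(delta_mx 0 i) h x| <= c) -> `|'D_v h x| <= (n%:R * c) * `|v|.
Proof.
move=> dh hc; rewrite (derive_rV_sum v dh).
rewrite (le_trans (ler_norm_sum _ _ _))//.
apply: (@le_trans _ _ (\sum_(i < n) c * `|v|)).
  apply: ler_sum => i _; rewrite normrZ mulrC ler_pM//.
  exact: entry_le_norm.
by rewrite big_const_ord iter_addr_0 mulr_natl mulrnAl.
Qed.

Lemma ball_convex {V : normedModType R} (x y c : V) (r t : R) :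
  `|x - c| < r -> `|y - c| < r -> 0 <= t <= 1 -> `|y + t *: (x - y) - c| < r.
Proof.
move=> xr yr /andP[t0 t1].
have -> : y + t *: (x - y) - c = (1 - t) *: (y - c) + t *: (x - c).
  have E : - (t *: (y - c)) + t *: (x - c) = t *: (x - y).
    by rewrite addrC -scalerBr opprB addrA subrK.
  by rewrite scalerBl scale1r -(addrA (y - c)) E addrAC.
rewrite (le_lt_trans (ler_normD _ _))// !normrZ (ger0_norm t0) ger0_norm ?subr_ge0//.
move: xr yr; move: (`|x - c|) (`|y - c|) => a b xr yr.
have [->|tn0] := eqVneq t 0; first by rewrite subr0 mul1r mul0r addr0.
have tp : 0 < t by rewrite lt_def tn0.
have : t * a < t * r by rewrite ltr_pM2l.
have : (1 - t) * b <= (1 - t) * r by rewrite ler_wpM2l ?subr_ge0// ltW.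
lra.
Qed.

(** The mean value theorem is applied to each entry separately. As the norm is the maximum of the
    entries, the constant [c] is not degraded. *)
Lemma lipschitz_on_ball m n (h : 'rV[R]_m -> 'rV[R]_n) x0 (r c : R) : 0 <= c ->
  (forall x, `|x - x0| < r -> differentiable h x) ->
  (forall x v, `|x - x0| < r -> `|'D_v h x| <= c * `|v|) ->
  forall x y, `|x - x0| < r -> `|y - x0| < r -> `|h x - h y| <= c * `|x - y|.
Proof.
move=> c0 dh hc x y xr yr; apply/mx_norm_leP => [|i]; first exact: mulr_ge0.
have seg (t : R) : 0 <= t <= 1 -> `|y + t *: (x - y) - x0| < r.
  exact: ball_convex.
have [t /andP[t0 t1] E] := @MVT_direction _ _ (fun z => h z 0 i : R^o) y (x - y)
  (fun t t01 => differentiable_entry i (dh _ (seg t t01))).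
have t01 : 0 <= t <= 1 by rewrite !ltW.
have -> : (h x - h y) 0 i = ('D_(x - y) h (y + t *: (x - y))) 0 i.
  rewrite -derive_entry; last exact: dh (seg t t01).
  have yx : y + (x - y) = x by rewrite addrC subrK.
  by rewrite -E yx !mxE.
apply: le_trans (hc _ _ (seg t t01)).
exact: entry_le_norm.
Qed.

(** Transpose of the usual Jacobian matrix: tangent vectors are rows and multiply it from the
    left. *)
Definition jac {m n} (f : 'rV[R]_m -> 'rV[R]_n) x : 'M[R]_(m, n) :=
  \matrix_(i, j) ('D_(delta_mx 0 i) f x) 0 j.

Lemma derive_jac {m n} (f : 'rV[R]_m -> 'rV[R]_n) x v : differentiable f x ->
  'D_v f x = v *m jac f x.
Proof.
move=> df; rewrite (derive_rV_sum v df); apply/rowP => j.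
by rewrite summxE mxE; apply: eq_bigr => i _; rewrite !mxE.
Qed.

Lemma injective_unitmx n (A : 'M[R]_n) :
  (forall v : 'rV_n, v *m A = 0 -> v = 0) -> A \in unitmx.
Proof.
move=> Ainj; rewrite -row_free_unit -kermx_eq0; apply/eqP/row_matrixP => i.
rewrite row0; apply: Ainj; rewrite -row_mul mulmx_ker; exact: row0.
Qed.

Lemma mulmx_bound m n (A : 'M[R]_(m, n)) :
  exists2 K : R, 0 < K & forall v : 'rV_m, `|v *m A| <= K * `|v|.
Proof.
exact: (linear_lipschitz (@row_linear_continuous R _ _ (mulmxr A))).
Qed.

(** With [B] the inverse of the derivative at [x0], the map [h x = x - f x *m B] has zero derivative
    at [x0], hence is 1/2-Lipschitz near it. Therefore [f] is injective there with Lipschitz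
    inverse, and solving [f x = y] amounts to finding a fixed point of the contraction
    [x |-> h x + y *m B]. *)
Theorem inverse_function n (f : 'rV[R]_n -> 'rV[R]_n) (O : set 'rV[R]_n) x0 :
  open O -> O x0 -> smooth_on O f -> (forall v, 'D_v f x0 = 0 -> v = 0) ->
  exists (U V : set 'rV[R]_n) (psi : 'rV[R]_n -> 'rV[R]_n),
  [/\ open U, U x0, U `<=` O & open V] /\
  [/\ forall x, U x -> V (f x), forall y, V y -> U (psi y),
      forall x, U x -> psi (f x) = x, forall y, V y -> f (psi y) = y &
      smooth_on V psi].
Proof.
move=> Oo Ox0 sf finj.
have df x : O x -> differentiable f x by exact: smooth_differentiable sf.
have uJ : jac f x0 \in unitmx.
  by apply: injective_unitmx => v; rewrite -derive_jac; [exact: finj|exact: df].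
pose B := invmx (jac f x0).
have [K K0 BK] := mulmx_bound B.
pose h x := x - f x *m B.
have sB : smooth_on O (fun x => f x *m B).
  apply: smooth_rV => // j.
  apply: (@smooth_eq _ _ _ _ (fun x => \sum_i (f x 0 i : R^o) *: (B i j : R^o))) => //.
    by move=> x _; rewrite mxE.
  apply: smooth_sum => // i; apply: smoothZ => //; first exact: smooth_entry.
  exact: smooth_on_cst.
have sh : smooth_on O h by apply: smoothB => //; exact: smooth_on_id.
have dh x : O x -> differentiable h x by exact: smooth_differentiable sh.
have DB x v : O x -> 'D_v (fun x => f x *m B) x = 'D_v f x *m B.
  move=> Ox; rewrite (@derive_comp _ _ _ _ f (mulmxr B) x v) //; last 2 first.
  - exact: df.
  - exact/linear_differentiable/row_linear_continuous.
  rewrite deriveE; last exact/linear_differentiable/row_linear_continuous.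
  by rewrite diff_lin//; exact: row_linear_continuous.
have Dh x v : O x -> 'D_v h x = v - 'D_v f x *m B.
  move=> Ox; rewrite derive_fB; last 2 first.
  - exact: ex_diff.
  - exact: smooth_differentiable sB Ox.
  by rewrite derive_id DB.
have Dh0 v : 'D_v h x0 = 0.
  by rewrite Dh// (derive_jac v (df _ Ox0)) mulmxK// subrr.
(* The n partial derivatives contribute at most n / (2 (n + 1)) <= 1/2 to the operator norm; [n.+1]
   keeps the bound meaningful for n = 0. *)
have [r r0 Hr] : exists2 r : R, 0 < r & forall x, `|x - x0| < r -> O x /\
    forall i, `|'D_(delta_mx 0 i) h x| <= (2 * n.+1%:R)^-1.
  have : \forall x \near x0, O x /\ forall i : 'I_n, `|'D_(delta_mx 0 i) h x| <= (2 * n.+1%:R)^-1.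
    apply: filterI; first exact: nbhs_open.
    apply: (@filter_forall 'rV[R]_n _ _ (nbhs x0) _) => i.
    have /cvgrPdist_le : {for x0, continuous ('D_(delta_mx 0 i) h)}.
      exact: (smooth_derive (delta_mx 0 i) sh 0%N x0 Ox0).
    move=> /(_ (2 * n.+1%:R)^-1); rewrite invr_gt0 mulr_gt0// => /(_ isT).
    by apply: filterS => x; rewrite Dh0 sub0r normrN.
  move=> /nbhs_normP[r /= r0 H]; exists r => // x xr.
  by apply: H; rewrite /= distrC.
have rO x : `|x - x0| < r -> O x by move=> /Hr[].
have hle x v : `|x - x0| < r -> `|'D_v h x| <= 2^-1 * `|v|.
  move=> xr; have [Ox Hx] := Hr _ xr.
  apply: le_trans (norm_derive_le v (dh _ Ox) Hx) _.
  rewrite ler_wpM2r// invfM mulrCA ler_piMr// ler_pdivrMr// mul1r.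
  by rewrite ler_nat.
have hL := lipschitz_on_ball _ (fun x xr => dh x (rO x xr)) hle.
have {}hL x y : `|x - x0| < r -> `|y - x0| < r -> `|h x - h y| <= `|x - y| / 2.
  by move=> xr yr; rewrite mulrC; apply: hL; rewrite ?invr_ge0.
have hf x y : x - y = (h x - h y) + (f x - f y) *m B.
  by rewrite /h mulmxBl; apply/rowP => j; rewrite !mxE; ring.
have fL x y : `|x - x0| < r -> `|y - x0| < r -> `|x - y| <= 2 * K * `|f x - f y|.
  move=> xr yr; have H1 := hL _ _ xr yr; have H2 := BK (f x - f y).
  have : `|x - y| <= `|h x - h y| + `|(f x - f y) *m B|.
    by rewrite {1}(hf x y) ler_normD.
  by move: H1 H2; rewrite -mulrA; move: (K * _) => w; lra.
(* [B] enlarges norms at most [K] times, so for [y] in [V] the contraction moves [x0] by less than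
   r/4. It then maps the closed ball of radius r/2 into the open one. The condition [V (f x)] in [U]
   makes the image of [U] exactly [V]. *)
pose V : set 'rV[R]_n := [set y | `|y - f x0| < r / (4 * K)].
pose U : set 'rV[R]_n := [set x | `|x - x0| < r / 2 /\ V (f x)].
have r2r x : `|x - x0| < r / 2 -> `|x - x0| < r.
  by move/lt_trans; apply; rewrite ltr_pdivrMr// ltr_pMr// ltr1n.
have ballo (z : 'rV[R]_n) d : open [set y | `|y - z| < d] by exact: open_normball.
have fU x : U x -> V (f x) by case.
have surj y : V y -> exists x, U x /\ f x = y.
  move=> Vy; pose T x := h x + y *m B.
  have Tx0 : `|T x0 - x0| < r / 4.
    have -> : T x0 - x0 = (y - f x0) *m B.
      by rewrite /T /h mulmxBl; apply/rowP => j; rewrite !mxE; ring.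
    rewrite (le_lt_trans (BK _))// mulrC -ltr_pdivlMr// -mulrA -invfM.
    exact: Vy.
  have TL x z : `|x - x0| <= r / 2 -> `|z - x0| <= r / 2 -> `|T x - T z| <= `|x - z| / 2.
    move=> xr zr; rewrite (_ : T x - T z = h x - h z); last first.
      by rewrite /T opprD addrACA subrr addr0.
    have r2 : r / 2 < r by rewrite ltr_pdivrMr// ltr_pMr// ltr1n.
    by apply: hL; exact: le_lt_trans r2.
  have x00 : `|x0 - x0| <= r / 2 by rewrite subrr normr0 divr_ge0// ltW.
  have Tr x : `|x - x0| <= r / 2 -> `|T x - x0| < r / 2.
    move=> xr; have := TL _ _ xr x00; have : `|T x - x0| <= `|T x - T x0| + `|T x0 - x0|.
      by rewrite (le_trans _ (ler_normD _ _))// addrA subrK.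
    move: Tx0 xr; move: (`|T x - T x0|) (`|T x - x0|) (`|T x0 - x0|) (`|x - x0|) => a b c d.
    lra.
  have [| | | |x xr Tx] := @contraction_fixed_point n x0 (r / 2) T.
  - by rewrite divr_ge0// ltW.
  - move=> x xr; have hx : {for x, continuous h}.
      apply: differentiable_continuous; apply: dh; apply: rO.
      by apply: (le_lt_trans xr); rewrite ltr_pdivrMr// ltr_pMr// ltr1n.
    exact: (continuousD hx (@cst_continuous _ _ (y *m B) x)).
  - by move=> x xr; rewrite ltW// Tr.
  - exact: TL.
  exists x; have fxy : f x = y.
    have : (y - f x) *m B = 0.
      have -> : (y - f x) *m B = T x - x.
        by rewrite mulmxBl /T /h; apply/rowP => j; rewrite !mxE; ring.
      by rewrite Tx subrr.
    move/(congr1 (mulmx^~ (jac f x0))); rewrite mulmxKV// mul0mx => /eqP.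
    by rewrite subr_eq0 => /eqP.
  by split=> //; split; [rewrite -Tx; exact: Tr|rewrite fxy].
pose psi y := get [set x | U x /\ f x = y].
have psiP y : V y -> U (psi y) /\ f (psi y) = y.
  move=> Vy; have [x Hx] := surj y Vy.
  exact: (@getPex _ [set x | U x /\ f x = y] (ex_intro _ x Hx)).
have Ur x : U x -> `|x - x0| < r by move=> [/r2r].
have psiL y z : V y -> V z -> `|psi y - psi z| <= 2 * K * `|y - z|.
  move=> Vy Vz; have [Uy {2}<-] := psiP _ Vy; have [Uz {2}<-] := psiP _ Vz.
  by apply: fL; exact: Ur.
have psif x : U x -> psi (f x) = x.
  move=> Ux; have [Up fp] := psiP _ (fU _ Ux).
  apply/eqP; rewrite -subr_eq0 -normr_le0.
  by apply: le_trans (fL _ _ (Ur _ Up) (Ur _ Ux)) _; rewrite fp subrr normr0 mulr0.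
have Vo : open V by exact: ballo.
have K2 : 0 < 2 * K by rewrite mulr_gt0.
have psic y : V y -> {for y, continuous psi}.
  move=> Vy; apply: continuous_eps => e e0; have [d d0 Hd] := open_ball Vo Vy.
  exists (Num.min d (e / (2 * K))); first by rewrite lt_min d0 divr_gt0.
  move=> z; rewrite lt_min => /andP[zd ze].
  by rewrite (le_trans (psiL _ _ (Hd _ zd) Vy))// mulrC -ler_pdivlMr// ltW.
(* A vector killed by the derivative of [f] is fixed by that of [h], which halves norms; so it is
   zero. *)
have uJx x : U x -> jac f x \in unitmx.
  move=> Ux; apply: injective_unitmx => v; rewrite -derive_jac => [Dv|]; last exact/df/rO/Ur.
  have := hle x v (Ur _ Ux); rewrite Dh; last exact/rO/Ur.
  rewrite Dv mul0mx subr0 => vv; apply/eqP; rewrite -normr_le0.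
  by move: vv; move: (`|v|) => a; lra.
(* The remainder of [psi] is minus the image of the remainder of [f] under the inverse Jacobian. The
   Lipschitz bound on [psi] turns an error small relative to the increment of [psi] into one small
   relative to [k]. *)
have dpsi y : V y -> differentiable psi y /\
    forall v, 'D_v psi y = v *m invmx (jac f (psi y)).
  move=> Vy; have [Up fp] := psiP _ Vy; pose L := mulmxr (invmx (jac f (psi y))) : {linear 'rV[R]_n -> 'rV[R]_n}.
  have Lc : continuous L by exact: row_linear_continuous.
  suff [dp dE] : differentiable psi y /\ 'd psi y = L :> (_ -> _).
    by split=> // v; rewrite deriveE// dE.
  apply: differentiable_eps => // e e0.
  have [K' K'0 K'P] := mulmx_bound (invmx (jac f (psi y))).
  have dfp : differentiable f (psi y) by exact/df/rO/Ur.
  have e'0 : 0 < e / (K' * (2 * K)) by rewrite divr_gt0// mulr_gt0.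
  have /nbhs_norm0P[d /= d0 Hd] := differentiable_epsE dfp e'0.
  have [dV dV0 HdV] := open_ball Vo Vy.
  apply/nbhs_norm0P; exists (Num.min dV (d / (2 * K))).
    by rewrite /= lt_min dV0 divr_gt0.
  move=> k /=; rewrite lt_min => /andP[kV kd'].
  have Vk : V (k + y) by apply: HdV; rewrite addrK.
  have [Uk fk] := psiP _ Vk.
  have kL : `|psi (k + y) - psi y| <= 2 * K * `|k|.
    by have := psiL _ _ Vk Vy; rewrite addrK.
  have kd : `|psi (k + y) - psi y| < d.
    apply: le_lt_trans kL _; rewrite mulrC -ltr_pdivlMr//.
  have {Hd} := Hd _ kd; rewrite subrK fk fp addrK.
  rewrite -(deriveE _ dfp) (derive_jac _ dfp) => Hk.
  have -> : psi (k + y) - psi y - L k =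
      - ((k - (psi (k + y) - psi y) *m jac f (psi y)) *m invmx (jac f (psi y))).
    by rewrite mulmxBl mulmxK ?uJx// opprB.
  rewrite normrN (le_trans (K'P _))// (le_trans (ler_wpM2l (ltW K'0) Hk))//.
  rewrite (le_trans (ler_wpM2l (ltW K'0) (ler_wpM2l (ltW e'0) kL)))//.
  have -> : K' * (e / (K' * (2 * K)) * (2 * K * `|k|)) = e * `|k|.
    by field; rewrite !gt_eqF.
  exact: lexx.
exists U, V, psi; split; split=> //.
- rewrite openE => x [xr Vx].
  have Ox : O x by exact/rO/r2r.
  apply: filterI; first exact: (nbhs_open (ballo x0 (r / 2)) xr).
  have fc : {for x, continuous f} by apply/differentiable_continuous/df.
  by apply: fc; exact: nbhs_open.
- by split; [rewrite subrr normr0 divr_gt0|rewrite /V /= subrr normr0 divr_gt0// mulr_gt0].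
- by move=> x /Ur/rO.
- by move=> y /psiP[].
- by move=> y /psiP[].
(* The derivative of [psi] is the inverse Jacobian of [f] evaluated at [psi]: it is as regular as
   [psi] is already known to be, which raises the order by one. *)
elim=> [|k IH] //=; split=> [y /dpsi[]//|v].
apply: (@Ck_on_eq _ _ _ Vo _ _ (fun y => v *m invmx (jac f (psi y)))).
  by move=> y /dpsi[_ ->].
apply: Ck_on_rV => // j.
apply: (@Ck_on_eq _ _ _ Vo _ _ (fun y => \sum_i (v 0 i : R^o) *: (invmx (jac f (psi y)) i j : R^o))).
  by move=> y _; rewrite mxE.
apply: Ck_on_sum => // i; apply: Ck_onZ => //; first exact: Ck_on_cst.
have uA y : V y -> jac f (psi y) \in unitmx by move=> /psiP[Up _]; exact: uJx.
apply: (@Ck_on_invmx R _ V Vo k n (fun y => jac f (psi y)) uA) => a b.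
apply: (@Ck_on_eq _ _ _ Vo _ _ ((fun x => ('D_(delta_mx 0 a) f x) 0 b : R^o) \o psi)).
  by move=> y _; rewrite /= mxE.
have VO y : V y -> O (psi y) by move=> /psiP[/Ur/rO].
apply: (Ck_on_comp Vo VO IH).
exact: (smooth_entry b Oo (smooth_derive (delta_mx 0 a) sf)).
Qed.

End InverseFunction.

(** * The Poincare lemma *)

Section Primitives.
Context {R : realType}.

Lemma exists_primitive (h : R -> R) : continuous h ->
  exists P : R -> R, forall t : R, 0 <= t <= 1 -> is_derive t 1 P (h t).
Proof.
(* Integrating from -1, on a segment reaching up to 2, makes 0 and 1 interior points, so that the
   derivative is two-sided there. *)
move=> hc; exists (fun x => \int[@lebesgue_measure R]_(t in `[-1, x]) h t)%R => t /andP[t0 t1].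
have t2 : t < 2 by rewrite (le_lt_trans t1)// ltr1n.
have hi : (@lebesgue_measure R).-integrable `[-1, 2] (EFin \o h).
  apply: continuous_compact_integrable; first exact: segment_compact.
  exact: continuous_subspaceT.
have a1 : (-1 : R) < t by rewrite (lt_le_trans _ t0)// ltrN10.
have [dP DP] := continuous_FTC1_closed t2 hi a1 (hc t).
by apply: DeriveDef; [exact: dP|rewrite -derive1E; exact: DP].
Qed.

End Primitives.

Section Dot.
Context {R : realType} {n : nat}.
Implicit Types v w : 'rV[R]_n.

(** A 1-form is encoded as a row-valued map [w]; [dotr (w x) v] is its value at [x] on the vector
    [v]. *)
Definition dotr w v : R := \sum_i w 0 i * v 0 i.

Lemma dotrDl w1 w2 v : dotr (w1 + w2) v = dotr w1 v + dotr w2 v.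
Proof. by rewrite -big_split; apply: eq_bigr => i _; rewrite mxE mulrDl. Qed.

Lemma dotrDr w v1 v2 : dotr w (v1 + v2) = dotr w v1 + dotr w v2.
Proof. by rewrite -big_split; apply: eq_bigr => i _; rewrite mxE mulrDr. Qed.

Lemma dotrZl k w v : dotr (k *: w) v = k * dotr w v.
Proof. by rewrite mulr_sumr; apply: eq_bigr => i _; rewrite mxE mulrA. Qed.

Lemma dotrZr k w v : dotr w (k *: v) = k * dotr w v.
Proof. by rewrite mulr_sumr; apply: eq_bigr => i _; rewrite mxE mulrCA. Qed.

Lemma dotrBl w1 w2 v : dotr (w1 - w2) v = dotr w1 v - dotr w2 v.
Proof. by rewrite dotrDl -scaleN1r dotrZl mulN1r. Qed.

Lemma dotrBr w v1 v2 : dotr w (v1 - v2) = dotr w v1 - dotr w v2.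
Proof. by rewrite dotrDr -scaleN1r dotrZr mulN1r. Qed.

Lemma dotr_le w v : `|dotr w v| <= n%:R * (`|w| * `|v|).
Proof.
rewrite (le_trans (ler_norm_sum _ _ _))//.
apply: (@le_trans _ _ (\sum_(i < n) `|w| * `|v|)).
  by apply: ler_sum => i _; rewrite normrM ler_pM// entry_le_norm.
by rewrite big_const_ord iter_addr_0 mulr_natl.
Qed.

Lemma derive_dotr {V : normedModType R} (f g : V -> 'rV[R]_n) (x u : V) :
  differentiable f x -> differentiable g x ->
  differentiable (fun y => dotr (f y) (g y) : R^o) x /\
  'D_u (fun y => dotr (f y) (g y) : R^o) x =
    dotr ('D_u f x) (g x) + dotr (f x) ('D_u g x).
Proof.
move=> df dg.
have H i := derive_fZ u (differentiable_entry i df) (differentiable_entry i dg).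
have [d E] := derive_fsum u (fun i => (H i).1).
split; first exact: d.
rewrite E /dotr -big_split /=; apply: eq_bigr => i _.
by rewrite (H i).2 !derive_entry.
Qed.

Lemma smooth_dotr {V : normedModType R} (U : set V) (f g : V -> 'rV[R]_n) : open U ->
  smooth_on U f -> smooth_on U g -> smooth_on U (fun y => dotr (f y) (g y) : R^o).
Proof.
by move=> Uo sf sg; apply: smooth_sum => // i; apply: smoothM => //; exact: smooth_entry.
Qed.

End Dot.

(** * Bounds on compact balls *)

Section Bounds.
Context {R : realType}.

Lemma bounded_on_ball m n (f : 'rV[R]_m -> 'rV[R]_n) x0 (r : R) : 0 <= r ->
  (forall x, `|x - x0| <= r -> {for x, continuous f}) ->
  exists2 M : R, 0 <= M & forall x, `|x - x0| <= r -> `|f x| <= M.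
Proof.
move=> r0 fc; pose A : set 'rV[R]_m := [set x | `|x - x0| <= r].
have Ac : compact A.
  apply: bounded_closed_compact.
    exists (`|x0| + r); split; first exact: num_real.
    move=> M rM x /= Ax; apply: le_trans (ltW rM).
    by rewrite -[x](subrK x0) (le_trans (ler_normD _ _))// addrC lerD2l.
  have -> : A = closed_ball_ Num.norm x0 r.
    by apply/seteqP; split=> x; rewrite /A /closed_ball_ /= distrC.
  exact: closed_closed_ball_.
have Tc' : {within A, continuous (fun x => `|f x|)}.
  apply: continuous_in_subspaceT => x; rewrite inE => Ax.
  apply: (@continuous_comp _ _ _ f Num.norm); first exact: fc.
  exact: norm_continuous.
have A0 : A !=set0 by exists x0; rewrite /A /= subrr normr0.
have [c _ cmax] := EVT_max_rV A0 Ac Tc'.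
by exists `|f c| => // x xr; apply: cmax; rewrite inE.
Qed.

Lemma uniform_bound n (f : 'I_n -> 'rV[R]_n -> 'rV[R]_n) x0 (r : R) : 0 <= r ->
  (forall i x, `|x - x0| <= r -> {for x, continuous (f i)}) ->
  exists2 M : R, 0 <= M & forall i x, `|x - x0| <= r -> `|f i x| <= M.
Proof.
move=> r0 fc.
have /choice[M HM] i : exists M : R, 0 <= M /\ forall x, `|x - x0| <= r -> `|f i x| <= M.
  by have [M M0 HM] := bounded_on_ball r0 (fc i); exists M.
exists (\sum_i M i); first by apply: sumr_ge0 => i _; have [] := HM i.
move=> i x xr; have [_ H] := HM i; apply: le_trans (H x xr) _.
rewrite (bigD1 i)//= lerDl sumr_ge0// => j _.
by have [] := HM j.
Qed.

Lemma C2_bounds n (f : 'rV[R]_n -> 'rV[R]_n) (O : set 'rV[R]_n) x0 (r : R) :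
  0 <= r -> smooth_on O f -> (forall x, `|x - x0| <= r -> O x) ->
  exists2 T : R, 0 <= T &
   (forall a v, `|a - x0| < r -> `|'D_v f a| <= T * `|v|) /\
   (forall a b v, `|a - x0| < r -> `|b - x0| < r ->
      `|'D_v f a - 'D_v f b| <= T * `|v| * `|a - b|).
Proof.
move=> r0 sf rO.
have sD i : smooth_on O ('D_(delta_mx 0 i) f) by exact: smooth_derive.
have [M M0 HM] : exists2 M : R, 0 <= M & forall i x, `|x - x0| <= r -> `|'D_(delta_mx 0 i) f x| <= M.
  by apply: uniform_bound => // i x xr; apply: (sD i 0%N); exact: rO.
have /choice[N HN] j : exists N : R, 0 <= N /\ forall i x, `|x - x0| <= r ->
    `|'D_(delta_mx 0 i) ('D_(delta_mx 0 j) f) x| <= N.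
  have [N N0 HN] : exists2 N : R, 0 <= N & forall i x, `|x - x0| <= r ->
    `|'D_(delta_mx 0 i) ('D_(delta_mx 0 j) f) x| <= N.
    apply: uniform_bound => // i x xr.
    by apply: (smooth_derive (delta_mx 0 i) (sD j) 0%N); exact: rO.
  by exists N.
pose N' := \sum_j N j.
have N'0 : 0 <= N' by apply: sumr_ge0 => j _; have [] := HN j.
have NN' j : N j <= N'.
  by rewrite /N' (bigD1 j)//= lerDl sumr_ge0// => k _; have [] := HN k.
have nn (c : R) : 0 <= c -> 0 <= n%:R * c by move=> ?; rewrite mulr_ge0.
have lip j a b : `|a - x0| < r -> `|b - x0| < r ->
    `|'D_(delta_mx 0 j) f a - 'D_(delta_mx 0 j) f b| <= n%:R * N' * `|a - b|.
  move=> ar br.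
  apply: (@lipschitz_on_ball _ _ _ ('D_(delta_mx 0 j) f) x0 r) => //; first exact: nn.
    by move=> x xr; apply: (smooth_differentiable (sD j)); exact/rO/ltW.
  move=> x v xr; apply: norm_derive_le.
    by apply: (smooth_differentiable (sD j)); exact/rO/ltW.
  by move=> i; apply: le_trans (NN' j); apply: (HN j).2; exact: ltW.
have fd x : `|x - x0| < r -> differentiable f x.
  by move=> xr; apply: (smooth_differentiable sf); exact/rO/ltW.
exists (n%:R * M + n%:R * (n%:R * N')); first by rewrite addr_ge0// !nn.
split=> [a v ar|a b v ar br].
  apply: le_trans (norm_derive_le v (fd _ ar) (fun i => HM i a (ltW ar))) _.
  by rewrite ler_wpM2r// lerDl !nn.
rewrite (derive_rV_sum v (fd _ ar)) (derive_rV_sum v (fd _ br)) -sumrB.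
rewrite (le_trans (ler_norm_sum _ _ _))//.
apply: (@le_trans _ _ (\sum_(i < n) `|v| * (n%:R * N' * `|a - b|))).
  apply: ler_sum => i _; rewrite -scalerBr normrZ ler_pM// ?lip//.
  exact: entry_le_norm.
rewrite big_const_ord iter_addr_0 -[leLHS]mulr_natl.
have -> : n%:R * (`|v| * (n%:R * N' * `|a - b|)) = n%:R * (n%:R * N') * `|v| * `|a - b|.
  by ring.
by rewrite ler_wpM2r// ler_wpM2r// lerDr nn.
Qed.

End Bounds.

Section Poincare.
Context {R : realType} {n : nat}.

Lemma continuous_lipschitz {V W : normedModType R} (f : V -> W) (c : R) :
  (forall x y, `|f x - f y| <= c * `|x - y|) -> continuous f.
Proof.
move=> fc x; apply: continuous_eps => e e0.
exists (e / (`|c| + 1)); first by rewrite divr_gt0// ltr_wpDl.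
move=> y; rewrite ltr_pdivlMr ?ltr_wpDl// => H.
apply: le_trans (fc y x) _; apply: le_trans (ltW H).
rewrite mulrC ler_wpM2l//; have := ler_norm c; lra.
Qed.

(** A 1-Lipschitz retraction of the line onto [0, 1]. It extends an integrand given along a ray to a
    function continuous on the whole line, as [exists_primitive] requires. *)
Definition unit_clamp (t : R) : R := Num.max 0 (Num.min 1 t).

Lemma unit_clamp_bound t : 0 <= unit_clamp t <= 1.
Proof. by rewrite /unit_clamp le_max lexx ge_max ler01 ge_min lexx. Qed.

Lemma unit_clamp_id t : 0 <= t <= 1 -> unit_clamp t = t.
Proof. by move=> /andP[t0 t1]; rewrite /unit_clamp min_r// max_r. Qed.

Lemma unit_clamp_lipschitz (s t : R) : `|unit_clamp s - unit_clamp t| <= `|s - t|.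
Proof.
have h1 := ler_norm (s - t); have h2 := ler_norm (t - s); rewrite [`|t - s|]distrC in h2.
move: h1 h2; move: (`|s - t|) => d h1 h2; rewrite /unit_clamp /Num.max /Num.min ler_norml.
by do ![case: ifPn]; rewrite -?leNgt => *; apply/andP; split; lra.
Qed.

Lemma differentiable_dotr (f : 'rV[R]_n -> R^o) (w x : 'rV[R]_n) :
  (forall e, 0 < e -> \forall h \near (0 : 'rV[R]_n), `|f (h + x) - f x - dotr w h| <= e * `|h|) ->
  differentiable f x /\ forall v, 'D_v f x = dotr w v.
Proof.
move=> fw; pose L0 v : R^o := dotr w v.
have L0lin : linear L0 by move=> k u v; rewrite /L0 dotrDr dotrZr.
pose L : {linear 'rV[R]_n -> R^o} := HB.pack L0 (GRing.isLinear.Build _ _ _ _ L0 L0lin).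
have Lc : continuous L by exact: row_linear_continuous.
have [df dE] := differentiable_eps Lc fw.
by split=> // v; rewrite deriveE// dE.
Qed.

Lemma derive_affine {V : normedModType R} (a b : V) (t : R) y h :
  differentiable (fun z => a + t *: (z - b)) y /\
  'D_h (fun z => a + t *: (z - b)) y = t *: h.
Proof.
have d0 : differentiable (fun z : V => z) y by exact: ex_diff.
have d1 : differentiable (fun z => z - b) y.
  exact: (differentiableB d0 (differentiable_cst b y)).
have [d2 D2] := @derive_fZ _ _ _ (cst t) _ y h (differentiable_cst _ _) d1.
have d3 : differentiable (fun z => cst t z *: (z - b)) y by exact: d2.
split; first exact: (differentiableD (differentiable_cst a y) d3).
rewrite (derive_fD h (differentiable_cst a y) d3) derive_cst add0r D2.
rewrite (derive_fB h d0 (differentiable_cst b y)) !derive_cst scale0r add0r subr0.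
by rewrite derive_id.
Qed.

(** The left-hand side is t ((Db - Da) z' + Da (z' - z)) + (wb - wa) h, where every product contains
    two factors of size |h|. The three products account for the constants r, 1 and 1 in [r + 2]. *)
Lemma ray_estimate (t T r : R) (Db Da z z' wb wa h sh : 'rV[R]_n) :
  0 <= t <= 1 -> 0 <= T -> 0 <= r -> `|Db - Da| <= T * `|h| * `|h| -> `|z'| <= r ->
  `|Da| <= T * `|h| -> `|sh| <= `|h| -> `|wb - wa| <= T * `|h| -> sh = z' - z ->
  `|t * dotr Db z' + dotr wb h - (t * dotr Da z + dotr wa h)| <=
     n%:R * T * (r + 2) * `|h| * `|h|.
Proof.
move=> /andP[t0 t1] T0 r0 Dab zr Dah shh wab shE.
have -> : t * dotr Db z' + dotr wb h - (t * dotr Da z + dotr wa h) =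
    t * (dotr (Db - Da) z' + dotr Da sh) + dotr (wb - wa) h.
  by rewrite shE dotrBr !dotrBl; ring.
have n0 : (0 : R) <= n%:R by exact: ler0n.
have n1 : `|dotr (Db - Da) z'| <= n%:R * (T * `|h| * `|h| * r).
  by apply: le_trans (dotr_le _ _) _; rewrite ler_wpM2l// ler_pM.
have n2 : `|dotr Da sh| <= n%:R * (T * `|h| * `|h|).
  by apply: le_trans (dotr_le _ _) _; rewrite ler_wpM2l// ler_pM.
have n3 : `|dotr (wb - wa) h| <= n%:R * (T * `|h| * `|h|).
  by apply: le_trans (dotr_le _ _) _; rewrite ler_wpM2l// ler_wpM2r.
have n4 : `|t * (dotr (Db - Da) z' + dotr Da sh)| <= `|dotr (Db - Da) z'| + `|dotr Da sh|.
  by rewrite normrM (ger0_norm t0) (le_trans _ (ler_normD _ _))// ler_piMl.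
apply: le_trans (ler_normD _ _) _.
apply: le_trans (lerD (le_trans n4 (lerD n1 n2)) n3) _.
by rewrite le_eqVlt; apply/orP; left; apply/eqP; ring.
Qed.

(* The potential of a closed form is its integral along rays; the remainder of
   its Taylor expansion is estimated through the mean value theorem in the
   integration variable, so that no differentiation under the integral is
   needed. *)
Lemma poincare (w : 'rV[R]_n -> 'rV[R]_n) (O : set 'rV[R]_n) x0 (r : R) :
  smooth_on O w -> (forall x, `|x - x0| < r -> O x) ->
  (forall x u v, O x -> dotr ('D_u w x) v = dotr ('D_v w x) u) ->
  exists W : 'rV[R]_n -> R^o, W x0 = 0 /\
    forall x, `|x - x0| < r -> differentiable W x /\ forall v, 'D_v W x = dotr (w x) v.
Proof.
move=> sw rO wcl.
have dw x : O x -> differentiable w x by exact: smooth_differentiable sw.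
have ray (c t : R) x : 0 <= t <= 1 -> `|x - x0| < c -> `|x0 + t *: (x - x0) - x0| < c.
  move=> /andP[t0 t1] xr; rewrite addrAC subrr add0r normrZ ger0_norm//.
  by apply: le_lt_trans xr; rewrite ler_piMl.
have rO' (t : R) x : 0 <= t <= 1 -> `|x - x0| < r -> O (x0 + t *: (x - x0)).
  by move=> t01 xr; apply/rO/ray.
pose H x (t : R) : R := dotr (w (x0 + t *: (x - x0))) (x - x0).
(* [P x] is a primitive of the integrand along the ray from [x0] to [x], with junk value 0 outside
   the ball. *)
have /choice[P HP] x : exists P : R -> R, `|x - x0| < r ->
    forall t : R, 0 <= t <= 1 -> is_derive t 1 P (H x t).
  have [xr|_] := ltP (`|x - x0|) r; last by exists (fun=> 0).
  have hc : continuous (fun t : R => H x (unit_clamp t)).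
    have c1 : continuous (fun t : R => x0 + unit_clamp t *: (x - x0)).
      apply: (@continuous_lipschitz _ _ _ (`|x - x0|)) => s t.
      rewrite opprD addrACA subrr add0r -scalerBl normrZ mulrC ler_wpM2l//.
      exact: unit_clamp_lipschitz.
    have c2 : continuous (fun z => dotr z (x - x0) : R^o).
      apply: (@continuous_lipschitz _ _ _ (n%:R * `|x - x0|)) => y z.
      by rewrite -dotrBl (le_trans (dotr_le _ _))// -mulrA [`|_| * `|y - z|]mulrC.
    move=> t.
    have c3 : {for (x0 + unit_clamp t *: (x - x0)), continuous w}.
      apply: differentiable_continuous; apply: dw; apply: rO' => //; exact: unit_clamp_bound.
    exact: (continuous_comp (continuous_comp (c1 t) c3) (c2 _)).
  have [P HP] := exists_primitive hc.
  exists P => _ t t01; have := HP t t01.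
  by rewrite (unit_clamp_id t01).
exists (fun x => P x 1 - P x 0 - (P x0 1 - P x0 0)); split; first by rewrite subrr.
(* A radius strictly between the distance from [x] to [x0] and [r]: the closed ball of radius [r1]
   is compact and contained in [O], hence carries uniform bounds on the derivatives of [w]. *)
move=> x xr; pose r1 := (`|x - x0| + r) / 2.
have xr1 : `|x - x0| < r1 by rewrite /r1 ltr_pdivlMr// mulr_natr mulr2n ltrD2l.
have r1r : r1 < r by rewrite /r1 ltr_pdivrMr// mulr_natr mulr2n ltrD2r.
have r10 : 0 <= r1 by exact: le_trans (ltW xr1).
have [T T0 [T1 T2]] := C2_bounds r10 sw (fun y yr => rO y (le_lt_trans yr r1r)).
apply: differentiable_dotr => e e0.
pose C := n%:R * T * (r1 + 2) + 1.
have C0 : 0 < C by rewrite ltr_wpDl// !mulr_ge0// addr_ge0.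
have rx : 0 < r1 - `|x - x0| by rewrite subr_gt0.
apply/nbhs_norm0P; exists (Num.min (r1 - `|x - x0|) (e / C)).
  by rewrite /= lt_min rx divr_gt0.
move=> h /=; rewrite lt_min => /andP[hr he].
have segr (s : R) : 0 <= s <= 1 -> `|x + s *: h - x0| < r1.
  move=> /andP[s0 s1]; rewrite addrAC (le_lt_trans (ler_normD _ _))// normrZ ger0_norm//.
  have : s * `|h| <= `|h| by rewrite ler_piMl.
  by move: hr; move: (`|x - x0|) (`|h|) (s * _) => a b c; lra.
have xhr : `|h + x - x0| < r.
  apply: lt_trans r1r; rewrite [h + x]addrC.
  by have := segr 1; rewrite scale1r; apply; rewrite ler01 lexx.
pose a (t : R) := x0 + t *: (x - x0).
(* [Q 1 - Q 0] is the Taylor remainder of the potential at [x], because the subtracted term vanishes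
   at t = 0 and is [dotr (w x) h] at t = 1. The mean value theorem replaces it by [Q' t], which
   contains no integral. *)
pose Q (t : R) : R^o := P (h + x) t - P x t - dotr (w (a t)) (t *: h).
pose Q' (t : R) : R^o := H (h + x) t - H x t -
  (dotr ('D_(x - x0) w (a t)) (t *: h) + dotr (w (a t)) h).
have dQ (t : R) : 0 <= t <= 1 -> is_derive t 1 Q (Q' t).
  move=> t01; apply: is_deriveB.
    by apply: is_deriveB; [exact: (HP _ xhr)|exact: (HP _ xr)].
  have [dwt Dwt] := is_derive_segment (dw _ (rO' t x t01 xr)).
  have dwt' : differentiable (fun s : R^o => w (x0 + s *: (x - x0))) t by apply/derivable1_diffP.
  have idh : is_diff t (fun s : R^o => s *: h) (fun s => s *: h) by exact: is_diff_scalel.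
  have dh : differentiable (fun s : R^o => s *: h) t by exact: ex_diff.
  have [dd DD] := @derive_dotr _ _ _ (fun s : R^o => w (x0 + s *: (x - x0))) (fun s => s *: h) t 1 dwt' dh.
  apply: DeriveDef; first exact: diff_derivable.
  rewrite DD Dwt; congr (_ + dotr _ _).
  by rewrite deriveE// diff_val scale1r.
have [||t] := @MVT R Q Q' 0 1 ltr01.
- by move=> t; rewrite in_itv /= => /andP[t0 t1]; apply: dQ; rewrite !ltW.
- apply: continuous_in_subspaceT => t; rewrite inE /= in_itv /= => t01.
  have [+ _] := dQ _ t01.
  by move=> /derivable1_diffP; exact: differentiable_continuous.
rewrite in_itv /= subr0 mulr1 => /andP[t0 t1] E.
have t01 : 0 <= t <= 1 by rewrite !ltW.
have -> : P (h + x) 1 - P (h + x) 0 - (P x0 1 - P x0 0) -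
    (P x 1 - P x 0 - (P x0 1 - P x0 0)) - dotr (w x) h = Q' t.
  have a1 : a 1 = x by rewrite /a scale1r addrC subrK.
  have z0 : dotr (w (a 0)) (0 *: h) = 0 by rewrite dotrZr mul0r.
  rewrite -E /Q a1 z0 scale1r.
  by move: (dotr (w x) h) (P _ _) (P _ _) (P _ _) (P _ _) (P _ _) (P _ _) => *; ring.
have dG (s : R) : 0 <= s <= 1 -> differentiable (fun y => w (x0 + t *: (y - x0))) (x + s *: h) /\
   'D_h (fun y => w (x0 + t *: (y - x0))) (x + s *: h) = t *: 'D_h w (x0 + t *: (x + s *: h - x0)).
  move=> s01; have dws := dw _ (rO' t _ t01 (lt_trans (segr s s01) r1r)).
  have [da Da] := derive_affine x0 x0 t (x + s *: h) h.
  split; first exact: (differentiable_comp da dws).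
  have -> := derive_comp h da dws.
  by rewrite Da derive_scalev.
have dH (s : R) : 0 <= s <= 1 -> differentiable (fun y => H y t : R^o) (x + s *: h) /\
   'D_h (fun y => H y t : R^o) (x + s *: h) =
    dotr (t *: 'D_h w (x0 + t *: (x + s *: h - x0))) (x + s *: h - x0) +
    dotr (w (x0 + t *: (x + s *: h - x0))) h.
  move=> s01; have [d1 D1] := dG s s01.
  have d0 : differentiable (fun y : 'rV[R]_n => y) (x + s *: h) by exact: ex_diff.
  have di : differentiable (fun y => y - x0) (x + s *: h).
    exact: (differentiableB d0 (differentiable_cst x0 _)).
  have Di : 'D_h (fun y => y - x0) (x + s *: h) = h.
    by rewrite (derive_fB h d0 (differentiable_cst x0 _)) derive_cst derive_id subr0.
  have [d2 D2] := derive_dotr h d1 di.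
  split; first exact: d2.
  by rewrite D2 D1 Di.
(* A second application of the mean value theorem, now along [h], expresses the difference of the
   integrands through the derivative of [w] in the direction [h] at a point [b] close to [a t]. *)
have [s /andP[s0 s1] Es] := MVT_direction (fun s s01 => (dH s s01).1).
have s01 : 0 <= s <= 1 by rewrite !ltW.
rewrite [x + h]addrC (dH s s01).2 in Es.
rewrite /Q' Es.
have sr := segr s s01.
set b := x0 + t *: (x + s *: h - x0).
have br : `|b - x0| < r1 by exact: ray.
have ar : `|a t - x0| < r1 by exact: ray.
have atr : `|a t - x0| < r by exact: lt_trans r1r.
have ba : b - a t = (t * s) *: h.
  by rewrite /b /a opprD addrACA subrr add0r -scalerBr opprB addrA subrK addrAC subrr add0r scalerA.
(* Closedness exchanges [h] and the ray direction, so that the terms at [a t] and at [b] have the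
   same shape and cancel to first order in [h]. *)
rewrite dotrZr wcl; last exact: rO.
rewrite dotrZl.
have bah : `|b - a t| <= `|h|.
  have ts0 : 0 <= t * s by apply: mulr_ge0; exact: ltW.
  have ts1 : t * s <= 1 by apply: mulr_ile1; exact: ltW.
  by rewrite ba normrZ ger0_norm// ler_piMl.
have wba : `|w b - w (a t)| <= T * `|h|.
  apply: (@le_trans _ _ (T * `|b - a t|)); last by rewrite ler_wpM2l.
  apply: (@lipschitz_on_ball _ _ _ w x0 r1) => // y yr.
  by apply: dw; apply: rO; exact: lt_trans r1r.
have Dba : `|'D_h w b - 'D_h w (a t)| <= T * `|h| * `|h|.
  by apply: (le_trans (T2 _ _ h br ar)); rewrite ler_wpM2l// mulr_ge0.
have Da := T1 _ h ar.
have shh : `|s *: h| <= `|h| by rewrite normrZ ger0_norm ?(ltW s0)// ler_piMl// ltW.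
have shE : s *: h = (x + s *: h - x0) - (x - x0).
  by apply/rowP => j; rewrite !mxE; ring.
have := ray_estimate t01 T0 r10 Dba (ltW sr) Da shh wba shE.
move/le_trans; apply; apply: (@le_trans _ _ (C * `|h| * `|h|)).
  by rewrite /C mulrDl mulrDl mul1r lerDl mulr_ge0.
by rewrite ler_wpM2r// mulrC -ler_pdivlMr// ltW.
Qed.

(** The mean value theorem is applied to a single [u k], with a bound that does not depend on [k];
    then k tends to infinity with [h] fixed. Thus pointwise convergence of [u k] and uniform
    convergence of the gradients suffice. *)
Lemma derive_uniform_limit (u : nat -> 'rV[R]_n -> R^o) (w : nat -> 'rV[R]_n -> 'rV[R]_n)
    (u' : 'rV[R]_n -> R^o) (w' : 'rV[R]_n -> 'rV[R]_n) x0 (r : R) :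
  (forall k x, `|x - x0| < r -> differentiable (u k) x) ->
  (forall k x v, `|x - x0| < r -> 'D_v (u k) x = dotr (w k x) v) ->
  (forall k x, `|x - x0| < r -> {for x, continuous (w k)}) ->
  (forall x, `|x - x0| < r -> forall e, 0 < e -> exists N, forall k, (N <= k)%N ->
     `|u k x - u' x| <= e) ->
  (forall e, 0 < e -> exists N, forall k, (N <= k)%N -> forall x, `|x - x0| < r ->
     `|w k x - w' x| <= e) ->
  forall x, `|x - x0| < r -> differentiable u' x /\ forall v, 'D_v u' x = dotr (w' x) v.
Proof.
move=> du Du wc uu ww x xr.
apply: differentiable_dotr => e e0.
(* The factor 4 shares the error among three comparisons with the limit and the continuity of one
   fixed [w N]; the dimension comes from [dotr_le]. *)
have e1 : 0 < e / (n.+1%:R * 4) by rewrite divr_gt0.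
have [N HN] := ww _ e1.
have /cvgrPdist_le/(_ _ e1)/nbhs_normP[d /= d0 Hd] := wc N x xr.
have rx : 0 < r - `|x - x0| by rewrite subr_gt0.
apply/nbhs_norm0P; exists (Num.min (r - `|x - x0|) d).
  by rewrite /= lt_min rx d0.
move=> h /=; rewrite lt_min => /andP[hr hd].
have segr (s : R) : 0 <= s <= 1 -> `|x + s *: h - x0| < r /\ `|s *: h| <= `|h|.
  move=> /andP[s0 s1].
  have : `|s *: h| <= `|h| by rewrite normrZ ger0_norm// ler_piMl.
  move=> sh; split=> //; rewrite addrAC (le_lt_trans (ler_normD _ _))//.
  by move: hr sh; move: (`|x - x0|) (`|h|) (`|s *: h|) => a b c; lra.
have xhr : `|x + h - x0| < r.
  by have [] := segr 1; rewrite ?scale1r ?ler01 ?lexx.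
have main k : (N <= k)%N -> `|u k (x + h) - u k x - dotr (w' x) h| <= e * `|h|.
  move=> Nk.
  have [s /andP[s0 s1] ->] := @MVT_direction _ _ (u k) x h (fun s s01 => du k _ (segr s s01).1).
  have s01 : 0 <= s <= 1 by rewrite !ltW.
  have [sr sh] := segr s s01.
  rewrite (Du k _ h sr) -dotrBl (le_trans (dotr_le _ _))// mulrA ler_wpM2r//.
  have H1 := HN k Nk _ sr; have H2 := HN N (leqnn N) _ sr; have H3 := HN N (leqnn N) _ xr.
  have H4 : `|w N x - w N (x + s *: h)| <= e / (n.+1%:R * 4).
    by apply: Hd; rewrite /= opprD addrA subrr add0r normrN (le_lt_trans sh).
  have : `|w k (x + s *: h) - w' x| <= e / n.+1%:R.
    have -> : w k (x + s *: h) - w' x = (w k (x + s *: h) - w' (x + s *: h)) -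
       (w N (x + s *: h) - w' (x + s *: h)) - (w N x - w N (x + s *: h)) + (w N x - w' x).
      by apply/rowP => j; rewrite !mxE; ring.
    have -> : e / n.+1%:R = e / (n.+1%:R * 4) + e / (n.+1%:R * 4) + e / (n.+1%:R * 4) + e / (n.+1%:R * 4).
      by field.
    rewrite (le_trans (ler_normD _ _))// lerD// (le_trans (ler_normB _ _))// lerD//.
    by rewrite (le_trans (ler_normB _ _))// lerD.
  move=> H; rewrite (le_trans (ler_wpM2l (ler0n _ n) H))//.
  by rewrite mulrCA ler_piMr ?(ltW e0)// ler_pdivrMr// mul1r ler_nat.
rewrite [h + x]addrC; apply/ler_addgt0Pl => eta eta0.
have eta2 : 0 < eta / 2 by rewrite divr_gt0.
have [N1 HN1] := uu _ xhr _ eta2; have [N2 HN2] := uu _ xr _ eta2.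
pose k := maxn N (maxn N1 N2).
have H1 := main k (leq_maxl _ _).
have k1 : (N1 <= k)%N by rewrite /k !leq_max leqnn orbT.
have k2 : (N2 <= k)%N by rewrite /k !leq_max leqnn !orbT.
have H2 := HN1 k k1; have H3 := HN2 k k2.
move: H1 H2 H3; move: (dotr (w' x) h) (u k (x + h)) (u k x) (u' (x + h)) (u' x) => l a b c d'.
move=> H1 H2 H3.
have -> : c - d' - l = (a - b - l) - (a - c) + (b - d') by ring.
apply: le_trans (ler_normD _ _) _; have := ler_normB (a - b - l) (a - c).
by move: H1 H2 H3; lra.
Qed.

End Poincare.

(** * Adapted frames *)

Section Frames.
Context {R : realType}.

Lemma ord3P (P : 'I_3 -> Prop) : P 0 -> P 1 -> P ord_max -> forall i, P i.
Proof.
move=> P0 P1 P2 [[|[|[|i]]] Hi] //.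
- by rewrite (_ : Ordinal Hi = 0)//; apply/val_inj.
- by rewrite (_ : Ordinal Hi = 1)//; apply/val_inj.
- by rewrite (_ : Ordinal Hi = ord_max)//; apply/val_inj.
Qed.

Lemma sum3 (V : nmodType) (F : 'I_3 -> V) : \sum_i F i = F 0 + F 1 + F ord_max.
Proof.
rewrite !big_ord_recl big_ord0 addr0 addrA; congr (_ + F _ + F _); exact/val_inj.
Qed.

Definition frame (a b c : 'rV[R]_3) : 'M[R]_3 := \matrix_(i < 3) [:: a; b; c]`_i.

Lemma frame_comb (u a b c : 'rV[R]_3) :
  u *m frame a b c = u 0 0 *: a + u 0 1 *: b + u 0 ord_max *: c.
Proof. by rewrite mulmx_sum_row sum3 !rowK. Qed.

(** The dual basis: column [k] of the inverse matrix, turned into a row so that [dotr] evaluates it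
    as a 1-form. *)
Definition coframe (M : 'M[R]_3) (k : 'I_3) : 'rV[R]_3 := \row_i invmx M i k.

Lemma dotr_coframe M k v : dotr (coframe M k) v = (v *m invmx M) 0 k.
Proof. by rewrite mxE; apply: eq_bigr => i _; rewrite mxE mulrC. Qed.

Lemma frame_decomp a b c v : frame a b c \in unitmx ->
  v = dotr (coframe (frame a b c) 0) v *: a + dotr (coframe (frame a b c) 1) v *: b +
      dotr (coframe (frame a b c) ord_max) v *: c.
Proof. by move=> u; rewrite !dotr_coframe -frame_comb mulmxKV. Qed.

Lemma coframe_comb a b c x y z k : frame a b c \in unitmx ->
  dotr (coframe (frame a b c) k) (x *: a + y *: b + z *: c) = [:: x; y; z]`_k.
Proof.
move=> u; pose w : 'rV[R]_3 := \row_i [:: x; y; z]`_i.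
have -> : x *: a + y *: b + z *: c = w *m frame a b c by rewrite frame_comb !mxE.
by rewrite dotr_coframe mulmxK// mxE.
Qed.

Lemma frame_inj a b c x y z x' y' z' : frame a b c \in unitmx ->
  x *: a + y *: b + z *: c = x' *: a + y' *: b + z' *: c ->
  [/\ x = x', y = y' & z = z'].
Proof.
move=> u E; have H k := congr1 (dotr (coframe (frame a b c) k)) E.
by split; [have := H 0|have := H 1|have := H ord_max]; rewrite !coframe_comb.
Qed.

Lemma coframe1 a b c k : frame a b c \in unitmx ->
  dotr (coframe (frame a b c) k) a = (k == 0)%:R.
Proof.
move=> u; have := coframe_comb 1 0 0 k u; rewrite scale1r !scale0r !addr0 => ->.
by move: k; apply: ord3P.
Qed.

Lemma coframe2 a b c k : frame a b c \in unitmx ->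
  dotr (coframe (frame a b c) k) b = (k == 1)%:R.
Proof.
move=> u; have := coframe_comb 0 1 0 k u; rewrite scale1r !scale0r addr0 add0r => ->.
by move: k; apply: ord3P.
Qed.

Lemma coframe3 a b c k : frame a b c \in unitmx ->
  dotr (coframe (frame a b c) k) c = (k == ord_max)%:R.
Proof.
move=> u; have := coframe_comb 0 0 1 k u; rewrite scale1r !scale0r !add0r => ->.
by move: k; apply: ord3P.
Qed.

Lemma smooth_coframe (U : set 'rV[R]_3) (X Y Z : 'rV[R]_3 -> 'rV[R]_3) k : open U ->
  smooth_on U X -> smooth_on U Y -> smooth_on U Z ->
  (forall x, U x -> frame (X x) (Y x) (Z x) \in unitmx) ->
  smooth_on U (fun x => coframe (frame (X x) (Y x) (Z x)) k).
Proof.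
move=> Uo sX sY sZ uU; apply: smooth_rV => // j.
apply: (@smooth_eq _ _ _ _ (fun x => invmx (frame (X x) (Y x) (Z x)) j k : R^o)) => //.
  by move=> x _; rewrite mxE.
apply: smooth_invmx => // a b.
move: a; apply: ord3P.
- by apply: (smooth_eq Uo _ (smooth_entry b Uo sX)) => x _; rewrite mxE.
- by apply: (smooth_eq Uo _ (smooth_entry b Uo sY)) => x _; rewrite mxE.
- by apply: (smooth_eq Uo _ (smooth_entry b Uo sZ)) => x _; rewrite mxE.
Qed.

End Frames.

(** * Closed 1-forms in an adapted frame *)

Section AdaptedFrames.
Context {R : realType}.
Local Notation E := 'rV[R]_3.

(** The flat structure equations on an open set of R^3. They are all that the construction of
    coordinates uses, so that it never refers to the manifold or to the original pair. *)
Record adapted_frame (B : set E) (X H Y : E -> E) (eps nu : E -> R^o) : Prop := {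
  af_open : open B;
  af_X : smooth_on B X;
  af_H : smooth_on B H;
  af_Y : smooth_on B Y;
  af_eps : smooth_on B eps;
  af_nu : smooth_on B nu;
  af_unit : forall x, B x -> frame (X x) (H x) (Y x) \in unitmx;
  af_XH : forall x, B x -> lbr X H x = 0;
  af_YX : forall x, B x -> lbr Y X x = H x;
  af_YH : forall x, B x -> lbr Y H x = eps x *: X x + nu x *: H x;
  af_Xeps : forall x, B x -> 'D_(X x) eps x = 0;
  af_Heps : forall x, B x -> 'D_(H x) eps x = 0;
  af_Xnu : forall x, B x -> 'D_(X x) nu x = 0;
  af_Hnu : forall x, B x -> 'D_(H x) nu x = 0
}.

Lemma adapted_frame_sub B B' X H Y eps nu : open B' -> B' `<=` B ->
  adapted_frame B X H Y eps nu -> adapted_frame B' X H Y eps nu.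
Proof.
by move=> Bo BB [? ? ? ? ? ? u ? ? ? ? ? ? ?]; split=> //;
  try (by move=> x /BB; auto); try exact: smooth_sub BB _.
Qed.

(* d w (A, C) = A (w C) - C (w A) - w [A, C] *)
Lemma cartan (B : set E) (w A C : E -> E) x : open B -> B x ->
  smooth_on B w -> smooth_on B A -> smooth_on B C ->
  dotr ('D_(A x) w x) (C x) - dotr ('D_(C x) w x) (A x) =
  'D_(A x) (fun y => dotr (w y) (C y) : R^o) x -
  'D_(C x) (fun y => dotr (w y) (A y) : R^o) x - dotr (w x) (lbr A C x).
Proof.
move=> Bo Bx sw sA sC.
have dw := smooth_differentiable sw Bx; have dA := smooth_differentiable sA Bx.
have dC := smooth_differentiable sC Bx.
rewrite (derive_dotr (A x) dw dC).2 (derive_dotr (C x) dw dA).2.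
have -> : dotr (w x) (lbr A C x) = dotr (w x) ('D_(A x) C x) - dotr (w x) ('D_(C x) A x).
  exact: dotrBr.
by move: (dotr _ _) (dotr _ _) (dotr _ _) (dotr _ _) => *; ring.
Qed.

(** By bilinearity, symmetry needs testing on pairs of basis vectors only. With [L] the differential
    of a 1-form at a point, this reduces closedness to three equations. *)
Lemma closed_on_frame (a b c u v : E) (L : {linear E -> E}) :
  frame a b c \in unitmx ->
  dotr (L a) b = dotr (L b) a -> dotr (L c) a = dotr (L a) c ->
  dotr (L c) b = dotr (L b) c -> dotr (L u) v = dotr (L v) u.
Proof.
move=> U ab ca cb.
rewrite (frame_decomp u U) (frame_decomp v U).
move: (dotr _ u) (dotr _ u) (dotr _ u) (dotr _ v) (dotr _ v) (dotr _ v).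
move=> u1 u2 u3 v1 v2 v3.
rewrite !linearD !linearZ /= !(dotrDl, dotrDr, dotrZl, dotrZr) ab ca cb.
by move: (dotr _ _) (dotr _ _) (dotr _ _) (dotr _ _) (dotr _ _) (dotr _ _) => *; ring.
Qed.

(** [p], [q], [s] are the values of the 1-form on X, H, Y. The three equations say that its exterior
    derivative vanishes on (X, H), (Y, X) and (Y, H), the brackets being replaced by their values 0,
    H and eps X + nu H. The Picard iterates, the planar coordinates and w itself all arise from
    it. *)
Lemma frame_potential X H Y (eps nu p q s : E -> R^o) x0 (r : R) (c : R) :
  let B := [set x | `|x - x0| < r] in
  let cf k x := coframe (frame (X x) (H x) (Y x)) k in
  adapted_frame B X H Y eps nu ->
  smooth_on B p -> smooth_on B q -> smooth_on B s ->
  (forall x, B x -> 'D_(X x) q x = 'D_(H x) p x) ->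
  (forall x, B x -> 'D_(Y x) p x - 'D_(X x) s x = q x) ->
  (forall x, B x -> 'D_(Y x) q x - 'D_(H x) s x = eps x * p x + nu x * q x) ->
  exists W : E -> R^o, [/\ W x0 = c, smooth_on B W &
   forall x v, B x -> 'D_v W x =
     p x * dotr (cf 0 x) v + q x * dotr (cf 1 x) v + s x * dotr (cf ord_max x) v].
Proof.
move=> B cf af sp sq ss e1 e2 e3.
have Bo := af_open af.
have scf k : smooth_on B (cf k).
  by apply: smooth_coframe; [|exact: af_X af|exact: af_H af|exact: af_Y af|exact: af_unit af].
pose w x : E := p x *: cf 0 x + q x *: cf 1 x + s x *: cf ord_max x.
have sw : smooth_on B w.
  by apply: smoothD => //; [apply: smoothD => //|]; apply: smoothZ.
have wE x v : dotr (w x) v =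
    p x * dotr (cf 0 x) v + q x * dotr (cf 1 x) v + s x * dotr (cf ord_max x) v.
  by rewrite /w !dotrDl !dotrZl.
have wX x : B x -> dotr (w x) (X x) = p x.
  by move=> Bx; rewrite wE /cf !coframe1 ?(af_unit af)//= mulr1 !mulr0 !addr0.
have wH x : B x -> dotr (w x) (H x) = q x.
  by move=> Bx; rewrite wE /cf !coframe2 ?(af_unit af)//= mulr1 !mulr0 addr0 add0r.
have wY x : B x -> dotr (w x) (Y x) = s x.
  by move=> Bx; rewrite wE /cf !coframe3 ?(af_unit af)//= mulr1 !mulr0 !add0r.
have DwE (A : E -> E) (f : E -> R^o) x v : B x -> (forall y, B y -> dotr (w y) (A y) = f y) ->
    'D_v (fun y => dotr (w y) (A y) : R^o) x = 'D_v f x.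
  by move=> Bx Af; apply: near_eq_derive; apply: filterS (nbhs_open Bo Bx) => y; exact: Af.
have wcl x u v : B x -> dotr ('D_u w x) v = dotr ('D_v w x) u.
  move=> Bx; have dw := smooth_differentiable sw Bx.
  rewrite !deriveE//; apply: (closed_on_frame u v (af_unit af Bx)).
  - rewrite -!deriveE//; apply/eqP; rewrite -subr_eq0.
    rewrite (cartan Bo Bx sw (af_X af) (af_H af)) (DwE _ _ _ _ Bx wX) (DwE _ _ _ _ Bx wH).
    by rewrite (af_XH af Bx) e1// -(scale0r 0) dotrZr mul0r subrr subr0.
  - rewrite -!deriveE//; apply/eqP; rewrite -subr_eq0.
    rewrite (cartan Bo Bx sw (af_Y af) (af_X af)) (DwE _ _ _ _ Bx wX) (DwE _ _ _ _ Bx wY).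
    by rewrite (af_YX af Bx) e2// wH// subrr.
  - rewrite -!deriveE//; apply/eqP; rewrite -subr_eq0.
    rewrite (cartan Bo Bx sw (af_Y af) (af_H af)) (DwE _ _ _ _ Bx wY) (DwE _ _ _ _ Bx wH).
    by rewrite (af_YH af Bx) e3// dotrDr !dotrZr wX// wH// subrr.
have [W [W0 HW]] := @poincare _ _ w B x0 r sw (fun x Bx => Bx) wcl.
have dW x : B x -> differentiable W x by move=> /HW[].
have dWc x v : B x -> differentiable (fun x => W x + c : R^o) x /\
    'D_v (fun x => W x + c : R^o) x = dotr (w x) v.
  move=> Bx; have [d1 D1] := HW x Bx; have dc := differentiable_cst (c : R^o) x.
  split; first exact: (differentiableD d1 dc).
  by rewrite (derive_fD v d1 dc) derive_cst addr0 D1.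
exists (fun x => W x + c); split; first by rewrite W0 add0r.
- apply: smooth_onS => [x Bx|v]; first by have [] := dWc x 0 Bx.
  apply: (@smooth_eq _ _ _ _ (fun x => dotr (w x) v : R^o)) => //.
    by move=> x Bx; rewrite (dWc x v Bx).2.
  by apply: smooth_dotr => //; exact: smooth_on_cst.
- by move=> x v Bx; rewrite (dWc x v Bx).2 wE.
Qed.

End AdaptedFrames.

(** * A linear system along a frame *)

Section LinearSystem.
Context {R : realType}.
Local Notation E := 'rV[R]_3.

(** The intervals of centre [u k] and radius 2 M / 2^k are nested, so the supremum of their left
    endpoints lies in all of them. The explicit rate makes the convergence uniform when [u] depends
    on a point. *)
Lemma geometric_limit (u : nat -> R) (M : R) : 0 <= M ->
  (forall k, `|u k.+1 - u k| <= M * 2^-1 ^+ k) ->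
  exists l, forall k, `|u k - l| <= 2 * M * 2^-1 ^+ k.
Proof.
move=> M0 uM; pose g k : R := M * 2^-1 ^+ k.
have g0 k : 0 <= g k by rewrite mulr_ge0// exprn_ge0// invr_ge0.
have gS k : g k.+1 = g k / 2 by rewrite /g exprSr mulrA.
have step k : u k - 2 * g k <= u k.+1 - 2 * g k.+1 /\ u k.+1 + 2 * g k.+1 <= u k + 2 * g k.
  have := uM k; rewrite -/(g k) gS ler_norml => /andP[]; have := g0 k.
  by move: (g k) (u k) (u k.+1) => a b c *; split; lra.
have up j k : (j <= k)%N -> u j - 2 * g j <= u k - 2 * g k.
  elim: k => [|k IH]; first by rewrite leqn0 => /eqP->.
  rewrite leq_eqVlt => /orP[/eqP->//|/IH/le_trans]; apply; exact: (step k).1.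
have dn j k : (j <= k)%N -> u k + 2 * g k <= u j + 2 * g j.
  elim: k => [|k IH]; first by rewrite leqn0 => /eqP->.
  rewrite leq_eqVlt => /orP[/eqP->//|/IH]; apply: le_trans; exact: (step k).2.
have vw j k : u j - 2 * g j <= u k + 2 * g k.
  have m0 := g0 (maxn j k).
  apply: le_trans (up _ _ (leq_maxl j k)) _; apply: le_trans (dn _ _ (leq_maxr j k)).
  by move: m0; lra.
pose A : set R := [set u k - 2 * g k | k in setT].
have A0 : A !=set0 by exists (u 0%N - 2 * g 0%N); exists 0%N.
have Aub k : ubound A (u k + 2 * g k) by move=> _ [j _ <-].
have hA : has_sup A by split=> //; exists (u 0%N + 2 * g 0%N); exact: Aub.
exists (sup A) => k; rewrite -mulrA -/(g k) ler_norml.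
have h1 : u k - 2 * g k <= sup A by apply: ub_le_sup; [case: hA|exists k].
have h2 : sup A <= u k + 2 * g k by apply: ge_sup.
by apply/andP; split; move: h1 h2; lra.
Qed.

Lemma geometric_small (c e : R) : 0 < e ->
  exists N, forall k, (N <= k)%N -> c * 2^-1 ^+ k <= e.
Proof.
move=> e0; have c0 : 0 <= `|c| / e by rewrite divr_ge0// ltW.
exists (Num.bound (`|c| / e)) => k Nk.
have h := archi_boundP c0.
have k2 : (k%:R : R) <= 2 ^+ k by rewrite -natrX ler_nat ltnW// ltn_expl.
have bk : ((Num.bound (`|c| / e))%:R : R) <= k%:R by rewrite ler_nat.
rewrite exprVn ler_pdivrMr ?exprn_gt0// (le_trans (ler_norm _))//.
by rewrite mulrC -ler_pdivrMr// (le_trans (ltW h))// (le_trans bk).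
Qed.

(** Mean value theorem on the segment from [x0], where [u] vanishes; the factor 3 is the dimension,
    coming from [dotr_le]. *)
Lemma potential_le (u s : E -> R^o) (th : E -> E) x0 (r S T : R) :
  0 <= S -> 0 <= T ->
  (forall x, `|x - x0| < r -> differentiable u x) ->
  (forall x v, `|x - x0| < r -> 'D_v u x = s x * dotr (th x) v) ->
  (forall x, `|x - x0| < r -> `|s x| <= S) ->
  (forall x, `|x - x0| < r -> `|th x| <= T) ->
  u x0 = 0 -> forall x, `|x - x0| < r -> `|u x| <= 3 * T * r * S.
Proof.
move=> S0 T0 du Du sS tT u0 x xr.
have seg (t : R) : 0 <= t <= 1 -> `|x0 + t *: (x - x0) - x0| < r.
  move=> /andP[t0 t1]; rewrite addrAC subrr add0r normrZ ger0_norm//.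
  by apply: le_lt_trans xr; rewrite ler_piMl.
have [t /andP[t0 t1]] := MVT_direction (fun t t01 => du _ (seg t t01)).
have t01 : 0 <= t <= 1 by rewrite !ltW.
have tr := seg t t01.
have xx : x0 + (x - x0) = x by rewrite addrC subrK.
rewrite xx u0 subr0 Du// => ->.
rewrite normrM mulrC; apply: ler_pM => //; last exact: sS.
apply: le_trans (dotr_le _ _) _; rewrite -mulrA ler_wpM2l//.
by apply: ler_pM => //; [exact: tT|exact: ltW].
Qed.

(* Picard iteration for d a = b theta, d b = (eps a + nu b) theta, theta being
   the closed form dual to Y; every iterate is a potential of a closed form. *)
Lemma linear_solution (O : set E) X H Y (eps nu : E -> R^o) x0 (a0 b0 : R) :
  adapted_frame O X H Y eps nu -> O x0 ->
  exists r0 : R, 0 < r0 /\ forall r, 0 < r <= r0 ->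
  let B := [set x | `|x - x0| < r] in
  let th x := coframe (frame (X x) (H x) (Y x)) ord_max in
  B `<=` O /\
  exists a b : E -> R^o, [/\ a x0 = a0, b x0 = b0, smooth_on B a, smooth_on B b &
   forall x v, B x -> 'D_v a x = b x * dotr (th x) v /\
      'D_v b x = (eps x * a x + nu x * b x) * dotr (th x) v].
Proof.
move=> af Ox0; have Oo := af_open af.
have [R1 R10 HR1] := open_ball Oo Ox0.
pose r1 := R1 / 2.
have r10 : 0 < r1 by rewrite divr_gt0.
have r1O x : `|x - x0| <= r1 -> O x.
  by move=> xr; apply: HR1; rewrite (le_lt_trans xr)// ltr_pdivrMr// ltr_pMr// ltr1n.
pose th x := coframe (frame (X x) (H x) (Y x)) ord_max.
have sth : smooth_on O th.
  by apply: smooth_coframe; [|exact: af_X af|exact: af_H af|exact: af_Y af|exact: af_unit af].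
have bnd (f : E -> R^o) : smooth_on O f -> exists2 M : R, 0 <= M & forall x, `|x - x0| <= r1 -> `|f x| <= M.
  move=> sf; have [|M M0 HM] := @bounded_on_ball R 3 1 (fun x => \row_(j < 1) f x) x0 r1 (ltW r10).
    move=> x xr; have s1 : smooth_on O (fun x => \row_(j < 1) f x : 'rV[R]_1).
      apply: smooth_rV => // i.
      by apply: (smooth_eq Oo _ sf) => y _; rewrite mxE.
    by apply: (s1 0%N); exact: r1O.
  exists M => // x xr; apply: le_trans (HM x xr).
  by have := entry_le_norm (\row_(j < 1) f x) 0; rewrite mxE.
have [K1 K10 HK1] := bnd _ (af_eps af).
have [K2 K20 HK2] := bnd _ (af_nu af).
have [T T0 HT] : exists2 M : R, 0 <= M & forall x, `|x - x0| <= r1 -> `|th x| <= M.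
  apply: bounded_on_ball; first exact: ltW.
  by move=> x xr; apply: (sth 0%N); exact: r1O.
(* In the maximum norm, (b, eps a + nu b) is at most [K] times as large as (a, b). *)
pose K := 1 + K1 + K2.
have K1' : 1 <= K by rewrite /K -addrA lerDl addr_ge0.
have K0 : 0 < K by exact: lt_le_trans K1'.
(* By [potential_le], one iteration multiplies differences by at most 3 T r K; this radius brings
   the factor down to 1/2. Using [T + 1] avoids a division by zero. *)
pose r0 := Num.min r1 (6 * (T + 1) * K)^-1.
have T1 : 0 < T + 1 by rewrite ltr_wpDl.
have TK : 0 < 6 * (T + 1) * K by rewrite !mulr_gt0.
have r00 : 0 < r0 by rewrite /r0 lt_min r10 invr_gt0.
exists r0; split=> // r /andP[rp rr0] B; rewrite -/th.
have rr1 : r <= r1 by apply: le_trans rr0 _; rewrite /r0 ge_min lexx.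
have small : 3 * T * r * K <= 2^-1.
  have : r <= (6 * (T + 1) * K)^-1 by apply: le_trans rr0 _; rewrite /r0 ge_min lexx orbT.
  rewrite -[_^-1]mul1r ler_pdivlMr// => h.
  have : 0 <= r * K by rewrite mulr_ge0// ltW.
  by move: h; lra.
have Br1 x : B x -> `|x - x0| <= r1 by move=> xr; apply: ltW; exact: lt_le_trans xr rr1.
have BO : B `<=` O by move=> x /Br1/r1O.
have Bo : open B by exact: open_normball.
have Bx0 : B x0 by rewrite /B /= subrr normr0.
have afB := adapted_frame_sub Bo BO af.
have sthB := smooth_sub BO sth.
split=> //.
(* The invariant that keeps the iteration going: a smooth multiple of theta is closed once its
   coefficient is killed by X and H. A new iterate inherits the property, its differential being a
   multiple of theta. *)
pose valid (S : (E -> R^o) * (E -> R^o)) := [/\ smooth_on B S.1, smooth_on B S.2,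
  forall x, B x -> 'D_(X x) S.1 x = 0 /\ 'D_(H x) S.1 x = 0 &
  forall x, B x -> 'D_(X x) S.2 x = 0 /\ 'D_(H x) S.2 x = 0].
pose next (S S' : (E -> R^o) * (E -> R^o)) := [/\ S'.1 x0 = a0, S'.2 x0 = b0 &
  forall x v, B x -> 'D_v S'.1 x = S.2 x * dotr (th x) v /\
    'D_v S'.2 x = (eps x * S.1 x + nu x * S.2 x) * dotr (th x) v].
have pot (s : E -> R^o) c : smooth_on B s ->
    (forall x, B x -> 'D_(X x) s x = 0 /\ 'D_(H x) s x = 0) ->
    exists W : E -> R^o, [/\ W x0 = c, smooth_on B W,
      forall x v, B x -> 'D_v W x = s x * dotr (th x) v &
      forall x, B x -> 'D_(X x) W x = 0 /\ 'D_(H x) W x = 0].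
  move=> ss sXH.
  have [|||W [W0 sW DW]] := @frame_potential R X H Y eps nu (fun=> 0) (fun=> 0) s x0 r c afB
     (smooth_on_cst _ _) (smooth_on_cst _ _) ss.
  - by move=> x Bx; rewrite !derive_cst.
  - by move=> x Bx; rewrite derive_cst (sXH x Bx).1 subrr.
  - by move=> x Bx; rewrite derive_cst (sXH x Bx).2 !mulr0 subr0 addr0.
  have DW' x v : B x -> 'D_v W x = s x * dotr (th x) v.
    by move=> Bx; rewrite DW// !mul0r !add0r.
  exists W; split=> // x Bx; rewrite !DW'// /th coframe1 ?coframe2 ?(af_unit afB)//=.
  by rewrite !mulr0.
(* [step] is made total by leaving an invalid pair unchanged; only valid pairs occur among the
   iterates. *)
have /choice[step Hstep] S : exists S', valid S -> valid S' /\ next S S'.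
  have [vS|nS] := pselect (valid S); last by exists S.
  have [s1 s2 k1 k2] := vS.
  have se := af_eps afB; have sn := af_nu afB.
  have sm : smooth_on B (fun x => eps x * S.1 x + nu x * S.2 x : R^o).
    by apply: smoothD => //; exact: smoothM.
  have Dm x v : B x -> 'D_v eps x = 0 -> 'D_v nu x = 0 -> 'D_v S.1 x = 0 -> 'D_v S.2 x = 0 ->
      'D_v (fun x => eps x * S.1 x + nu x * S.2 x : R^o) x = 0.
    move=> Bx z1 z2 z3 z4.
    have de := smooth_differentiable se Bx; have dn := smooth_differentiable sn Bx.
    have d1 := smooth_differentiable s1 Bx; have d2 := smooth_differentiable s2 Bx.
    have [m1 M1] := derive_fZ v de d1; have [m2 M2] := derive_fZ v dn d2.
    have := derive_fD v m1 m2; rewrite M1 M2 z1 z2 z3 z4 !scale0r !scaler0 !addr0.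
    exact.
  have [W1 [W10 sW1 DW1 kW1]] := pot S.2 a0 s2 k2.
  have [|W2 [W20 sW2 DW2 kW2]] := pot _ b0 sm.
    move=> x Bx; have [? ?] := k1 x Bx; have [? ?] := k2 x Bx.
    by split; apply: Dm => //; [exact: af_Xeps afB _ Bx|exact: af_Xnu afB _ Bx|
      exact: af_Heps afB _ Bx|exact: af_Hnu afB _ Bx].
  exists (W1, W2) => _; split; first by split.
  by split=> // x v Bx; split; [exact: DW1|exact: DW2].
pose S0 : (E -> R^o) * (E -> R^o) := (fun=> a0, fun=> b0).
pose S k := iter k step S0.
have vS k : valid (S k).
  elim: k => [|k IH]; last by rewrite /S iterS; exact: (Hstep _ IH).1.
  by split; [exact: smooth_on_cst|exact: smooth_on_cst| |] => x Bx; rewrite !derive_cst.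
have nS k : next (S k) (S k.+1) by exact: (Hstep _ (vS k)).2.
have S00 k : (S k).1 x0 = a0 /\ (S k).2 x0 = b0 by case: k => [//|k]; have [] := nS k.
pose M := `|a0| + `|b0|.
have M0 : 0 <= M by rewrite addr_ge0.
have dS1 k x : B x -> differentiable (S k).1 x.
  by move=> Bx; have [s1 _ _ _] := vS k; exact: smooth_differentiable s1 Bx.
have dS2 k x : B x -> differentiable (S k).2 x.
  by move=> Bx; have [_ s2 _ _] := vS k; exact: smooth_differentiable s2 Bx.
have thT x : B x -> `|th x| <= T by move=> /Br1/HT.
have epsK x : B x -> `|eps x| <= K1 by move=> /Br1/HK1.
have nuK x : B x -> `|nu x| <= K2 by move=> /Br1/HK2.
have est (c : R) (u1 u2 : E -> R^o) : 0 <= c -> (forall x, B x -> `|u1 x| <= c /\ `|u2 x| <= c) ->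
   forall W : E -> R^o, (forall x, B x -> differentiable W x) -> W x0 = 0 ->
   (forall x v, B x -> 'D_v W x = u2 x * dotr (th x) v) \/
   (forall x v, B x -> 'D_v W x = (eps x * u1 x + nu x * u2 x) * dotr (th x) v) ->
   forall x, B x -> `|W x| <= c / 2.
  move=> c0 uc W dW W0 DW x Bx.
  have cK : 3 * T * r * (K * c) <= c / 2.
    by rewrite mulrA [c / 2]mulrC ler_wpM2r.
  apply: le_trans cK.
  have Kc : 0 <= K * c by rewrite mulr_ge0// ltW.
  case: DW => DW.
    apply: (potential_le Kc T0 dW DW _ thT W0 Bx) => y By.
    by apply: le_trans (uc y By).2 _; rewrite ler_peMl.
  apply: (@potential_le W (fun x => eps x * u1 x + nu x * u2 x) th x0 r (K * c) T Kc T0 dW DW _ thT W0 x Bx) => y By.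
  rewrite (le_trans (ler_normD _ _))// !normrM /K mulrDl mulrDl mul1r.
  have h1 : `|eps y| * `|u1 y| <= K1 * c by apply: ler_pM => //; [exact: epsK|exact: (uc y By).1].
  have h2 : `|nu y| * `|u2 y| <= K2 * c by apply: ler_pM => //; [exact: nuK|exact: (uc y By).2].
  by move: h1 h2 c0; lra.
have dif k : forall x, B x -> `|(S k.+1).1 x - (S k).1 x| <= M * 2^-1 ^+ k /\
    `|(S k.+1).2 x - (S k).2 x| <= M * 2^-1 ^+ k.
  elim: k => [|k IH] x Bx.
    have [a1 b1 D1] := nS 0%N.
    have uc y : B y -> `|(S 0%N).1 y| <= M /\ `|(S 0%N).2 y| <= M.
      by move=> _; rewrite /S /= /M lerDl lerDr.
    have M2 : M / 2 <= M * 2^-1 ^+ 0 by rewrite expr0 mulr1; move: M0; lra.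
    split; apply: le_trans M2.
    - apply: (est M _ _ M0 uc (fun x => (S 1%N).1 x - (S 0%N).1 x)) => //.
      + by move=> y By; exact: (differentiableB (dS1 1%N y By) (dS1 0%N y By)).
      + by rewrite a1 subrr.
      + left=> y v By; rewrite (derive_fB v (dS1 1%N y By) (dS1 0%N y By)).
        by rewrite (D1 y v By).1 derive_cst subr0.
    - apply: (est M _ _ M0 uc (fun x => (S 1%N).2 x - (S 0%N).2 x)) => //.
      + by move=> y By; exact: (differentiableB (dS2 1%N y By) (dS2 0%N y By)).
      + by rewrite b1 subrr.
      + right=> y v By; rewrite (derive_fB v (dS2 1%N y By) (dS2 0%N y By)).
        by rewrite (D1 y v By).2 derive_cst subr0.
  have [a1 b1 D1] := nS k; have [a2 b2 D2] := nS k.+1.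
  have c0 : 0 <= M * 2^-1 ^+ k by rewrite mulr_ge0// exprn_ge0// invr_ge0.
  rewrite exprSr mulrA; split.
  - apply: (est _ _ _ c0 IH (fun x => (S k.+2).1 x - (S k.+1).1 x)) => //.
    + by move=> y By; exact: (differentiableB (dS1 _ y By) (dS1 _ y By)).
    + by rewrite a1 a2 subrr.
    + left=> y v By; rewrite (derive_fB v (dS1 _ y By) (dS1 _ y By)).
      by rewrite (D1 y v By).1 (D2 y v By).1 -mulrBl.
  - apply: (est _ _ _ c0 IH (fun x => (S k.+2).2 x - (S k.+1).2 x)) => //.
    + by move=> y By; exact: (differentiableB (dS2 _ y By) (dS2 _ y By)).
    + by rewrite b1 b2 subrr.
    + right=> y v By; rewrite (derive_fB v (dS2 _ y By) (dS2 _ y By)).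
      by rewrite (D1 y v By).2 (D2 y v By).2 -mulrBl; congr (_ * _); ring.
have /choice[a Ha] x : exists l : R^o, B x -> forall k, `|(S k).1 x - l| <= 2 * M * 2^-1 ^+ k.
  have [Bx|nB] := pselect (B x); last by exists 0.
  by have [l Hl] := geometric_limit M0 (fun k => (dif k x Bx).1); exists l.
have /choice[b Hb] x : exists l : R^o, B x -> forall k, `|(S k).2 x - l| <= 2 * M * 2^-1 ^+ k.
  have [Bx|nB] := pselect (B x); last by exists 0.
  by have [l Hl] := geometric_limit M0 (fun k => (dif k x Bx).2); exists l.
have lim (u s : nat -> E -> R^o) (u' s' : E -> R^o) (C D : R) :
    0 <= D -> (forall k, smooth_on B (u k)) -> (forall k, smooth_on B (s k)) ->
    (forall k x v, B x -> 'D_v (u k.+1) x = s k x * dotr (th x) v) ->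
    (forall k x, B x -> `|u k x - u' x| <= C * 2^-1 ^+ k) ->
    (forall k x, B x -> `|s k x - s' x| <= D * 2^-1 ^+ k) ->
    forall x, B x -> differentiable u' x /\ forall v, 'D_v u' x = s' x * dotr (th x) v.
  move=> D0 su ss Du uu' ss' x Bx.
  (* The sequence is shifted by one because the gradient of the iterate k + 1 is given by the
     iterate k. *)
  have [|||||d1 D1] := @derive_uniform_limit R 3 (fun k => u k.+1)
     (fun k x => s k x *: th x) u' (fun x => s' x *: th x) x0 r _ _ _ _ _ x Bx.
  - by move=> k y By; exact: smooth_differentiable (su k.+1) By.
  - by move=> k y v By; rewrite dotrZl Du.
  - by move=> k y By; apply: (smoothZ Bo (ss k) sthB 0%N).
  - move=> y By e e0; have [N HN] := geometric_small C e0; exists N => k Nk.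
    by apply: le_trans (uu' k.+1 y By) (HN _ _); exact: leqW.
  - move=> e e0; have [N HN] := geometric_small (D * T) e0; exists N => k Nk y By.
    rewrite -scalerBl normrZ; apply: le_trans (HN k Nk).
    by rewrite mulrAC; apply: ler_pM => //; [exact: ss'|exact: thT].
  by split=> // v; rewrite D1 dotrZl.
have M20 : 0 <= 2 * M by rewrite mulr_ge0.
have sS1 k : smooth_on B (S k).1 by have [] := vS k.
have sS2 k : smooth_on B (S k).2 by have [] := vS k.
have DS k x v : B x -> 'D_v (S k.+1).1 x = (S k).2 x * dotr (th x) v /\
    'D_v (S k.+1).2 x = (eps x * (S k).1 x + nu x * (S k).2 x) * dotr (th x) v.
  by have [_ _] := nS k; exact.
have da := lim (fun k => (S k).1) (fun k => (S k).2) a b _ _ M20 sS1 sS2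
  (fun k x v Bx => (DS k x v Bx).1) (fun k x Bx => Ha x Bx k) (fun k x Bx => Hb x Bx k).
have se := af_eps afB; have sn := af_nu afB.
have sm k : smooth_on B (fun x => eps x * (S k).1 x + nu x * (S k).2 x : R^o).
  by apply: smoothD => //; exact: smoothM.
have D20 : 0 <= (K1 + K2) * (2 * M) by rewrite mulr_ge0// addr_ge0.
have db := lim (fun k => (S k).2) (fun k x => eps x * (S k).1 x + nu x * (S k).2 x)
  b (fun x => eps x * a x + nu x * b x) (2 * M) ((K1 + K2) * (2 * M)) D20 sS2 sm
  (fun k x v Bx => (DS k x v Bx).2) (fun k x Bx => Hb x Bx k).
have {}db x : B x -> differentiable b x /\ forall v, 'D_v b x = (eps x * a x + nu x * b x) * dotr (th x) v.
  apply: db => k y By.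
  have -> : eps y * (S k).1 y + nu y * (S k).2 y - (eps y * a y + nu y * b y) =
    eps y * ((S k).1 y - a y) + nu y * ((S k).2 y - b y) by ring.
  rewrite (le_trans (ler_normD _ _))// !normrM -mulrA mulrDl lerD//.
    by apply: ler_pM => //; [exact: epsK|exact: Ha].
  by apply: ler_pM => //; [exact: nuK|exact: Hb].
have start (c l : R) : (forall k, `|c - l| <= 2 * M * 2^-1 ^+ k) -> l = c.
  move=> H0; apply/eqP; rewrite eq_sym -subr_eq0 -normr_le0; apply/ler_addgt0Pl => e e0.
  by have [N HN] := geometric_small (2 * M) e0; rewrite addr0; apply: le_trans (HN N (leqnn N)).
exists a, b.
(* Bootstrap for [a] and [b] together: the system expresses the derivatives of both through [a], [b]
   and smooth functions, so each order of regularity yields the next. *)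
have Ckab k : Ck_on k B a /\ Ck_on k B b.
  elim: k => [|k [IHa IHb]].
    by split=> x Bx; apply: differentiable_continuous; [exact: (da x Bx).1|exact: (db x Bx).1].
  have Cdot v : Ck_on k B (fun x => dotr (th x) v : R^o).
    by apply: smooth_dotr => //; exact: smooth_on_cst.
  split; split=> [x Bx|v]; [exact: (da x Bx).1| |exact: (db x Bx).1|].
    apply: (Ck_on_eq Bo _ (Ck_onZ Bo IHb (Cdot v))) => x Bx.
    by rewrite (da x Bx).2.
  apply: (Ck_on_eq Bo _ (Ck_onZ Bo (Ck_onD Bo (Ck_onZ Bo (se k) IHa) (Ck_onZ Bo (sn k) IHb)) (Cdot v))) => x Bx.
  by rewrite (db x Bx).2.
split.
- by apply: start => k; have := Ha x0 Bx0 k; rewrite (S00 k).1.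
- by apply: start => k; have := Hb x0 Bx0 k; rewrite (S00 k).2.
- by move=> k; exact: (Ckab k).1.
- by move=> k; exact: (Ckab k).2.
- by move=> x v Bx; rewrite (da x Bx).2 (db x Bx).2.
Qed.

End LinearSystem.

(** * Trivialisation of an adapted frame *)

Section Reparametrisation.
Context {R : realType} (d : R) (d0 : 0 < d).

(** A diffeomorphism of the line onto (-d, d), with inverse [unsquash], made of square roots and
    inverses only. It turns functions of w defined for |w| < d into functions smooth on the whole
    line. *)
Definition squash (s : R^o) : R^o := (Num.sqrt (1 + s * s) : R^o)^-1 * (d * s).
Definition unsquash (w : R^o) : R^o := (Num.sqrt (d * d - w * w) : R^o)^-1 * w.

Let s1 (s : R) : 0 < 1 + s * s.
Proof. by rewrite ltr_wpDr// -expr2 sqr_ge0. Qed.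

Let sqrtE (x y : R) : 0 <= y -> x = y ^+ 2 -> Num.sqrt x = y.
Proof. by move=> y0 ->; rewrite sqrtr_sqr ger0_norm. Qed.

Lemma squashK s : unsquash (squash s) = s.
Proof.
rewrite /unsquash /squash; set t := Num.sqrt (1 + s * s).
have t0 : 0 < t by rewrite sqrtr_gt0.
have tt : t ^+ 2 = 1 + s * s by rewrite sqr_sqrtr// ltW.
have -> : Num.sqrt (d * d - t^-1 * (d * s) * (t^-1 * (d * s))) = d / t.
  apply: sqrtE; first by rewrite divr_ge0// ltW.
  have -> : d * d - t^-1 * (d * s) * (t^-1 * (d * s)) = d * d * (t ^+ 2 - s * s) / t ^+ 2.
    by field; rewrite gt_eqF.
  by rewrite {1}tt addrK mulr1 expr_div_n expr2.
by field; rewrite !gt_eqF.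
Qed.

Lemma squash_lt s : `|squash s| < d.
Proof.
rewrite /squash; set t := Num.sqrt (1 + s * s).
have t0 : 0 < t by rewrite sqrtr_gt0.
rewrite normrM normfV (gtr0_norm t0) normrM (gtr0_norm d0) mulrC ltr_pdivrMr// ltr_pM2l//.
rewrite -sqrtr_sqr ltr_sqrt// expr2 ltrDr//.
Qed.

Let d1 (w : R) : `|w| < d -> 0 < d * d - w * w.
Proof.
move=> wd; have h : (`|w|) ^+ 2 < d ^+ 2 by rewrite ltr_pXn2r// ?nnegrE// ltW.
by rewrite subr_gt0 -!expr2 -(real_normK (num_real w)).
Qed.

Lemma unsquashK w : `|w| < d -> squash (unsquash w) = w.
Proof.
move=> wd; rewrite /unsquash /squash; set t := Num.sqrt (d * d - w * w).
have t0 : 0 < t by rewrite sqrtr_gt0 d1.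
have tt : t ^+ 2 = d * d - w * w by rewrite sqr_sqrtr// ltW// d1.
have -> : Num.sqrt (1 + t^-1 * w * (t^-1 * w)) = d / t.
  apply: sqrtE; first by rewrite divr_ge0// ltW.
  have -> : 1 + t^-1 * w * (t^-1 * w) = (t ^+ 2 + w * w) / t ^+ 2.
    by field; rewrite gt_eqF.
  by rewrite {1}tt subrK expr_div_n expr2.
by field; rewrite !gt_eqF.
Qed.

Lemma smooth_squash : smooth_on [set: R^o] squash.
Proof.
have sid : smooth_on [set: R^o] (fun x : R^o => x) by exact: smooth_on_id.
apply: smoothM; first exact: openT.
  apply: smoothV; first exact: openT.
    by move=> x _; rewrite gt_eqF// sqrtr_gt0.
  apply: smooth_sqrt; [exact: openT|by move=> x _; exact: s1|].
  apply: smoothD; [exact: openT|exact: smooth_on_cst|].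
  by apply: smoothM => //; exact: openT.
by apply: smoothM => //; [exact: openT|exact: smooth_on_cst].
Qed.

Definition squash_range : set R^o := [set w | `|w - 0| < d].

Lemma smooth_unsquash : smooth_on squash_range unsquash.
Proof.
have Do : open squash_range by exact: open_normball.
have sid : smooth_on squash_range (fun x : R^o => x) by exact: smooth_on_id.
have pos x : squash_range x -> 0 < d * d - x * x.
  by rewrite /squash_range /= subr0; exact: d1.
apply: smoothM => //; apply: smoothV => //.
  by move=> x /pos h; rewrite gt_eqF// sqrtr_gt0.
by apply: smooth_sqrt => //; apply: smoothB => //; [exact: smooth_on_cst|exact: smoothM].
Qed.

End Reparametrisation.

Section Rows.
Context {R : realType} {V : normedModType R}.

Definition row3 (a b c : R) : 'rV[R]_3 := \row_(i < 3) [:: a; b; c]`_i.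

Lemma smooth_row3 (U : set V) (a b c : V -> R^o) : open U ->
  smooth_on U a -> smooth_on U b -> smooth_on U c ->
  smooth_on U (fun x => row3 (a x) (b x) (c x)).
Proof.
move=> Uo sa sb sc; apply: smooth_rV => //; apply: ord3P.
- by apply: (smooth_eq Uo _ sa) => x _; rewrite mxE.
- by apply: (smooth_eq Uo _ sb) => x _; rewrite mxE.
- by apply: (smooth_eq Uo _ sc) => x _; rewrite mxE.
Qed.

Lemma derive_row3 (a b c : V -> R^o) x v :
  differentiable a x -> differentiable b x -> differentiable c x ->
  'D_v (fun x => row3 (a x) (b x) (c x)) x = row3 ('D_v a x) ('D_v b x) ('D_v c x).
Proof.
move=> da db dc.
have E0 : (fun y => row3 (a y) (b y) (c y) 0 0 : R^o) = a by apply/funext => y; rewrite mxE.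
have E1 : (fun y => row3 (a y) (b y) (c y) 0 1 : R^o) = b by apply/funext => y; rewrite mxE.
have E2 : (fun y => row3 (a y) (b y) (c y) 0 ord_max : R^o) = c by apply/funext => y; rewrite mxE.
have d : differentiable (fun x => row3 (a x) (b x) (c x)) x.
  by apply: differentiable_rV; apply: ord3P; rewrite ?E0 ?E1 ?E2.
apply/rowP; apply: ord3P; rewrite -derive_entry// mxE.
- by rewrite E0.
- by rewrite E1.
- by rewrite E2.
Qed.

Lemma row3_eta (z : 'rV[R]_3) : row3 (z 0 0) (z 0 1) (z 0 ord_max) = z.
Proof. by apply/rowP; apply: ord3P; rewrite mxE. Qed.

Lemma row3_0 : row3 0 0 0 = 0.
Proof. by apply/rowP; apply: ord3P; rewrite !mxE. Qed.

Lemma row3_lt (a b c d : R) : `|a| < d -> `|b| < d -> `|c| < d -> `|row3 a b c| < d.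
Proof.
move=> ad bd cd; have d0 : 0 < d by exact: le_lt_trans ad.
by apply/(mx_norm_ltP _ d0); apply: ord3P; rewrite mxE.
Qed.

Lemma row3_eq (a b c a' b' c' : R) : row3 a b c = row3 a' b' c' -> [/\ a = a', b = b' & c = c'].
Proof.
move=> E; have H i := congr1 (fun z : 'rV[R]_3 => z 0 i) E.
by split; [have := H 0|have := H 1|have := H ord_max]; rewrite !mxE.
Qed.

End Rows.

(** * Straightening coordinates *)

Section LocalTrivialisation.
Context {R : realType}.
Local Notation E := 'rV[R]_3.

Lemma local_trivialisation (O : set E) X H Y (eps nu : E -> R^o) x0 :
  adapted_frame O X H Y eps nu -> O x0 ->
  exists (F1 F2 : R -> R) (U V : set E) (phi psi : E -> E) (beta : E -> R^o),
  [/\ smooth_on [set: R^o] (F1 : R^o -> R^o), smooth_on [set: R^o] (F2 : R^o -> R^o),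
      [/\ open U, U x0, U `<=` O & open V],
      [/\ forall x, U x -> V (phi x), forall z, V z -> U (psi z),
          forall x, U x -> psi (phi x) = x & forall z, V z -> phi (psi z) = z] &
      [/\ smooth_on U phi, smooth_on V psi, smooth_on U beta,
          forall x, U x -> beta x != 0 &
          forall x, U x ->
            row3 (F1 (phi x 0 ord_max)) (F2 (phi x 0 ord_max)) 0 = 'D_(X x) phi x /\
            row3 0 0 1 = 'D_(beta x *: Y x) phi x]].
Proof.
move=> af Ox0.
(* With initial values (1, 0) and (0, 1), the differentials at [x0] of the coordinates built below
   form the coframe itself; this is what [Phi_inj] uses. *)
have [r1 [r10 H1]] := linear_solution 1 0 af Ox0.
have [r2 [r20 H2]] := linear_solution 0 1 af Ox0.
(* Both solutions must live on one ball, whence the freedom of radius in [linear_solution]. *)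
pose r := Num.min r1 r2.
have r0 : 0 < r by rewrite lt_min r10.
have [|BO [a1 [b1 [a10 b10 sa1 sb1 D1]]]] := H1 r; first by rewrite r0 ge_min lexx.
have [|_ [a2 [b2 [a20 b20 sa2 sb2 D2]]]] := H2 r; first by rewrite r0 ge_min lexx orbT.
move: BO sa1 sb1 sa2 sb2 D1 D2; set B := [set x | `|x - x0| < r].
move=> BO sa1 sb1 sa2 sb2 D1 D2.
have Bo : open B by exact: open_normball.
have Bx0 : B x0 by rewrite /B /= subrr normr0.
have afB := adapted_frame_sub Bo BO af.
pose cf k x := coframe (frame (X x) (H x) (Y x)) k.
have cfX k x : B x -> dotr (cf k x) (X x) = (k == 0)%:R.
  by move=> Bx; apply: coframe1; exact: af_unit afB _ Bx.
have cfH k x : B x -> dotr (cf k x) (H x) = (k == 1)%:R.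
  by move=> Bx; apply: coframe2; exact: af_unit afB _ Bx.
have cfY k x : B x -> dotr (cf k x) (Y x) = (k == ord_max)%:R.
  by move=> Bx; apply: coframe3; exact: af_unit afB _ Bx.
have pot (a b : E -> R^o) : smooth_on B a -> smooth_on B b ->
   (forall x v, B x -> 'D_v a x = b x * dotr (cf ord_max x) v /\
      'D_v b x = (eps x * a x + nu x * b x) * dotr (cf ord_max x) v) ->
   exists W : E -> R^o, [/\ W x0 = 0, smooth_on B W &
     forall x v, B x -> 'D_v W x = a x * dotr (cf 0 x) v + b x * dotr (cf 1 x) v].
  move=> sa sb Dab.
  have [|||W [W0 sW DW]] := @frame_potential R X H Y eps nu a b (fun=> 0) x0 r 0 afB
     sa sb (smooth_on_cst _ _).
  - by move=> x Bx; rewrite (Dab x _ Bx).1 (Dab x _ Bx).2 cfX// cfH// !mulr0.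
  - by move=> x Bx; rewrite (Dab x _ Bx).1 derive_cst cfY// eqxx mulr1 subr0.
  - by move=> x Bx; rewrite (Dab x _ Bx).2 derive_cst cfY// eqxx mulr1 subr0.
  by exists W; split=> // x v Bx; rewrite DW// mul0r addr0.
have [y1 [y10 sy1 Dy1]] := pot _ _ sa1 sb1 D1.
have [y2 [y20 sy2 Dy2]] := pot _ _ sa2 sb2 D2.
have [|||w [w0 sw Dw]] := @frame_potential R X H Y eps nu (fun=> 0) (fun=> 0) (fun=> 1) x0 r 0 afB
     (smooth_on_cst _ _) (smooth_on_cst _ _) (smooth_on_cst _ _).
- by move=> x Bx; rewrite !derive_cst.
- by move=> x Bx; rewrite !derive_cst subrr.
- by move=> x Bx; rewrite !derive_cst !mulr0 subrr addr0.
have {}Dw x v : B x -> 'D_v w x = dotr (cf ord_max x) v.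
  by move=> Bx; rewrite Dw// !mul0r !add0r mul1r.
have dy1 x : B x -> differentiable y1 x by exact: smooth_differentiable sy1.
have dy2 x : B x -> differentiable y2 x by exact: smooth_differentiable sy2.
have dw x : B x -> differentiable w x by exact: smooth_differentiable sw.
pose Phi x := row3 (y1 x) (y2 x) (w x).
have sPhi : smooth_on B Phi by exact: smooth_row3.
have DPhi x v : B x -> 'D_v Phi x = row3 ('D_v y1 x) ('D_v y2 x) ('D_v w x).
  by move=> Bx; apply: derive_row3; [exact: dy1|exact: dy2|exact: dw].
have Phi_inj v : 'D_v Phi x0 = 0 -> v = 0.
  rewrite DPhi// Dy1// Dy2// Dw// a10 b10 a20 b20 !mul1r !mul0r addr0 add0r => E0.
  have [c0 c1 c2] : [/\ dotr (cf 0 x0) v = 0, dotr (cf 1 x0) v = 0 & dotr (cf ord_max x0) v = 0].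
    exact: (row3_eq (etrans E0 (esym row3_0))).
  by rewrite (frame_decomp v (af_unit afB Bx0)) c0 c1 c2 !scale0r !addr0.
have [U0 [V0 [psi0 [[U0o U0x U0B V0o] [UV0 VU0 psiK phiK spsi]]]]] :=
  inverse_function Bo Bx0 sPhi Phi_inj.
have Phi0 : Phi x0 = 0 by rewrite /Phi y10 y20 w0 row3_0.
have [d d0 Hd] := open_ball V0o (UV0 _ U0x).
have {}Hd z : `|z| < d -> V0 z by move=> zd; apply: Hd; rewrite Phi0 subr0.
have dPhi x : B x -> differentiable Phi x by exact: smooth_differentiable sPhi.
have dpsi z : V0 z -> differentiable psi0 z by exact: smooth_differentiable spsi.
have Dpsi z v : V0 z -> 'D_('D_v psi0 z) Phi (psi0 z) = v.
  move=> Vz; rewrite -(derive_comp v (dpsi z Vz) (dPhi _ (U0B _ (VU0 _ Vz)))).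
  rewrite -[RHS](derive_id z v); apply: near_eq_derive.
  by apply: filterS (nbhs_open V0o Vz) => y Vy /=; exact: phiK.
(* A ball in the maximum norm is a convex cube: a segment joining two of its points with the same
   w-coordinate stays inside, and dw vanishes along it. As da is a multiple of dw, [a] depends on w
   alone. *)
have constant (a b : E -> R^o) : smooth_on B a ->
    (forall x v, B x -> 'D_v a x = b x * dotr (cf ord_max x) v) ->
    forall z z' : E, `|z| < d -> `|z'| < d -> z 0 ord_max = z' 0 ord_max ->
    a (psi0 z) = a (psi0 z').
  move=> sa Da z z' zd z'd zz.
  have seg (t : R) : 0 <= t <= 1 -> V0 (z' + t *: (z - z')).
    move=> t01; apply: Hd; rewrite -[_ + _]subr0.
    by apply: ball_convex => //; rewrite subr0.
  have da x : B x -> differentiable a x by exact: smooth_differentiable sa.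
  have dapsi y : V0 y -> differentiable (a \o psi0) y.
    by move=> Vy; exact: (differentiable_comp (dpsi _ Vy) (da _ (U0B _ (VU0 _ Vy)))).
  have [t /andP[t0 t1] E1] := MVT_direction (fun t t01 => dapsi _ (seg t t01)).
  have {}t1 : 0 <= t <= 1 by rewrite !ltW.
  have Vt := seg t t1; have Bt := U0B _ (VU0 _ Vt).
  have zE : z' + (z - z') = z by rewrite addrC subrK.
  apply/eqP; rewrite -subr_eq0; move: E1; rewrite zE /= => ->.
  rewrite (derive_comp (z - z') (dpsi _ Vt) (da _ Bt)) Da// -Dw//.
  suff -> : 'D_('D_(z - z') psi0 (z' + t *: (z - z'))) w (psi0 (z' + t *: (z - z'))) = 0.
    by rewrite mulr0.
  have := congr1 (fun y : E => y 0 ord_max) (Dpsi _ (z - z') Vt).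
  by rewrite DPhi// !mxE /= zz subrr.
pose U : set E := [set x | U0 x /\ `|Phi x - 0| < d].
(* Only the planar coordinates stay bounded: the reparametrisation stretches the range (-d, d) of w
   to the whole line. *)
pose V : set E := [set z | squash_range d (z 0 0) /\ squash_range d (z 0 1)].
pose phi x := row3 (y1 x) (y2 x) (unsquash d (w x)).
pose psi (z : E) := psi0 (row3 (z 0 0) (z 0 1) (squash d (z 0 ord_max))).
(* [a] is read off on the axis where the planar coordinates vanish; by [constant] this gives its
   value everywhere over the same w, and it makes sense for every real [s]. *)
pose F (a : E -> R^o) (s : R) : R := a (psi0 (row3 0 0 (squash d s))).
have UB x : U x -> B x by move=> [/U0B].
have Uo : open U.
  rewrite openE => x [U0x' Px]; apply: filterI; first exact: nbhs_open.
  have Pc : {for x, continuous Phi} by exact: (sPhi 0%N x (U0B _ U0x')).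
  exact: (Pc [set z | `|z - 0| < d] (nbhs_open (open_normball (0 : E) d) Px)).
have coordc i : continuous (fun z : E => z 0 i : R^o) by exact: (@coord_continuous R 1 3 0 i).
have Vo : open V.
  by apply: openI; apply: open_comp => [z _|]; try exact: coordc; exact: open_normball.
have Phid (x : E) i : U x -> `|Phi x 0 i| < d.
  by move=> [_]; rewrite subr0 => /(mx_norm_ltP _ d0).
have y1d x : U x -> `|y1 x| < d by move=> /(Phid x 0); rewrite mxE.
have y2d x : U x -> `|y2 x| < d by move=> /(Phid x 1); rewrite mxE.
have wd x : U x -> `|w x| < d by move=> /(Phid x ord_max); rewrite mxE.
have rowV (z : E) : V z -> `|row3 (z 0 0) (z 0 1) (squash d (z 0 ord_max))| < d.
  move=> [z0 z1]; move: z0 z1; rewrite /squash_range /= !subr0 => z0 z1.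
  by apply: row3_lt => //; exact: squash_lt.
have sF a : smooth_on B a -> smooth_on [set: R^o] (F a : R^o -> R^o).
  move=> sa; have sapsi : smooth_on V0 (a \o psi0).
    by apply: (smooth_comp V0o _ spsi sa) => z /VU0/U0B.
  apply: (@smooth_comp _ _ _ _ 3 V0 (fun s : R^o => row3 0 0 (squash d s)) (a \o psi0)) => //.
  - exact: openT.
  - by move=> s _; apply: Hd; apply: row3_lt; rewrite ?normr0//; exact: squash_lt.
  - apply: smooth_row3; [exact: openT|exact: smooth_on_cst|exact: smooth_on_cst|].
    exact: smooth_squash.
have ssig : smooth_on U (fun x => unsquash d (w x) : R^o).
  apply: (@smooth_comp1 _ _ _ _ (squash_range d) w (unsquash d)) => //.
  - by move=> x Ux; rewrite /squash_range /= subr0 wd.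
  - exact: smooth_sub UB sw.
  - exact: smooth_unsquash.
have Fa a b x : U x -> smooth_on B a ->
    (forall x v, B x -> 'D_v a x = b x * dotr (cf ord_max x) v) ->
    F a (phi x 0 ord_max) = a x.
  move=> Ux sa Da; rewrite /F mxE /= unsquashK ?wd//.
  have [U0x' Px] := Ux; rewrite subr0 in Px.
  rewrite -{2}(psiK x U0x'); apply: (constant a b) => //.
    by apply: row3_lt; rewrite ?normr0// wd.
  by rewrite !mxE.
have dsq (s : R^o) : differentiable (squash d : R^o -> R^o) s.
  by apply: smooth_differentiable (smooth_squash d) _.
have dus (t : R^o) : `|t| < d -> differentiable (unsquash d : R^o -> R^o) t.
  move=> td; apply: (smooth_differentiable (smooth_unsquash d0)).
  by rewrite /squash_range /= subr0.
(* Y has derivative 1 on w, hence [unsquash'] on the new coordinate; multiplication by the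
   derivative of the inverse reparametrisation restores 1. *)
pose beta x : R^o := 'D_1 (squash d : R^o -> R^o) (unsquash d (w x)).
have Dphi x v : U x -> 'D_v phi x =
    row3 ('D_v y1 x) ('D_v y2 x) ('D_v w x * 'D_1 (unsquash d : R^o -> R^o) (w x)).
  move=> Ux; have Bx := UB _ Ux; have dux := dus _ (wd x Ux).
  rewrite derive_row3; [|exact: dy1|exact: dy2|exact: smooth_differentiable ssig Ux].
  rewrite (derive_comp v (dw x Bx) dux); congr row3.
  by rewrite -[X in 'D_X _ _ = _]mulr1 (derive_scalev _ _ dux).
have betaE x : U x -> beta x * 'D_1 (unsquash d : R^o -> R^o) (w x) = 1.
  move=> Ux; have dux := dus _ (wd x Ux).
  rewrite mulrC -[_ * _]/('D_1 (unsquash d : R^o -> R^o) (w x) *: beta x : R^o).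
  rewrite /beta -(derive_scalev _ _ (dsq _)) [_ *: 1]mulr1.
  rewrite -(@derive_comp R R^o R^o R^o (unsquash d) (squash d) (w x) (1 : R^o) dux (dsq _)).
  rewrite -[RHS](derive_id (w x : R^o) (1 : R^o)); apply: near_eq_derive.
  have := nbhs_open (open_normball (0 : R^o) d) (_ : [set y : R^o | `|y - 0| < d] (w x)).
  rewrite /= subr0 => /(_ (wd x Ux)); apply: filterS => y /=; rewrite subr0.
  exact: unsquashK.
exists (F a1), (F a2), U, V, phi, psi, beta; split.
- exact: sF.
- exact: sF.
- by split=> //; [split=> //; rewrite Phi0 subrr normr0|move=> x /UB/BO].
- split.
  + move=> x Ux; rewrite /V /squash_range /= !mxE /= !subr0.
    by split; [exact: y1d|exact: y2d].
  + move=> z Vz; have Vz' := Hd _ (rowV z Vz); split; first exact: VU0.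
    by rewrite /psi phiK// subr0 rowV.
  + move=> x Ux; rewrite /psi /phi !mxE /= unsquashK ?wd//.
    by apply: psiK; case: Ux.
  + move=> z Vz; have Vz' := Hd _ (rowV z Vz).
    have := phiK _ Vz'; rewrite -/(psi z) => /row3_eq[e1 e2 e3].
    by rewrite /phi e1 e2 e3 squashK// row3_eta.
- split.
  + apply: smooth_row3 => //; exact: smooth_sub UB _.
  + apply: (@smooth_comp _ _ _ V 3 V0 (fun z : E => row3 (z 0 0) (z 0 1) (squash d (z 0 ord_max))) psi0) => //.
      by move=> z /rowV/Hd.
    have sc i : smooth_on V (fun z : E => z 0 i : R^o).
      by apply: smooth_entry => //; exact: smooth_on_id.
    apply: smooth_row3 => //.
    apply: (@smooth_comp1 _ _ _ V [set: R^o] (fun z : E => z 0 ord_max : R^o) (squash d)) => //.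
    exact: smooth_squash.
  + apply: (@smooth_comp1 _ _ _ U [set: R^o] _ ('D_1 (squash d : R^o -> R^o)) Uo _ ssig) => //.
    by apply: smooth_derive; exact: smooth_squash.
  + by move=> x Ux; apply/eqP => b0; have := betaE x Ux; rewrite b0 mul0r => /esym/eqP; rewrite oner_eq0.
  + move=> x Ux; have Bx := UB _ Ux; split.
      rewrite (Fa a1 b1 x Ux sa1 (fun x v Bx => (D1 x v Bx).1)).
      rewrite (Fa a2 b2 x Ux sa2 (fun x v Bx => (D2 x v Bx).1)).
      by rewrite Dphi// Dy1// Dy2// Dw// !cfX// /= !mulr1 !mulr0 mul0r !addr0.
    have dphi : differentiable phi x.
      by apply: (smooth_differentiable (U := U)) => //; apply: smooth_row3 => //; exact: smooth_sub UB _.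
    rewrite (derive_scalev _ _ dphi) Dphi// Dy1// Dy2// Dw// !cfY//= !mulr0 !addr0 mul1r.
    by apply/rowP; apply: ord3P; rewrite !mxE /= ?mulr0// betaE.
Qed.

End LocalTrivialisation.

(** * Charts *)

Section Transfer.
Context {R : realType} {n : nat} {M : manifold R n}.
Implicit Types (c d : chart R n M) (p : M) (v w : M -> 'rV[R]_n).

Lemma chart_image_open c (A : set M) : open A -> A `<=` dom c -> open (c @` A).
Proof.
move=> Ao Ac; rewrite openE => _ [p Ap <-].
have cp : (c @` dom c) (c p) by exists p => //; exact: Ac.
have n1 : nbhs (c p) (c @` dom c) by exact: open_nbhs_nbhs (conj (@cod_open _ _ _ c) cp).
have n2 : nbhs (c p) (cinv c @^-1` A).
  apply: (cinv_continuous cp); rewrite cmapK; last exact: Ac.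
  exact: open_nbhs_nbhs.
apply: filterS2 n1 n2 => _ [q dq <-] /=; rewrite cmapK// => Aq.
by exists q.
Qed.

Lemma overlap_open c d : open (c @` (dom c `&` dom d)).
Proof.
by apply: chart_image_open => [|p []//]; apply: openI; exact: dom_open.
Qed.

Lemma cinv_dom c x : (c @` dom c) x -> dom c (cinv c x) /\ c (cinv c x) = x.
Proof. by move=> [p dp <-]; rewrite cmapK. Qed.

Lemma transition_differentiable c d p : atlas c -> atlas d -> dom c p -> dom d p ->
  differentiable (d \o cinv c) (c p).
Proof.
move=> ac ad cp dp; apply: (smooth_differentiable (atlas_compatible ac ad)).
by exists p.
Qed.

(** Chain rule through the transition map. The target [W] is arbitrary so that the same statement
    covers functions, other charts and maps into Euclidean space. *)
Lemma chart_change {W : normedModType R} (lam : M -> W) c d p a :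
  atlas c -> atlas d -> dom c p -> dom d p ->
  differentiable (lam \o cinv d) (d p) ->
  'D_a (lam \o cinv c) (c p) =
    'D_('D_a (d \o cinv c) (c p)) (lam \o cinv d) (d p).
Proof.
move=> ac ad cp dp dl.
have dt := transition_differentiable ac ad cp dp.
have e : (d \o cinv c) (c p) = d p by rewrite /= cmapK.
have {}dl : differentiable (lam \o cinv d) ((d \o cinv c) (c p)) by rewrite e.
rewrite -e -(derive_comp a dt dl); apply: near_eq_derive.
have cpd : (c @` (dom c `&` dom d)) (c p) by exists p.
apply: filterS (nbhs_open (@overlap_open c d) cpd) => _ [q [cq dq] <-] /=.
by rewrite !cmapK.
Qed.

Lemma derive_chart_id c p a : dom c p -> 'D_a (c \o cinv c) (c p) = a.
Proof.
move=> cp; rewrite -[RHS](derive_id (c p) a); apply: near_eq_derive.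
have cpd : (c @` dom c) (c p) by exists p.
by apply: filterS (nbhs_open (@cod_open _ _ _ c) cpd) => x /cinv_dom[].
Qed.

Lemma in_chart_change v c d p : atlas c -> atlas d -> dom c p -> dom d p ->
  'D_(in_chart c v (c p)) (d \o cinv c) (c p) = in_chart d v (d p).
Proof.
move=> ac ad cp dp; rewrite /in_chart !cmapK//.
have pp := chart_at_dom p; have ap := chart_at_atlas p.
by rewrite -(chart_change _ ap ac pp cp)//; exact: transition_differentiable.
Qed.

Lemma in_chart_at v p : in_chart (chart_at p) v (chart_at p p) = v p.
Proof.
have pp := chart_at_dom p.
by rewrite /in_chart cmapK// derive_chart_id.
Qed.

(** At one point, changing from the chart selected there to [c] is a linear isomorphism of
    components. Linear relations between fields, and their independence, may therefore be checked in
    any chart. *)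
Lemma in_chart_mx c x : atlas c -> (c @` dom c) x ->
  exists2 J : 'M[R]_n, J \in unitmx & forall v, in_chart c v x = v (cinv c x) *m J.
Proof.
move=> ac [p cp <-]; have pp := chart_at_dom p; have ap := chart_at_atlas p.
have dt := transition_differentiable ap ac pp cp.
have dt' := transition_differentiable ac ap cp pp.
exists (jac (c \o cinv (chart_at p)) (chart_at p p)).
  apply: injective_unitmx => a; rewrite -derive_jac// => a0.
  rewrite -(derive_chart_id a pp) (chart_change a ap ac pp cp dt') a0.
  exact: derive0.
by move=> v; rewrite /in_chart cmapK// derive_jac.
Qed.

Lemma lie_derivative_chart (U : set M) v (lam : M -> R) c p : open U -> U p ->
  smooth_function U lam -> atlas c -> dom c p ->
  lie_derivative v lam p =
    'D_(in_chart c v (c p)) (lam \o cinv c : 'rV[R]_n -> R^o) (c p).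
Proof.
move=> Uo Up sl ac cp; have pp := chart_at_dom p; have ap := chart_at_atlas p.
rewrite /lie_derivative /in_chart cmapK//.
apply: (@chart_change R^o lam (chart_at p) c p (v p)) => //.
by apply: smooth_differentiable (sl c ac) _; exists p.
Qed.

(** [lie_bracket] differentiates components in a chart that depends on the point. Near [p] the
    components in [chart_at p] and in [c] are related by the transition map, and [lbr_related]
    carries the bracket across. *)
Lemma in_chart_bracket v w c x : smooth_field v -> smooth_field w -> atlas c ->
  (c @` dom c) x ->
  in_chart c (lie_bracket v w) x = lbr (in_chart c v) (in_chart c w) x.
Proof.
move=> sv sw ac [p cp <-]; have pp := chart_at_dom p; have ap := chart_at_atlas p.
rewrite {1}/in_chart cmapK//.
have -> : lie_bracket v w p =
    lbr (in_chart (chart_at p) v) (in_chart (chart_at p) w) (chart_at p p).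
  by rewrite lbrE !in_chart_at.
pose d := chart_at p; rewrite -/d.
pose U := d @` (dom d `&` dom c).
have Uo : open U by exact: overlap_open.
have e : c p = (c \o cinv d) (d p) by rewrite /= cmapK.
have UdO : U `<=` d @` dom d by move=> _ [q [dq cq] <-]; exists q.
have rel u y : U y -> 'D_(in_chart d u y) (c \o cinv d) y = in_chart c u ((c \o cinv d) y).
  by move=> [q [dq cq] <-]; rewrite (in_chart_change u ap ac dq cq) /= cmapK.
rewrite e; apply: (lbr_related Uo (@cod_open _ _ _ c) _ (atlas_compatible ap ac) _ _ (sv c ac) (sw c ac) (rel v) (rel w)).
- by move=> _ [q [dq cq] <-] /=; exists q => //; rewrite cmapK.
- exact: smooth_sub UdO (sv d ap).
- exact: smooth_sub UdO (sw d ap).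
- by exists p.
Qed.

Lemma smooth_field_bracket v w : smooth_field v -> smooth_field w ->
  smooth_field (lie_bracket v w).
Proof.
move=> sv sw c ac; have Oo := @cod_open _ _ _ c.
apply: (smooth_eq Oo _ (smooth_lbr Oo (sv c ac) (sw c ac))) => x Ox.
by rewrite in_chart_bracket.
Qed.

Lemma in_chartD v w c x : atlas c -> (c @` dom c) x ->
  in_chart c (fun p => v p + w p) x = in_chart c v x + in_chart c w x.
Proof. by move=> ac /(in_chart_mx ac)[J _ E]; rewrite !E mulmxDl. Qed.

Lemma in_chartZ (a : M -> R) v c x : atlas c -> (c @` dom c) x ->
  in_chart c (fun p => a p *: v p) x = a (cinv c x) *: in_chart c v x.
Proof. by move=> ac /(in_chart_mx ac)[J _ E]; rewrite !E -scalemxAl. Qed.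

Lemma in_chart_eq v w c x : v (cinv c x) = w (cinv c x) -> in_chart c v x = in_chart c w x.
Proof. by move=> e; rewrite /in_chart e. Qed.

Lemma smooth_function_chart (a : M -> R) c : smooth_function setT a -> atlas c ->
  smooth_on (c @` dom c) (a \o cinv c : 'rV[R]_n -> R^o).
Proof. by move=> sa ac; have := sa c ac; rewrite setIT. Qed.

Lemma smooth_fieldD v w : smooth_field v -> smooth_field w ->
  smooth_field (fun p => v p + w p).
Proof.
move=> sv sw c ac; have Oo := @cod_open _ _ _ c.
apply: (smooth_eq Oo _ (smoothD Oo (sv c ac) (sw c ac))) => x Ox.
by rewrite in_chartD.
Qed.

Lemma smooth_fieldZ (a : M -> R) v : smooth_function setT a -> smooth_field v ->
  smooth_field (fun p => a p *: v p).
Proof.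
move=> sa sv c ac; have Oo := @cod_open _ _ _ c.
apply: (smooth_eq Oo _ (smoothZ Oo (smooth_function_chart sa ac) (sv c ac))) => x Ox.
by rewrite in_chartZ.
Qed.

Lemma smooth_function_from_chart (U : set M) (a : M -> R) c : atlas c -> open U ->
  U `<=` dom c -> smooth_on (c @` U) (a \o cinv c : 'rV[R]_n -> R^o) ->
  smooth_function U a.
Proof.
move=> ac Uo Uc sa d ad.
have Ao : open (d @` (dom d `&` U)).
  by apply: chart_image_open => [|p []//]; apply: openI => //; exact: dom_open.
apply: (smooth_eq (f := (a \o cinv c) \o (c \o cinv d)) Ao) => [_ [p [dp Up] <-]|].
  by rewrite /= !cmapK//; exact: Uc.
apply: (smooth_comp Ao _ _ sa) => [_ [p [dp Up] <-]|].
  by exists p => //=; rewrite cmapK.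
apply: smooth_sub (atlas_compatible ad ac) => _ [p [dp Up] <-].
by exists p => //; split=> //; exact: Uc.
Qed.

End Transfer.

(** * Canonical pairs *)

Section FeedbackFrames.
Context {R : realType}.
Local Notation E := 'rV[R]_3.

Lemma frame_unit_inj (a b c : E) : (forall x y z : R, x *: a + y *: b + z *: c = 0 ->
  [/\ x = 0, y = 0 & z = 0]) -> frame a b c \in unitmx.
Proof.
move=> abc; apply: injective_unitmx => v; rewrite frame_comb => /abc[v0 v1 v2].
by apply/rowP; apply: ord3P; rewrite mxE.
Qed.

Lemma frame_inj0 (a b c : E) x y z : frame a b c \in unitmx ->
  x *: a + y *: b + z *: c = 0 -> [/\ x = 0, y = 0 & z = 0].
Proof. by move=> u e; apply: (frame_inj u); rewrite e !scale0r !addr0. Qed.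

Lemma wedge3_unit (a b c : E) : wedge3 a b c != 0 -> frame a b c \in unitmx.
Proof. by rewrite unitmxE unitfE. Qed.

Lemma frame_swap (a b c : E) : frame a b c \in unitmx -> frame a c b \in unitmx.
Proof.
move=> u; apply: frame_unit_inj => x y z; rewrite addrAC => /(frame_inj0 u)[-> -> ->].
by [].
Qed.

Section Feedback.
Context (O : set E) (F G : E -> E) (k c : E -> R^o).
Hypotheses (Oo : open O) (sF : smooth_on O F) (sG : smooth_on O G)
  (sk : smooth_on O k) (sc : smooth_on O c).

Lemma lbr_feedback x : O x ->
  lbr (fun y => c y *: G y) (fun y => F y + k y *: G y) x =
  c x *: lbr G F x +
    (c x * 'D_(G x) k x - 'D_(F x + k x *: G x) c x) *: G x.
Proof.
move=> Ox.
have dF := smooth_differentiable sF Ox; have dG := smooth_differentiable sG Ox.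
have dk := smooth_differentiable sk Ox; have dc := smooth_differentiable sc Ox.
have skG := smoothZ Oo sk sG; have dkG := smooth_differentiable skG Ox.
have dX := smooth_differentiable (smoothD Oo sF skG) Ox.
rewrite (lbrZl dc dX dG) (lbrDr dG dF dkG) (lbrZr dk dG dG) lbrxx scaler0 addr0.
by rewrite scalerDr scalerA -addrA -scalerBl.
Qed.

(** In the basis F, [G, F], G the new vectors have a triangular matrix with diagonal 1, c, c. *)
Lemma frame_feedback x : O x -> c x != 0 ->
  frame (F x) (lbr G F x) (G x) \in unitmx ->
  frame (F x + k x *: G x) (lbr (fun y => c y *: G y) (fun y => F y + k y *: G y) x)
    (c x *: G x) \in unitmx.
Proof.
move=> Ox c0 u; apply: frame_unit_inj => x0 y z; rewrite lbr_feedback//.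
set q := (_ - _ : R); clearbody q => e.
have [e0 e1 e2] : [/\ x0 = 0, y * c x = 0 & x0 * k x + y * q + z * c x = 0].
  apply: (frame_inj0 u); rewrite -[RHS]e.
  move: (F x) (lbr G F x) (G x) => a b d.
  by apply/rowP => i; rewrite !mxE; ring.
move: e1 e2 => /eqP; rewrite e0 mulf_eq0 (negPf c0) orbF => /eqP->.
by rewrite !mul0r !add0r => /eqP; rewrite mulf_eq0 (negPf c0) orbF => /eqP->.
Qed.

End Feedback.
End FeedbackFrames.

(** * Canonical pairs in a chart *)

Section CanonicalPairs.
Context {R : realType} {M : manifold R 3}.
Implicit Types (f g fc gc : M -> 'rV[R]_3).
Local Notation E := 'rV[R]_3.

(** Apart from its bracket relations, this is all that is used of a canonical pair: it comes from
    (f, g) by a smooth feedback whose scaling vanishes nowhere. *)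
Lemma canonical_pair_feedback f g fc gc : regular f g -> canonical_pair_of f g fc gc ->
  exists k c : M -> R, [/\ smooth_function setT k, smooth_function setT c,
    forall p, c p != 0, forall p, fc p = f p + k p *: g p & forall p, gc p = c p *: g p].
Proof.
move=> reg [k1 [k2 [k3 [l1 [l2 [l3 [s [[[sk1 sk2 sk3] [sl1 sl2 sl3] _ H] Hf Hg]]]]]]]].
(* Otherwise [g, [g, f]] would be a combination of g and [g, f], against the second regularity
   condition. Hence |l1| and its square root are smooth and positive. *)
have l10 p : l1 p != 0.
  apply/eqP => l0; have [_ /wedge3_unit u] := reg p; move: u; rewrite H l0 scale0r add0r => u.
  have [] := @frame_inj0 R _ _ _ (- l2 p) (- l3 p) 1 u _.
    by rewrite scale1r !scaleNr -opprD addNr.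
  by move=> _ _ /eqP; rewrite oner_eq0.
have n0 p : 0 < Num.sqrt `|l1 p| by rewrite sqrtr_gt0 normr_gt0.
exists k3, (fun p => (-1) ^+ s / Num.sqrt `|l1 p|); split=> //.
  move=> c ac; rewrite setIT; have Oo := @cod_open _ _ _ c.
  apply: (@smooth_eq _ _ _ _ (fun x => ((-1) ^+ s : R^o) * ((Num.sqrt `|l1 (cinv c x)| : R^o)^-1 : R^o) : R^o)) => //.
  apply: smoothM => //; first exact: smooth_on_cst.
  apply: smoothV => //; first by move=> x _; rewrite gt_eqF.
  apply: smooth_sqrt => //; first by move=> x _; rewrite normr_gt0.
  by apply: smooth_normr => //; exact: (smooth_function_chart sl1 ac).
by move=> p; rewrite mulf_neq0 ?signr_eq0// invr_eq0 gt_eqF.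
Qed.

Lemma frame_in_chart (a b d : M -> 'rV[R]_3) (c : chart R 3 M) x : atlas c ->
  (c @` dom c) x -> frame (a (cinv c x)) (b (cinv c x)) (d (cinv c x)) \in unitmx ->
  frame (in_chart c a x) (in_chart c b x) (in_chart c d x) \in unitmx.
Proof.
move=> ac Ox u; have [J uJ EJ] := in_chart_mx ac Ox.
apply: frame_unit_inj => x0 y z; rewrite !EJ !scalemxAl -!mulmxDl => e.
apply: (frame_inj0 u); apply: (can_inj (mulmxK uJ)).
by rewrite e mul0mx.
Qed.

(* The Jacobi identity applied to X, Y, [Y, X] kills mu. *)
Lemma jacobi_mu (O : set E) (X Y : E -> E) (eps mu nu : E -> R^o) x :
  open O -> O x -> smooth_on O X -> smooth_on O Y ->
  smooth_on O eps -> smooth_on O mu -> smooth_on O nu ->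
  (forall y, O y -> frame (X y) (lbr Y X y) (Y y) \in unitmx) ->
  (forall y, O y -> lbr X (lbr Y X) y = 0) ->
  (forall y, O y -> lbr Y (lbr Y X) y = eps y *: X y + mu y *: Y y + nu y *: lbr Y X y) ->
  'D_(X x) nu x = 0 -> mu x = 0.
Proof.
move=> Oo Ox sX sY se sm sn uF XH YH Xn.
pose H := lbr Y X; have sH : smooth_on O H by exact: smooth_lbr.
have dX := smooth_differentiable sX Ox; have dY := smooth_differentiable sY Ox.
have dH := smooth_differentiable sH Ox.
have de := smooth_differentiable se Ox; have dm := smooth_differentiable sm Ox.
have dn := smooth_differentiable sn Ox.
have J := lbr_jacobi Oo Ox sX sY sH.
have z0 (Z : E -> E) : lbr Z (fun=> 0) x = 0.
  by rewrite lbrE derive_cst derive0 subrr.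
have J2 : lbr Y (lbr H X) x = 0.
  rewrite -(z0 Y); apply: (lbr_eq Oo Ox) => // y Oy.
  by rewrite (lbrC X H) XH// oppr0.
have XY y : lbr X Y y = -1 *: H y by rewrite scaleN1r -lbrC.
have J3 : lbr H (lbr X Y) x = 0.
  have -> : lbr H (lbr X Y) x = lbr H (fun y => (cst (-1) : E -> R^o) y *: H y) x.
    by apply: (lbr_eq Oo Ox) => y _; [|exact: XY].
  by rewrite (lbrZr (differentiable_cst _ _) dH dH) derive_cst lbrxx scale0r scaler0 addr0.
rewrite J2 J3 !addr0 in J.
have sE : smooth_on O (fun y => eps y *: X y) by exact: smoothZ.
have sM : smooth_on O (fun y => mu y *: Y y) by exact: smoothZ.
have sN : smooth_on O (fun y => nu y *: H y) by exact: smoothZ.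
have dE := smooth_differentiable sE Ox; have dM := smooth_differentiable sM Ox.
have dN := smooth_differentiable sN Ox.
have dEM := smooth_differentiable (smoothD Oo sE sM) Ox.
move: J; rewrite (lbr_eq (X' := X) (Y' := fun y => eps y *: X y + mu y *: Y y + nu y *: H y) Oo Ox)//.
rewrite (lbrDr dX dEM dN) (lbrDr dX dE dM) (lbrZr de dX dX) (lbrZr dm dX dY) (lbrZr dn dX dH).
rewrite lbrxx (XH x Ox) XY !scaler0 !addr0 => J.
(* Coefficients on X, H and Y of [X, [Y, H]] = 0. In the middle one, [- mu] comes from [X, Y] = -
   H. *)
have [_ e _] : [/\ 'D_(X x) eps x = 0, 'D_(X x) nu x - mu x = 0 & 'D_(X x) mu x = 0].
  apply: (frame_inj0 (uF x Ox)); rewrite -[RHS]J.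
  move: ('D_(X x) eps x) ('D_(X x) nu x) ('D_(X x) mu x) => a b c.
  rewrite -/H; move: (X x) (Y x) (H x) => u v w.
  by apply/rowP => i; rewrite !mxE; ring.
by move: e; rewrite Xn sub0r => /eqP; rewrite oppr_eq0 => /eqP.
Qed.

Lemma regular_frame f g (c : chart R 3 M) x :
  smooth_field f -> smooth_field g -> regular f g -> atlas c -> (c @` dom c) x ->
  frame (in_chart c f x) (lbr (in_chart c g) (in_chart c f) x) (in_chart c g x) \in unitmx.
Proof.
move=> sf sg reg ac Ox; rewrite -(in_chart_bracket sg sf ac Ox); apply: frame_in_chart => //.
by apply: frame_swap; apply: wedge3_unit; have [] := reg (cinv c x).
Qed.

Lemma in_chart_feedback f g fc (k : M -> R) (c : chart R 3 M) x : atlas c ->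
  (c @` dom c) x -> (forall p, fc p = f p + k p *: g p) ->
  in_chart c fc x = in_chart c f x + k (cinv c x) *: in_chart c g x.
Proof.
move=> ac Ox Ef; rewrite (in_chart_eq (v := fc) (w := fun p => f p + k p *: g p) (Ef _)).
by rewrite (in_chartD _ _ ac Ox) (in_chartZ k g ac Ox).
Qed.

Lemma in_chart_scaling g gc (b : M -> R) (c : chart R 3 M) x : atlas c ->
  (c @` dom c) x -> (forall p, gc p = b p *: g p) ->
  in_chart c gc x = b (cinv c x) *: in_chart c g x.
Proof.
move=> ac Ox Eg; rewrite (in_chart_eq (v := gc) (w := fun p => b p *: g p) (Eg _)).
exact: in_chartZ.
Qed.

Lemma canonical_frame f g fc gc (k b : M -> R) (c : chart R 3 M) x :
  smooth_field f -> smooth_field g -> regular f g -> atlas c ->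
  smooth_function setT k -> smooth_function setT b -> (forall p, b p != 0) ->
  (forall p, fc p = f p + k p *: g p) -> (forall p, gc p = b p *: g p) ->
  (c @` dom c) x ->
  frame (in_chart c fc x) (lbr (in_chart c gc) (in_chart c fc) x) (in_chart c gc x) \in unitmx.
Proof.
move=> sf sg reg ac sk sb b0 Ef Eg Ox; have Oo := @cod_open _ _ _ c.
have EX y (Oy : (c @` dom c) y) := in_chart_feedback ac Oy Ef.
have EY y (Oy : (c @` dom c) y) := in_chart_scaling ac Oy Eg.
rewrite (lbr_eq Oo Ox EY EX) (EX x Ox) (EY x Ox).
apply: (frame_feedback Oo (sf c ac) (sg c ac) (smooth_function_chart sk ac) (smooth_function_chart sb ac) Ox).
  exact: b0.
exact: regular_frame.
Qed.

(** Differentiating eps^2 = 1 gives 2 eps eps' = 0, which needs no discussion of connected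
    components. *)
Lemma derive_sign (O : set E) (eps : E -> R^o) x v : open O -> O x -> smooth_on O eps ->
  (forall y, O y -> eps y * eps y = 1) -> 'D_v eps x = 0.
Proof.
move=> Oo Ox se ee; have de := smooth_differentiable se Ox.
have e0 : eps x != 0.
  by apply/eqP => z; have := ee x Ox; rewrite z mul0r => /esym/eqP; rewrite oner_eq0.
have : 'D_v (fun y => eps y *: eps y : R^o) x = 'D_v (cst (1 : R^o) : E -> R^o) x.
  by apply: near_eq_derive; apply: filterS (nbhs_open Oo Ox) => y; exact: ee.
rewrite derive_cst (derive_fZ v de de).2; move: ('D_v eps x) => d.
rewrite -[_ + _]/(d * eps x + eps x * d) [eps x * d]mulrC -mulr2n => /eqP.
by rewrite mulrn_eq0/= mulf_eq0 (negPf e0) orbF => /eqP.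
Qed.

Lemma lie_derivative_cinv v (a : M -> R) (c : chart R 3 M) x : atlas c ->
  smooth_function setT a -> (c @` dom c) x ->
  lie_derivative v a (cinv c x) = 'D_(in_chart c v x) (a \o cinv c : E -> R^o) x.
Proof.
move=> ac sa [p cp <-]; rewrite cmapK//.
exact: (lie_derivative_chart v openT I sa ac cp).
Qed.

Lemma canonical_brackets fc gc (kappa nu eps mu : M -> R) (c : chart R 3 M) :
  let X := in_chart c fc in let Y := in_chart c gc in
  smooth_field fc -> smooth_field gc -> atlas c ->
  (forall x, (c @` dom c) x -> frame (X x) (lbr Y X x) (Y x) \in unitmx) ->
  (forall p, lie_bracket fc (lie_bracket fc gc) p = kappa p *: gc p) ->
  (forall p, lie_bracket gc (lie_bracket gc fc) p =
     eps p *: fc p + mu p *: gc p + nu p *: lie_bracket gc fc p) ->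
  [/\ forall x, (c @` dom c) x -> lbr X (lbr X Y) x = kappa (cinv c x) *: Y x,
      forall x, (c @` dom c) x -> lbr Y (lbr Y X) x = eps (cinv c x) *: X x +
        mu (cinv c x) *: Y x + nu (cinv c x) *: lbr Y X x
    & smooth_on (c @` dom c) (eps \o cinv c : E -> R^o)].
Proof.
move=> X Y sf sg ac uF ffg ggf; have Oo := @cod_open _ _ _ c.
have sX : smooth_on (c @` dom c) X by exact: sf.
have sY : smooth_on (c @` dom c) Y by exact: sg.
have sH : smooth_on (c @` dom c) (lbr Y X) by exact: smooth_lbr.
have sfg := smooth_field_bracket sf sg; have sgf := smooth_field_bracket sg sf.
have Egf x (Ox : (c @` dom c) x) := in_chart_bracket sg sf ac Ox.
have Efg x (Ox : (c @` dom c) x) := in_chart_bracket sf sg ac Ox.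
have YYX x : (c @` dom c) x -> lbr Y (lbr Y X) x = eps (cinv c x) *: X x +
    mu (cinv c x) *: Y x + nu (cinv c x) *: lbr Y X x.
  move=> Ox; rewrite -(lbr_eq (X := Y) Oo Ox _ Egf)//.
  rewrite -(in_chart_bracket sg sgf ac Ox).
  rewrite (in_chart_eq (w := fun p => (eps p *: fc p + mu p *: gc p) + nu p *: lie_bracket gc fc p) (ggf _)).
  by rewrite (in_chartD (fun p => eps p *: fc p + mu p *: gc p) (fun p => nu p *: lie_bracket gc fc p) ac Ox)
    (in_chartD (fun p => eps p *: fc p) (fun p => mu p *: gc p) ac Ox)
    (in_chartZ eps _ ac Ox) (in_chartZ mu _ ac Ox) (in_chartZ nu _ ac Ox) Egf.
split=> // [x Ox|].
  rewrite -(lbr_eq (X := X) Oo Ox _ Efg)//.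
  rewrite -(in_chart_bracket sf sfg ac Ox).
  exact: (in_chart_scaling ac Ox ffg).
have sYH : smooth_on (c @` dom c) (lbr Y (lbr Y X)) := smooth_lbr Oo sY sH.
(* Smoothness of [eps] is recovered from the fields: it is the X-coefficient of [Y, [Y, X]],
   computed with a smooth coframe. *)
have scf := smooth_coframe 0 Oo sX sH sY uF.
apply: (@smooth_eq _ _ _ _ (fun x => dotr (coframe (frame (X x) (lbr Y X x) (Y x)) 0) (lbr Y (lbr Y X) x) : R^o)) => //.
  move=> x Ox; rewrite YYX// addrAC.
  by rewrite (coframe_comb _ _ _ 0 (uF x Ox)).
exact: (smooth_dotr Oo scf sYH).
Qed.

Lemma canonical_adapted fc gc (kappa nu eps mu : M -> R) (c : chart R 3 M) :
  smooth_field fc -> smooth_field gc -> atlas c ->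
  smooth_function setT nu -> smooth_function setT mu ->
  (forall p, eps p = 1 \/ eps p = -1) ->
  (forall x, (c @` dom c) x -> frame (in_chart c fc x)
     (lbr (in_chart c gc) (in_chart c fc) x) (in_chart c gc x) \in unitmx) ->
  (forall p, lie_bracket fc (lie_bracket fc gc) p = kappa p *: gc p) ->
  (forall p, lie_bracket gc (lie_bracket gc fc) p =
     eps p *: fc p + mu p *: gc p + nu p *: lie_bracket gc fc p) ->
  (forall p, kappa p = 0) -> (forall p, lie_derivative fc nu p = 0) ->
  (forall p, lie_derivative (lie_bracket fc gc) nu p = 0) ->
  adapted_frame (c @` dom c) (in_chart c fc) (lbr (in_chart c gc) (in_chart c fc))
    (in_chart c gc) (eps \o cinv c) (nu \o cinv c).
Proof.
move=> sf sg ac sn sm eps1 uF ffg ggf k0 fn hn; have Oo := @cod_open _ _ _ c.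
have [XXY YYX seps] := canonical_brackets sf sg ac uF ffg ggf.
move: XXY YYX seps uF; set X := in_chart c fc; set Y := in_chart c gc; set O := c @` dom c.
move=> XXY YYX seps uF.
have sX : smooth_on O X by exact: sf.
have sY : smooth_on O Y by exact: sg.
have sH : smooth_on O (lbr Y X) by exact: smooth_lbr.
have Efg x (Ox : O x) := in_chart_bracket sf sg ac Ox.
have XH x : O x -> lbr X (lbr Y X) x = 0.
  by move=> Ox; rewrite (lbr_lbrC Oo Ox sX sY) XXY// k0 scale0r oppr0.
have snu := smooth_function_chart sn ac; have smu := smooth_function_chart sm ac.
have eps2 x : O x -> (eps (cinv c x) : R^o) * eps (cinv c x) = 1.
  by move=> _; case: (eps1 (cinv c x)) => ->; rewrite ?mulr1 ?mulrNN ?mulr1.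
have Deps x v : O x -> 'D_v (eps \o cinv c : E -> R^o) x = 0.
  by move=> Ox; exact: (derive_sign v Oo Ox seps eps2).
have Dnu v x (Ox : O x) := lie_derivative_cinv v ac sn Ox.
have Xnu x : O x -> 'D_(X x) (nu \o cinv c : E -> R^o) x = 0.
  by move=> Ox; rewrite -Dnu.
have mu0 x : O x -> mu (cinv c x) = 0.
  move=> Ox; exact: (jacobi_mu Oo Ox sX sY seps smu snu uF XH YYX (Xnu x Ox)).
have YH x : O x -> lbr Y (lbr Y X) x = eps (cinv c x) *: X x + nu (cinv c x) *: lbr Y X x.
  by move=> Ox; rewrite YYX// mu0// scale0r addr0.
have Hnu x : O x -> 'D_(lbr Y X x) (nu \o cinv c : E -> R^o) x = 0.
  move=> Ox; have dn := smooth_differentiable snu Ox.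
  have : 'D_(lbr X Y x) (nu \o cinv c : E -> R^o) x = 0 by rewrite -Efg// -Dnu.
  rewrite (lbrC Y X) -scaleN1r (derive_scalev _ _ dn) => /eqP.
  by rewrite scaler_eq0 oppr_eq0 oner_eq0 => /eqP.
by exact: (Build_adapted_frame Oo sX sH sY seps snu uF XH (fun x _ => erefl) YH
  (fun x => Deps x _) (fun x => Deps x _) Xnu Hnu).
Qed.

End CanonicalPairs.

(** * Vanishing curvature gives a trivialisation *)

Section EuclideanTarget.
Context {R : realType} {n : nat} {M : manifold R n}.
Implicit Types (c d : chart R n M) (p q : M).
Local Notation E := 'rV[R]_n.

Lemma open_preimage_in {T : topologicalType} (A : set T) (W : set E) (h : T -> E) :
  open A -> open W -> (forall x, A x -> {for x, continuous h}) ->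
  open (A `&` h @^-1` W).
Proof.
move=> Ao Wo hc; rewrite openE => x [Ax Wx].
apply: filterI; first exact: open_nbhs_nbhs.
by apply: (hc x Ax); exact: open_nbhs_nbhs.
Qed.

Lemma chart_preimage_image c (U : set E) : U `<=` c @` dom c ->
  c @` (dom c `&` c @^-1` U) = U.
Proof.
move=> UO; apply/seteqP; split=> [_ [q [_ Uq] <-] //|x Ux].
by have [cx e] := cinv_dom (UO x Ux); exists (cinv c x) => //; split=> //=; rewrite e.
Qed.

Lemma differential_at_chart (phi : M -> euclidean R n) (w : M -> E) c q :
  atlas c -> dom c q -> differentiable (phi \o cinv c : E -> E) (c q) ->
  differential_at phi q (w q) = 'D_(in_chart c w (c q)) (phi \o cinv c : E -> E) (c q).
Proof.
move=> ac cq dp; rewrite /in_chart cmapK//.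
exact: (@chart_change R n M E phi (chart_at q) c q (w q) (chart_at_atlas q) ac (chart_at_dom q) cq dp).
Qed.

Lemma diffeomorphism_from_chart c (U V : set E) (phi psi : E -> E) : atlas c ->
  open U -> open V -> U `<=` c @` dom c ->
  (forall x, U x -> V (phi x)) -> (forall z, V z -> U (psi z)) ->
  (forall x, U x -> psi (phi x) = x) -> (forall z, V z -> phi (psi z) = z) ->
  smooth_on U phi -> smooth_on V psi ->
  diffeomorphism_between (N := euclidean R n) (dom c `&` c @^-1` U) V (phi \o c) (cinv c \o psi).
Proof.
move=> ac Uo Vo UO UV VU psiK phiK sphi spsi; split.
- by move=> _ [q [_ Uq] <-]; exact: UV.
- by move=> _ [z Vz <-]; have [cx e] := cinv_dom (UO _ (VU z Vz)); split=> //=; rewrite e; exact: VU.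
- by move=> q [cq Uq] /=; rewrite psiK// cmapK.
- by move=> z Vz /=; rewrite (cinv_dom (UO _ (VU z Vz))).2 phiK.
split; split.
- move=> q [cq Uq]; apply: continuous_comp; first exact: cmap_continuous.
  exact: (differentiable_continuous (smooth_differentiable sphi Uq)).
- move=> d _ ad ->; rewrite preimage_setT setIT.
  have Ao : open (d @` (dom d `&` (dom c `&` c @^-1` U))).
    apply: chart_image_open => [|q []//]; apply: openI; first exact: dom_open.
    by apply: open_preimage_in => //; [exact: dom_open|move=> q; exact: cmap_continuous].
  apply: (@smooth_comp _ _ _ _ _ U (c \o cinv d) phi Ao) => //.
    by move=> _ [q [dq [cq Uq]] <-] /=; rewrite cmapK.
  apply: smooth_sub (atlas_compatible ad ac) => _ [q [dq [cq Uq]] <-].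
  by exists q.
- move=> z Vz; apply: continuous_comp.
    exact: (differentiable_continuous (smooth_differentiable spsi Vz)).
  by apply: cinv_continuous; exact: UO (VU z Vz).
- move=> _ d -> ad; rewrite image_id setTI.
  have -> : V `&` (cinv c \o psi) @^-1` dom d = V `&` psi @^-1` (c @` (dom c `&` dom d)).
    apply/seteqP; split=> z [Vz Hz]; split=> //.
      have [cx e] := cinv_dom (UO _ (VU z Vz)).
      by exists (cinv c (psi z)).
    by move: Hz => [q [cq dq] /= <-]; rewrite cmapK.
  have Ao : open (V `&` psi @^-1` (c @` (dom c `&` dom d))).
    apply: open_preimage_in => //; first exact: overlap_open.
    by move=> z Vz; exact: (differentiable_continuous (smooth_differentiable spsi Vz)).
  apply: (@smooth_comp _ _ _ _ _ (c @` (dom c `&` dom d)) psi (d \o cinv c) Ao) => [z []//||].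
    by apply: smooth_sub spsi => z [].
  exact: atlas_compatible.
Qed.

Lemma smooth_function_sub (U : set M) (a : M -> R) : smooth_function setT a ->
  smooth_function U a.
Proof.
move=> sa c ac; apply: smooth_sub (smooth_function_chart sa ac).
by move=> _ [q [cq _] <-]; exists q.
Qed.

End EuclideanTarget.

Section Sufficiency.
Context {R : realType} {M : manifold R 3}.
Implicit Types (f g fc gc : M -> 'rV[R]_3).
Local Notation E := 'rV[R]_3.

Lemma feedback_from_chart f g fc gc (k b : M -> R) (c : chart R 3 M) p (F1 F2 : R -> R)
    (U V : set E) (phi psi : E -> E) (beta : E -> R^o) :
  atlas c -> dom c p -> smooth_function setT k -> smooth_function setT b ->
  (forall q, b q != 0) -> (forall q, fc q = f q + k q *: g q) ->
  (forall q, gc q = b q *: g q) ->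
  open U -> open V -> U (c p) -> U `<=` c @` dom c ->
  (forall x, U x -> V (phi x)) -> (forall z, V z -> U (psi z)) ->
  (forall x, U x -> psi (phi x) = x) -> (forall z, V z -> phi (psi z) = z) ->
  smooth_on U phi -> smooth_on V psi -> smooth_on U beta ->
  (forall x, U x -> beta x != 0) ->
  (forall x, U x ->
     row3 (F1 (phi x 0 ord_max)) (F2 (phi x 0 ord_max)) 0 = 'D_(in_chart c fc x) phi x /\
     row3 0 0 1 = 'D_(beta x *: in_chart c gc x) phi x) ->
  feedback_equivalent_near p f g (trivial_drift F1 F2) (@trivial_control R).
Proof.
move=> ac cp sk sb b0 Ef Eg Uo Vo Up UO UV VU psiK phiK sphi spsi sbeta beta0 D.
pose UM := dom c `&` c @^-1` U.
have UMo : open UM.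
  by apply: open_preimage_in => //; [exact: dom_open|move=> q; exact: cmap_continuous].
have cUM : c @` UM = U by exact: chart_preimage_image.
(* Two feedbacks are composed: from (f, g) to the canonical pair by [k] and [b], then the rescaling
   by [beta] that straightens the control field. *)
exists UM, V, (phi \o c : M -> euclidean R 3), (cinv c \o psi), k, (fun q => beta (c q) * b q).
split.
- by [].
- by [].
- exact: diffeomorphism_from_chart.
- split; first exact: smooth_function_sub.
    apply: (smooth_function_from_chart ac UMo) => [q []//|]; rewrite cUM.
    apply: (@smooth_eq _ _ _ _ (fun x => beta x * (b (cinv c x) : R^o) : R^o) _ Uo).
      by move=> x Ux; rewrite /= (cinv_dom (UO x Ux)).2.
    by apply: smoothM => //; apply: smooth_sub UO _; exact: smooth_function_chart.
  by move=> q [cq Uq]; rewrite mulf_neq0// beta0.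
- move=> q [cq Uq]; have [D1 D2] := D _ Uq.
  have dphi : differentiable (phi \o c \o cinv c : E -> E) (c q).
    apply: smooth_differentiable Uq; apply: (smooth_eq Uo _ sphi) => x Ux.
    by rewrite /= (cinv_dom (UO x Ux)).2.
  have Dphi v : 'D_v (phi \o c \o cinv c : E -> E) (c q) = 'D_v phi (c q).
    apply: near_eq_derive; apply: filterS (nbhs_open Uo Uq) => x Ux.
    by rewrite /= (cinv_dom (UO x Ux)).2.
  split.
    rewrite -Ef (differential_at_chart (phi := phi \o c) fc ac cq dphi) Dphi.
    exact: D1.
  have -> : (beta (c q) * b q) *: g q = beta (c q) *: gc q by rewrite Eg scalerA.
  rewrite (differential_at_chart (phi := phi \o c) (fun q => beta (c q) *: gc q) ac cq dphi) Dphi.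
  by rewrite (in_chartZ (fun q => beta (c q)) gc ac (UO _ Uq)) cmapK//; exact: D2.
Qed.

Lemma trivialisable_of_curvatures f g fc gc (kappa nu : M -> R) :
  smooth_field f -> smooth_field g -> regular f g -> canonical_pair_of f g fc gc ->
  curvatures fc gc kappa nu ->
  (forall p, kappa p = 0) -> (forall p, lie_derivative fc nu p = 0) ->
  (forall p, lie_derivative (lie_bracket fc gc) nu p = 0) ->
  locally_trivialisable f g.
Proof.
move=> sf sg reg can [_ snu [eps [mu [smu eps1 ffg ggf]]]] k0 fn hn p.
have [k [b [sk sb b0 Ef Eg]]] := canonical_pair_feedback reg can.
have sfc : smooth_field fc.
  have -> : fc = (fun q => f q + k q *: g q) by apply/funext.
  exact: (smooth_fieldD sf (smooth_fieldZ sk sg)).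
have sgc : smooth_field gc.
  have -> : gc = (fun q => b q *: g q) by apply/funext.
  exact: smooth_fieldZ.
have ac := chart_at_atlas p; have cp := chart_at_dom p.
have uF x (Ox : (chart_at p @` dom (chart_at p)) x) :=
  canonical_frame sf sg reg ac sk sb b0 Ef Eg Ox.
have af := canonical_adapted sfc sgc ac snu smu eps1 uF ffg ggf k0 fn hn.
have Op : (chart_at p @` dom (chart_at p)) (chart_at p p) by exists p.
have [F1 [F2 [U [V [phi [psi [beta [sF1 sF2 [Uo Up UO Vo] [UV VU psiK phiK]
  [sphi spsi sbeta beta0 D]]]]]]]]] := local_trivialisation af Op.
exists F1, F2; split=> //.
exact: (feedback_from_chart ac cp sk sb b0 Ef Eg Uo Vo Up UO UV VU psiK phiK sphi spsi sbeta beta0 D).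
Qed.

End Sufficiency.

(** * A trivialisation forces the curvatures *)

Section TrivialFields.
Context {R : realType}.
Local Notation E := 'rV[R]_3.

(** F, F' and F'' all have this shape: it is stable under the bracket with d/dw, and any two such
    fields commute because their coefficients depend on w alone while they have no w-component. *)
Definition planar_field (a b : R^o -> R^o) (z : E) : E :=
  row3 (a (z 0 ord_max)) (b (z 0 ord_max)) 0.

Lemma smooth_last (a : R^o -> R^o) : smooth_on setT a ->
  smooth_on setT (fun z : E => a (z 0 ord_max) : R^o).
Proof.
move=> sa; have sl : smooth_on setT (fun z : E => z 0 ord_max : R^o).
  exact: (smooth_entry ord_max openT (smooth_on_id _)).
exact: (smooth_comp1 (g := a) openT (fun _ _ => I) sl sa).
Qed.

Lemma derive_last (a : R^o -> R^o) (z v : E) : smooth_on setT a ->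
  'D_v (fun z : E => a (z 0 ord_max) : R^o) z = v 0 ord_max * 'D_1 a (z 0 ord_max).
Proof.
move=> sa; have da := smooth_differentiable (x := z 0 ord_max : R^o) sa I.
have dl : differentiable (fun z : E => z 0 ord_max : R^o) z.
  exact: (smooth_differentiable (smooth_entry ord_max (@openT E) (smooth_on_id _)) I).
rewrite (derive_comp (f := fun z : E => z 0 ord_max : R^o) (g := a) v dl da).
have -> : 'D_v (fun z : E => z 0 ord_max : R^o) z = v 0 ord_max.
  by rewrite (derive_entry (f := id))// derive_id.
transitivity ('D_(v 0 ord_max *: (1 : R^o)) a (z 0 ord_max)).
  by congr ('D_ _ a _); exact: esym (mulr1 _).
exact: (derive_scalev _ _ da).
Qed.

Lemma smooth_planar_field a b : smooth_on setT a -> smooth_on setT b ->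
  smooth_on setT (planar_field a b).
Proof.
by move=> sa sb; apply: smooth_row3; [exact: openT|exact: smooth_last|exact: smooth_last|exact: smooth_on_cst].
Qed.

Lemma derive_planar_field a b z v : smooth_on setT a -> smooth_on setT b ->
  'D_v (planar_field a b) z =
  v 0 ord_max *: planar_field (fun s => 'D_1 a s) (fun s => 'D_1 b s) z.
Proof.
move=> sa sb; have da := smooth_differentiable (smooth_last sa) (I : setT z).
have db := smooth_differentiable (smooth_last sb) (I : setT z).
rewrite (derive_row3 v da db (differentiable_cst _ _)) derive_cst !derive_last//.
by apply/rowP; apply: ord3P; rewrite !mxE/= ?mulr0.
Qed.

Lemma lbr_planar_fields a b a' b' z : smooth_on setT a -> smooth_on setT b ->
  smooth_on setT a' -> smooth_on setT b' ->
  lbr (planar_field a b) (planar_field a' b') z = 0.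
Proof.
by move=> *; rewrite lbrE !derive_planar_field// !mxE/= !scale0r subrr.
Qed.

Lemma lbr_vertical_planar a b z : smooth_on setT a -> smooth_on setT b ->
  lbr (fun=> row3 0 0 1) (planar_field a b) z =
  planar_field (fun s => 'D_1 a s) (fun s => 'D_1 b s) z.
Proof.
by move=> sa sb; rewrite lbrE derive_planar_field// derive_cst subr0 mxE/= scale1r.
Qed.

End TrivialFields.

(** * Bracket relations of a trivialising pair *)

Section StraightenedFrame.
Context {R : realType}.
Local Notation E := 'rV[R]_3.

(** Brackets are evaluated on the images under [Phi] and pulled back by injectivity of its
    differential. The last clause compares w-components, to which only [g1] contributes. *)
Lemma straightened_brackets (O : set E) (f1 g1 Phi : E -> E) (F1 F2 : R^o -> R^o) :
  let h1 := lbr g1 f1 in let m := lbr g1 h1 in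
  open O -> smooth_on O f1 -> smooth_on O g1 -> smooth_on O Phi ->
  smooth_on setT F1 -> smooth_on setT F2 ->
  (forall x v, O x -> 'D_v Phi x = 0 -> v = 0) ->
  (forall x, O x -> 'D_(f1 x) Phi x = planar_field F1 F2 (Phi x)) ->
  (forall x, O x -> 'D_(g1 x) Phi x = row3 0 0 1) ->
  [/\ forall x, O x -> lbr f1 h1 x = 0, forall x, O x -> lbr f1 m x = 0,
      forall x, O x -> lbr h1 m x = 0 &
      forall x l s t, O x -> m x = l *: f1 x + s *: h1 x + t *: g1 x -> t = 0].
Proof.
move=> h1 m Oo sf sg sP sF1 sF2 inj Df Dg.
have sh : smooth_on O h1 by exact: smooth_lbr.
have sm : smooth_on O m by exact: smooth_lbr.
have sF1' := smooth_derive (1 : R^o) sF1; have sF2' := smooth_derive (1 : R^o) sF2.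
have sF1'' := smooth_derive (1 : R^o) sF1'; have sF2'' := smooth_derive (1 : R^o) sF2'.
have OT y : O y -> [set: E] (Phi y) by [].
have sV : smooth_on [set: E] (fun=> row3 0 0 1 : E) by exact: smooth_on_cst.
have sT0 := smooth_planar_field sF1 sF2.
have sT1 := smooth_planar_field sF1' sF2'.
have sT2 := smooth_planar_field sF1'' sF2''.
have Dh x : O x -> 'D_(h1 x) Phi x = planar_field (fun s => 'D_1 F1 s) (fun s => 'D_1 F2 s) (Phi x).
  move=> Ox; rewrite (lbr_related Oo openT OT sP sg sf sV sT0 Dg Df Ox).
  exact: lbr_vertical_planar.
have Dm x : O x -> 'D_(m x) Phi x = planar_field (fun s => 'D_1 ('D_1 F1) s) (fun s => 'D_1 ('D_1 F2) s) (Phi x).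
  move=> Ox; rewrite (lbr_related Oo openT OT sP sg sh sV sT1 Dg Dh Ox).
  exact: lbr_vertical_planar.
split.
- move=> x Ox; apply: (inj x) => //.
  rewrite (lbr_related Oo openT OT sP sf sh sT0 sT1 Df Dh Ox).
  exact: lbr_planar_fields.
- move=> x Ox; apply: (inj x) => //.
  rewrite (lbr_related Oo openT OT sP sf sm sT0 sT2 Df Dm Ox).
  exact: lbr_planar_fields.
- move=> x Ox; apply: (inj x) => //.
  rewrite (lbr_related Oo openT OT sP sh sm sT1 sT2 Dh Dm Ox).
  exact: lbr_planar_fields.
move=> x l s t Ox em; have dP := smooth_differentiable sP Ox.
have := Dm x Ox; rewrite em !(derive_addv _ _ dP) !(derive_scalev _ _ dP) Df// Dh// Dg//.
by move=> /(congr1 (fun v : E => v 0 ord_max)); rewrite !mxE/= !mulr0 mulr1 !add0r.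
Qed.

Section Necessity.
Context (O : set E) (f1 g1 : E -> E) (eps mu nu kappa : E -> R^o).
Let h1 := lbr g1 f1.
Let m := lbr g1 h1.
Hypotheses (Oo : open O) (sf : smooth_on O f1) (sg : smooth_on O g1)
  (u : forall x, O x -> frame (f1 x) (h1 x) (g1 x) \in unitmx)
  (fh : forall x, O x -> lbr f1 h1 x = 0)
  (fm : forall x, O x -> lbr f1 m x = 0)
  (hm : forall x, O x -> lbr h1 m x = 0)
  (mg : forall x l s t, O x -> m x = l *: f1 x + s *: h1 x + t *: g1 x -> t = 0)
  (se : smooth_on O eps) (sn : smooth_on O nu)
  (ee : forall x, O x -> eps x * eps x = 1).

Let eps0 x : O x -> eps x != 0.
Proof.
by move=> Ox; apply/eqP => z; have := ee Ox; rewrite z mul0r => /esym/eqP; rewrite oner_eq0.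
Qed.

(** The g1-coefficients stay hidden behind [t], [t'], [t'']: the arguments below either compare
    other components or dispose of the g1-component of [m] through [mg]. *)
Lemma feedback_second_brackets (a b : E -> R^o) : smooth_on O a -> smooth_on O b ->
  let X := fun y => f1 y + a y *: g1 y in let Y := fun y => b y *: g1 y in
  forall x, O x -> exists t t' t'' : R,
    [/\ lbr Y X x = b x *: h1 x + t *: g1 x,
        lbr Y (lbr Y X) x =
          (b x * b x) *: m x + (b x * 'D_(g1 x) b x) *: h1 x + t' *: g1 x
      & exists s, lbr X (lbr Y X) x = (b x * a x) *: m x + s *: h1 x + t'' *: g1 x].
Proof.
move=> sa sb X Y x Ox.
have sh : smooth_on O h1 by exact: smooth_lbr.
have sX : smooth_on O X := smoothD Oo sf (smoothZ Oo sa sg).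
have sY : smooth_on O Y := smoothZ Oo sb sg.
pose p : E -> R^o := fun y => b y * 'D_(g1 y) a y - 'D_(X y) b y.
have sp : smooth_on O p.
  apply: smoothB => //; last exact: smooth_along.
  by apply: smoothM => //; exact: smooth_along.
have EH y : O y -> lbr Y X y = b y *: h1 y + p y *: g1 y.
  exact: (lbr_feedback Oo sf sg sa sb).
have sbh := smoothZ Oo sb sh; have spg := smoothZ Oo sp sg.
have dbh := smooth_differentiable sbh Ox; have dpg := smooth_differentiable spg Ox.
have da := smooth_differentiable sa Ox; have db := smooth_differentiable sb Ox.
have dp := smooth_differentiable sp Ox; have df := smooth_differentiable sf Ox.
have dg := smooth_differentiable sg Ox; have dh := smooth_differentiable sh Ox.
have dX := smooth_differentiable sX Ox; have dY := smooth_differentiable sY Ox.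
have dag := smooth_differentiable (smoothZ Oo sa sg) Ox.
have dbg := smooth_differentiable (smoothZ Oo sb sg) Ox.
have ZY : lbr Y (lbr Y X) x = lbr Y (fun y => b y *: h1 y + p y *: g1 y) x.
  by apply: (lbr_eq Oo Ox).
have ZX : lbr X (lbr Y X) x = lbr X (fun y => b y *: h1 y + p y *: g1 y) x.
  by apply: (lbr_eq Oo Ox).
exists (p x), (b x * 'D_(g1 x) p x - b x * 'D_(h1 x) b x - p x * 'D_(g1 x) b x).
exists ('D_(X x) p x - b x * 'D_(h1 x) a x - p x * 'D_(g1 x) a x); split.
- exact: EH.
- rewrite ZY (lbrDr dY dbh dpg) (lbrZr db dY dh) (lbrZr dp dY dg).
  rewrite (lbrZl db dh dg) (lbrZl db dg dg) lbrxx scaler0 sub0r.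
  rewrite !(derive_scalev _ _ db) !(derive_scalev _ _ dp) -/m.
  move: ('D_(g1 x) b x) ('D_(h1 x) b x) ('D_(g1 x) p x) (p x) (b x) => *.
  rewrite -/(m x).
  move: (m x) (h1 x) (g1 x) => w1 w2 w3.
  by apply/rowP => i; rewrite !mxE /GRing.scale/=; ring.
- exists ('D_(X x) b x - p x).
  rewrite ZX (lbrDr dX dbh dpg) (lbrZr db dX dh) (lbrZr dp dX dg).
  rewrite (lbrDl dh df dag) (lbrDl dg df dag) (lbrZl da dh dg) (lbrZl da dg dg) lbrxx.
  rewrite (lbrC g1 f1) -/h1 (fh Ox) scaler0 sub0r.
  rewrite -/(m x).
  move: ('D_(X x) b x) ('D_(h1 x) a x) ('D_(g1 x) a x) ('D_(X x) p x) (p x) (b x) (a x) => *.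
  move: (m x) (h1 x) (g1 x) => w1 w2 w3.
  by apply/rowP => i; rewrite !mxE; ring.
Qed.

Section CanonicalEquations.
Variables a b : E -> R^o.
Hypotheses (sa : smooth_on O a) (sb : smooth_on O b) (b0 : forall x, O x -> b x != 0).
Let X := fun y => f1 y + a y *: g1 y.
Let Y := fun y => b y *: g1 y.
Hypotheses (XXY : forall x, O x -> lbr X (lbr X Y) x = kappa x *: Y x)
  (YYX : forall x, O x -> lbr Y (lbr Y X) x = eps x *: X x + mu x *: Y x + nu x *: lbr Y X x).

Lemma feedback_eq0 x : O x -> a x = 0.
Proof.
move=> Ox; have [t [t' [t'' [e1 e2 [s e3]]]]] := feedback_second_brackets sa sb Ox.
have sX : smooth_on O X := smoothD Oo sf (smoothZ Oo sa sg).
have sY : smooth_on O Y := smoothZ Oo sb sg.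
move: (YYX Ox) (lbr_lbrC Oo Ox sX sY); rewrite (XXY Ox) e1 e2 e3 /X /Y.
move: ('D_(g1 x) b x) => d E2 E3.
(* The equation [X, [Y, X]] = - kappa Y is multiplied by [b], so that b^2 m can be replaced by its
   value from [Y, [Y, X]], where f1 has coefficient eps. The f1-component then reads a eps = 0. *)
have [/eqP + _ _] : [/\ a x * eps x = 0, a x * (nu x * b x - b x * d) + b x * s = 0 &
    a x * (eps x * a x + mu x * b x + nu x * t - t') + b x * (t'' + kappa x * b x) = 0].
  apply: (frame_inj0 (u Ox)).
  have {}E2 : (b x * b x) *: m x = eps x *: f1 x + (nu x * b x - b x * d) *: h1 x +
      (eps x * a x + mu x * b x + nu x * t - t') *: g1 x.
    have -> : (b x * b x) *: m x = ((b x * b x) *: m x + (b x * d) *: h1 x + t' *: g1 x) -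
      ((b x * d) *: h1 x + t' *: g1 x) by rewrite -[X in X - _]addrA addrK.
    rewrite [X in X - _]E2; move: (f1 x) (h1 x) (g1 x) => w1 w2 w3.
    by apply/rowP => i; rewrite !mxE; ring.
  have {}E3 : a x *: ((b x * b x) *: m x) + (b x * s) *: h1 x + (b x * (t'' + kappa x * b x)) *: g1 x = 0.
    have -> : 0 = b x *: (((b x * a x) *: m x + s *: h1 x + t'' *: g1 x) + kappa x *: (b x *: g1 x)).
      by rewrite [X in X + _]E3 addNr scaler0.
    move: (m x) (h1 x) (g1 x) => w1 w2 w3.
    by apply/rowP => i; rewrite !mxE; ring.
  rewrite -[RHS]E3 E2; move: (f1 x) (h1 x) (g1 x) => w1 w2 w3.
  by apply/rowP => i; rewrite !mxE; ring.
by rewrite mulf_eq0 (negPf (eps0 Ox)) orbF => /eqP.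
Qed.

Let lam : E -> R^o := fun y => (b y * b y : R^o)^-1 * eps y.
Let sig : E -> R^o := fun y => (b y : R^o)^-1 * (nu y - 'D_(g1 y) b y).

Let slam : smooth_on O lam.
Proof.
apply: smoothM => //; apply: smoothV => //; last exact: smoothM.
by move=> x Ox; rewrite mulf_neq0// b0.
Qed.

Let ssig : smooth_on O sig.
Proof.
apply: smoothM => //; first exact: smoothV.
by apply: smoothB => //; exact: smooth_along.
Qed.

Lemma second_bracket_decomp x : O x -> m x = lam x *: f1 x + sig x *: h1 x.
Proof.
move=> Ox; have [t [t' [t'' [e1 e2 _]]]] := feedback_second_brackets sa sb Ox.
move: (YYX Ox) (@mg x (lam x) (sig x)
  ((b x * b x)^-1 * (eps x * a x + mu x * b x + nu x * t - t')) Ox).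
rewrite e1 e2 /X /Y /lam /sig; move: ('D_(g1 x) b x) (b0 Ox) => d bx E2.
have Em : m x = ((b x * b x)^-1 * eps x) *: f1 x + ((b x)^-1 * (nu x - d)) *: h1 x +
    ((b x * b x)^-1 * (eps x * a x + mu x * b x + nu x * t - t')) *: g1 x.
  have -> : m x = (b x * b x)^-1 *: (((b x * b x) *: m x + (b x * d) *: h1 x + t' *: g1 x) -
      ((b x * d) *: h1 x + t' *: g1 x)).
    by rewrite -[X in X - _]addrA addrK scalerA mulVf ?scale1r// mulf_neq0.
  rewrite [X in X - _]E2; move: (f1 x) (h1 x) (g1 x) => w1 w2 w3.
  by apply/rowP => i; rewrite !mxE; field.
move=> /(_ Em) z; rewrite {1}Em z scale0r addr0.
by [].
Qed.

(** When Z commutes with f1 and h1, [Z, m] = Z(lam) f1 + Z(sig) h1; so commuting with m as well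
    forces both derivatives to vanish. *)
Let Dcoef (Z : E -> E) x : smooth_on O Z -> O x -> lbr Z f1 x = 0 -> lbr Z h1 x = 0 ->
  lbr Z m x = 0 -> 'D_(Z x) lam x = 0 /\ 'D_(Z x) sig x = 0.
Proof.
move=> sZ Ox Zf Zh; have sh : smooth_on O h1 by exact: smooth_lbr.
have dZ := smooth_differentiable sZ Ox.
have df := smooth_differentiable sf Ox; have dh := smooth_differentiable sh Ox.
have dl := smooth_differentiable slam Ox; have ds := smooth_differentiable ssig Ox.
have dlf := smooth_differentiable (smoothZ Oo slam sf) Ox.
have dsh := smooth_differentiable (smoothZ Oo ssig sh) Ox.
have -> : lbr Z m x = lbr Z (fun y => lam y *: f1 y + sig y *: h1 y) x.
  exact: (lbr_eq Oo Ox (fun y _ => erefl (Z y)) (fun y Oy => second_bracket_decomp Oy)).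
rewrite (lbrDr dZ dlf dsh) (lbrZr dl dZ df) (lbrZr ds dZ dh) Zf Zh !scaler0 !addr0 => e.
have [] := @frame_inj0 R _ _ _ ('D_(Z x) lam x) ('D_(Z x) sig x) 0 (u Ox).
  by rewrite scale0r addr0.
by [].
Qed.

(** Differentiate lam b^2 = eps, whose right-hand side is locally constant; lam and b vanish
    nowhere. *)
Let Db (Z : E -> E) x : O x -> 'D_(Z x) lam x = 0 -> 'D_(Z x) b x = 0.
Proof.
move=> Ox e; have De := derive_sign (Z x) Oo Ox se ee.
have dl := smooth_differentiable slam Ox; have db := smooth_differentiable sb Ox.
have [dbb Dbb] := derive_fZ (Z x) db db; have [_ D] := derive_fZ (Z x) dl dbb.
have : 'D_(Z x) (fun y => lam y *: (b y *: b y) : R^o) x = 'D_(Z x) eps x.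
  apply: near_eq_derive; apply: filterS (nbhs_open Oo Ox) => y Oy.
  rewrite /lam -[LHS]/((b y * b y)^-1 * eps y * (b y * b y)).
  by rewrite mulrAC mulVf ?mul1r// mulf_neq0// b0.
rewrite D De Dbb e scale0r add0r.
have l0 : lam x != 0 by rewrite mulf_neq0 ?eps0// invr_eq0 mulf_neq0// b0.
move: ('D_(Z x) b x) => d; rewrite -[LHS]/(lam x * (d * b x + b x * d)) [b x * d]mulrC -mulr2n => /eqP.
by rewrite mulf_eq0 (negPf l0)/= mulrn_eq0/= mulf_eq0 (negPf (b0 Ox)) orbF => /eqP.
Qed.

Let bf x : O x -> 'D_(f1 x) b x = 0 /\ 'D_(f1 x) sig x = 0.
Proof.
move=> Ox; have [] := Dcoef sf Ox (lbrxx _ _) (fh Ox) (fm Ox).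
by move=> /(Db Ox).
Qed.

Let bh x : O x -> 'D_(h1 x) b x = 0 /\ 'D_(h1 x) sig x = 0.
Proof.
move=> Ox; have sh : smooth_on O h1 by exact: smooth_lbr.
have hf : lbr h1 f1 x = 0 by rewrite (lbrC f1 h1) fh// oppr0.
have [] := Dcoef sh Ox hf (lbrxx _ _) (hm Ox).
by move=> /(Db Ox).
Qed.

Lemma curvature_eq0 x : O x -> kappa x = 0.
Proof.
move=> Ox; have sh : smooth_on O h1 by exact: smooth_lbr.
have sX : smooth_on O X := smoothD Oo sf (smoothZ Oo sa sg).
have sY : smooth_on O Y := smoothZ Oo sb sg.
have EX y : O y -> X y = f1 y by move=> Oy; rewrite /X feedback_eq0// scale0r addr0.
have EH y : O y -> lbr Y X y = b y *: h1 y.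
  move=> Oy; rewrite (lbr_eq Oo Oy (fun y _ => erefl (Y y)) EX).
  have df := smooth_differentiable sf Oy; have dg := smooth_differentiable sg Oy.
  have db := smooth_differentiable sb Oy.
  by rewrite (lbrZl db df dg) (bf Oy).1 scale0r subr0.
have : lbr X (lbr Y X) x = lbr f1 (fun y => b y *: h1 y) x.
  exact: (lbr_eq Oo Ox EX EH).
have df := smooth_differentiable sf Ox; have dh := smooth_differentiable sh Ox.
have db := smooth_differentiable sb Ox.
rewrite (lbrZr db df dh) (bf Ox).1 fh// scale0r scaler0 addr0 (lbr_lbrC Oo Ox sX sY) XXY// /Y.
rewrite scalerA => e.
have [] := @frame_inj0 R _ _ _ 0 0 (kappa x * b x) (u Ox).
  by rewrite !scale0r !add0r; apply: oppr_inj; rewrite e oppr0.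
by move=> _ _ /eqP; rewrite mulf_eq0 (negPf (b0 Ox)) orbF => /eqP.
Qed.

(** Write nu = sig b + g1(b). Z kills the first term, and Z(g1(b)) = [Z, g1](b) + g1(Z(b)), where
    both summands vanish. *)
Let Dnu (Z : E -> E) x : smooth_on O Z -> O x ->
  (forall y, O y -> 'D_(Z y) b y = 0) -> 'D_(Z x) sig x = 0 ->
  'D_(lbr Z g1 x) b x = 0 -> 'D_(Z x) nu x = 0.
Proof.
move=> sZ Ox Zb Zs ZGb.
have sgb : smooth_on O (fun y => 'D_(g1 y) b y) by exact: smooth_along.
have dgb := smooth_differentiable sgb Ox.
have ds := smooth_differentiable ssig Ox; have db := smooth_differentiable sb Ox.
have [dbs Dbs] := derive_fZ (Z x) ds db.
have -> : 'D_(Z x) nu x = 'D_(Z x) (fun y => sig y *: b y + 'D_(g1 y) b y : R^o) x.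
  apply: near_eq_derive; apply: filterS (nbhs_open Oo Ox) => y Oy.
  rewrite -[_ *: _]/(_ * _) /sig mulrAC mulVf ?b0// mul1r subrK.
  by [].
rewrite (derive_fD (Z x) dbs dgb) Dbs Zs (Zb x Ox).
move: ZGb; rewrite (lbr_apply Oo Ox sZ sg sb).
have -> : 'D_(g1 x) (fun y => 'D_(Z y) b y) x = 'D_(g1 x) (cst 0 : E -> R^o) x.
  by apply: near_eq_derive; apply: filterS (nbhs_open Oo Ox) => y; exact: Zb.
by rewrite derive_cst subr0 => ->; rewrite scaler0 scale0r !addr0.
Qed.

Lemma affine_curvature_constant x : O x ->
  'D_(X x) nu x = 0 /\ 'D_(lbr X Y x) nu x = 0.
Proof.
move=> Ox; have sh : smooth_on O h1 by exact: smooth_lbr.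
have db := smooth_differentiable sb Ox; have dn := smooth_differentiable sn Ox.
(* [f1, g1] = - h1 and [h1, g1] = - m. As m is a combination of f1 and h1, both brackets kill [b],
   as [Dnu] demands. *)
have nf : 'D_(f1 x) nu x = 0.
  apply: (Dnu sf Ox (fun y Oy => (bf Oy).1) (bf Ox).2).
  by rewrite (lbrC g1 f1) -scaleN1r (derive_scalev _ _ db) (bh Ox).1 scaler0.
have nh : 'D_(h1 x) nu x = 0.
  apply: (Dnu sh Ox (fun y Oy => (bh Oy).1) (bh Ox).2).
  rewrite (lbrC g1 h1) -scaleN1r (derive_scalev _ _ db) -/m second_bracket_decomp//.
  by rewrite (derive_addv _ _ db) !(derive_scalev _ _ db) (bf Ox).1 (bh Ox).1 !scaler0 addr0 scaler0.
have EX y : O y -> X y = f1 y by move=> Oy; rewrite /X feedback_eq0// scale0r addr0.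
split; first by rewrite EX.
rewrite (lbr_eq Oo Ox EX (fun y _ => erefl (Y y))).
have df := smooth_differentiable sf Ox; have dg := smooth_differentiable sg Ox.
rewrite (lbrZr db df dg) (bf Ox).1 scale0r add0r (lbrC g1 f1) scalerN -scaleNr.
by rewrite (derive_scalev _ _ dn) nh scaler0.
Qed.

End CanonicalEquations.
End Necessity.
End StraightenedFrame.

(** * From the chart back to the manifold *)

Section NecessityOnManifolds.
Context {R : realType} {M : manifold R 3}.
Implicit Types (f g fc gc : M -> 'rV[R]_3).
Local Notation E := 'rV[R]_3.

Lemma lbr_lbr_eq (U : set E) (X Y Z X' Y' Z' : E -> E) x : open U -> U x ->
  (forall y, U y -> X y = X' y) -> (forall y, U y -> Y y = Y' y) ->
  (forall y, U y -> Z y = Z' y) -> lbr X (lbr Y Z) x = lbr X' (lbr Y' Z') x.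
Proof.
move=> Uo Ux EX EY EZ; apply: (lbr_eq Uo Ux EX) => y Uy.
exact: (lbr_eq Uo Uy EY EZ).
Qed.

Lemma trivialisation_in_chart f g p (F1 F2 : R^o -> R^o) (c := chart_at p) :
  feedback_equivalent_near p f g (trivial_drift F1 F2) (@trivial_control R) ->
  exists (O : set E) (Phi : E -> E) (al be : E -> R^o),
    let f1 := fun x => in_chart c f x + al x *: in_chart c g x in
    let g1 := fun x => be x *: in_chart c g x in
    [/\ [/\ open O, O (c p) & O `<=` c @` dom c],
        [/\ smooth_on O Phi, smooth_on O al, smooth_on O be & forall x, O x -> be x != 0],
        forall x v, O x -> 'D_v Phi x = 0 -> v = 0,
        forall x, O x -> 'D_(f1 x) Phi x = planar_field F1 F2 (Phi x)
      & forall x, O x -> 'D_(g1 x) Phi x = row3 0 0 1].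
Proof.
move=> [U [V [phi [psi [al [be [[Uo Up] Vo [UV VU psiK phiK [[cphi sphi] [cpsi spsi]]]
  [sal sbe be0] D]]]]]]].
have ac : atlas c := chart_at_atlas p; have cp : dom c p := chart_at_dom p.
pose O := c @` (dom c `&` U); pose Phi : E -> E := phi \o cinv c.
have Oo : open O.
  by apply: chart_image_open => [|q []//]; apply: openI => //; exact: dom_open.
have sPhi : smooth_on O Phi.
  by have := sphi c (id_chart R 3) ac erefl; rewrite preimage_setT setIT.
exists O, Phi, (al \o cinv c), (be \o cinv c) => f1 g1.
split.
- by split=> //; [exists p|move=> _ [q [cq _] <-]; exists q].
- split=> //; [exact: sal|exact: sbe|].
  by move=> _ [q [cq Uq] <-]; rewrite /= cmapK//; exact: be0.
- move=> x v Ox Dv; have dP := smooth_differentiable sPhi Ox.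
  have := Ox => -[q [cq Uq] xq].
  (* [c \o psi] is a differentiable left inverse of [Phi] near [x], so the chain rule makes the
     differential of [Phi] injective. *)
  have s1 := spsi (id_chart R 3) c erefl ac; rewrite image_id setTI in s1.
  have Px : Phi x = phi q by rewrite -xq /Phi /= cmapK.
  have VP : (V `&` psi @^-1` dom c) (Phi x).
    by rewrite Px; split; [apply: UV; exists q|rewrite /= psiK].
  have d1 : differentiable (c \o psi : E -> E) (Phi x) := smooth_differentiable s1 VP.
  rewrite -(derive_id x v).
  have -> : 'D_v (id : E -> E) x = 'D_v ((c \o psi : E -> E) \o Phi) x.
    apply: near_eq_derive; apply: filterS (nbhs_open Oo Ox) => y [q' [cq' Uq'] <-].
    by rewrite /Phi /= cmapK// psiK.
  by rewrite (derive_comp v dP d1) Dv derive0.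
- move=> _ [q [cq Uq] <-]; have [D1 _] := D q Uq.
  have Ocq : O (c q) by exists q.
  have dP : differentiable (phi \o cinv c : E -> E) (c q) := smooth_differentiable sPhi Ocq.
  have Oc : (c @` dom c) (c q) by exists q.
  move: D1; rewrite (differential_at_chart (phi := phi) (fun q => f q + al q *: g q) ac cq dP).
  by rewrite (in_chartD f (fun q => al q *: g q) ac Oc) (in_chartZ al g ac Oc) /f1 /Phi /= cmapK// => <-.
- move=> _ [q [cq Uq] <-]; have [_ D1] := D q Uq.
  have Ocq : O (c q) by exists q.
  have dP : differentiable (phi \o cinv c : E -> E) (c q) := smooth_differentiable sPhi Ocq.
  have Oc : (c @` dom c) (c q) by exists q.
  move: D1; rewrite (differential_at_chart (phi := phi) (fun q => be q *: g q) ac cq dP).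
  by rewrite (in_chartZ be g ac Oc) /g1 /Phi /= cmapK// => <-.
Qed.

Lemma curvatures_of_trivialisable f g fc gc (kappa nu : M -> R) p :
  smooth_field f -> smooth_field g -> regular f g -> canonical_pair_of f g fc gc ->
  curvatures fc gc kappa nu -> locally_trivialisable f g ->
  [/\ kappa p = 0, lie_derivative fc nu p = 0
    & lie_derivative (lie_bracket fc gc) nu p = 0].
Proof.
move=> sf sg reg can [_ snu [eps [mu [smu eps1 ffg ggf]]]] triv.
have [F1 [F2 [sF1 sF2 /trivialisation_in_chart]]] := triv p.
case=> O [Phi [al [be []]]].
have [k [b [sk sb b0 Ef Eg]]] := canonical_pair_feedback reg can.
have sfc : smooth_field fc.
  have -> : fc = (fun q => f q + k q *: g q) by apply/funext.
  exact: (smooth_fieldD sf (smooth_fieldZ sk sg)).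
have sgc : smooth_field gc.
  have -> : gc = (fun q => b q *: g q) by apply/funext.
  exact: (smooth_fieldZ sb sg).
have cp := chart_at_dom p; have ac := chart_at_atlas p.
move: (chart_at p) cp ac => c cp ac.
have uF x (Ox : (c @` dom c) x) := canonical_frame sf sg reg ac sk sb b0 Ef Eg Ox.
have [XXY YYX seps] := canonical_brackets sfc sgc ac uF ffg ggf.
move=> [Oo Op Oc] [sPhi sal sbe be0] inj Df Dg.
pose F := in_chart c f; pose G := in_chart c g.
have sF : smooth_on O F by apply: smooth_sub Oc _; exact: sf.
have sG : smooth_on O G by apply: smooth_sub Oc _; exact: sg.
pose f1 x := F x + al x *: G x; pose g1 x := be x *: G x.
have sf1 : smooth_on O f1 := smoothD Oo sF (smoothZ Oo sal sG).
have sg1 : smooth_on O g1 := smoothZ Oo sbe sG.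
have u x : O x -> frame (f1 x) (lbr g1 f1 x) (g1 x) \in unitmx.
  move=> Ox; apply: (frame_feedback Oo sF sG sal sbe Ox (be0 x Ox)).
  exact: (regular_frame sf sg reg ac (Oc x Ox)).
have [fh fm hm mg] := straightened_brackets Oo sf1 sg1 sPhi sF1 sF2 inj Df Dg.
have sk' := smooth_sub Oc (smooth_function_chart sk ac).
have sb' := smooth_sub Oc (smooth_function_chart sb ac).
have sbeV := smoothV Oo be0 sbe.
(* The canonical pair is rewritten as a feedback of the trivialising pair: f + k g = f1 + (k - al) g
   and g = g1 / be. *)
pose a1 : E -> R^o := fun x => (be x : R^o)^-1 * ((k (cinv c x) : R^o) - al x).
pose b1 : E -> R^o := fun x => (be x : R^o)^-1 * b (cinv c x).
have sa1 : smooth_on O a1 := smoothM Oo sbeV (smoothB Oo sk' sal).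
have sb1 : smooth_on O b1 := smoothM Oo sbeV sb'.
have b10 x : O x -> b1 x != 0 by move=> Ox; rewrite mulf_neq0 ?b0// invr_eq0 be0.
have EX x : O x -> in_chart c fc x = f1 x + a1 x *: g1 x.
  move=> Ox; rewrite (in_chart_feedback ac (Oc x Ox) Ef) /f1 /g1 /a1 -/F -/G.
  move: (be0 x Ox) => nz.
  by rewrite scalerA mulrAC mulVf// mul1r -addrA -scalerDl subrKC.
have EY x : O x -> in_chart c gc x = b1 x *: g1 x.
  move=> Ox; rewrite (in_chart_scaling ac (Oc x Ox) Eg) /g1 /b1 -/G.
  by rewrite scalerA mulrAC mulVf ?be0// mul1r.
have XXY' x : O x -> lbr (fun y => f1 y + a1 y *: g1 y)
    (lbr (fun y => f1 y + a1 y *: g1 y) (fun y => b1 y *: g1 y)) x =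
    kappa (cinv c x) *: (b1 x *: g1 x).
  by move=> Ox; rewrite -(lbr_lbr_eq Oo Ox EX EX EY) (XXY x (Oc x Ox)) (EY x Ox).
have YYX' x : O x -> lbr (fun y => b1 y *: g1 y)
    (lbr (fun y => b1 y *: g1 y) (fun y => f1 y + a1 y *: g1 y)) x =
    eps (cinv c x) *: (f1 x + a1 x *: g1 x) + mu (cinv c x) *: (b1 x *: g1 x) +
    nu (cinv c x) *: lbr (fun y => b1 y *: g1 y) (fun y => f1 y + a1 y *: g1 y) x.
  move=> Ox; rewrite -(lbr_lbr_eq Oo Ox EY EY EX) (YYX x (Oc x Ox)) (EY x Ox) (EX x Ox).
  by rewrite (lbr_eq Oo Ox EY EX).
have snu' := smooth_sub Oc (smooth_function_chart snu ac).
have seps' := smooth_sub Oc seps.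
have ee x : O x -> (eps (cinv c x) : R^o) * eps (cinv c x) = 1.
  by move=> _; case: (eps1 (cinv c x)) => ->; rewrite ?mulr1 ?mulrNN ?mulr1.
have kap := curvature_eq0 (mu := mu \o cinv c) (kappa := kappa \o cinv c)
  Oo sf1 sg1 u fh fm mg seps' snu' ee sa1 sb1 b10 XXY' YYX' Op.
have [Xn Hn] := affine_curvature_constant (mu := mu \o cinv c) (kappa := kappa \o cinv c)
  Oo sf1 sg1 u fh fm hm mg seps' snu' ee sa1 sb1 b10 XXY' YYX' Op.
have Ocp : (c @` dom c) (c p) by exists p.
split.
- by move: kap; rewrite /= cmapK.
- have -> := lie_derivative_chart fc openT I snu ac cp.
  by rewrite EX.
- have -> := lie_derivative_chart (lie_bracket fc gc) openT I snu ac cp.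
  by rewrite (in_chart_bracket sfc sgc ac Ocp) (lbr_eq Oo Op EX EY).
Qed.

End NecessityOnManifolds.

Theorem theorem3 (R : realType) (M : manifold R 3)
    (f g : M -> 'rV[R]_3)
    (f_smooth : smooth_field f) (g_smooth : smooth_field g)
    (fg_regular : regular f g)
    (fc gc : M -> 'rV[R]_3) (fc_gc_canonical : canonical_pair_of f g fc gc)
    (kappa nu : M -> R) (kappa_nu_curvatures : curvatures fc gc kappa nu) :
  locally_trivialisable f g <->
  [/\ forall p : M, kappa p = 0,
      forall p : M, lie_derivative fc nu p = 0
    & forall p : M, lie_derivative (lie_bracket fc gc) nu p = 0].
Proof.
split=> [triv|[k0 fn hn]]; last first.
  exact: (trivialisable_of_curvatures f_smooth g_smooth fg_regular fc_gc_canonical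
    kappa_nu_curvatures).
have H p := curvatures_of_trivialisable p f_smooth g_smooth fg_regular
  fc_gc_canonical kappa_nu_curvatures triv.
by split=> p; have [] := H p.
Qed.
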